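(* Let $n\ge 1$ be an integer and $k$ a field whose characteristic is zero or odd. Let $S$ be the polynomial ring over $k$ in the $4n$ indeterminates $p_{1i},p_{2i},q_{1i},q_{2i}$ ($1\le i\le n$), $\mathbb{N}^2$-graded with all $p_{1i},p_{2i}$ of degree $[1,0]$ and all $q_{1i},q_{2i}$ of degree $[0,1]$, and let $Z=S/I$, where $I$ is generated by the $2n^2+n$ quadratic forms $$p_{1i}q_{1j}-p_{2i}q_{2j}\ (1\le i,j\le n),\qquad p_{1i}q_{2i},\ p_{2i}q_{1i}\ (1\le i\le n),$$ $$p_{1i}q_{2j}+p_{1j}q_{2i},\quad p_{2i}q_{1j}+p_{2j}q_{1i}\ (1\le i<j\le n).$$ The graded Betti numbers of $Z$ over $S$ are $$\beta^S_{i,v}(Z)=\begin{cases}1 & \text{if } i=0 \text{ and } v=[0,0],\\ 2n^2+n & \text{if } i=1 \text{ and } v=[1,1],\\ (2n^2-n)\binom{2n}{v_1-1}\binom{2n}{v_2-1}-\binom{2n}{v_1}\binom{2n}{v_2} & \text{if } i\ge 2,\ v_1,v_2\ge 1 \text{ and } v_1+v_2=i+2,\end{cases}$$ and $\beta^S_{i,v}(Z)=0$ in all other cases. The Betti numbers of $Z$ over $S$ are $$\beta^S_i(Z)=\begin{cases}1 & \text{for } i=0,\\ 2n^2+n & \text{for } i=1,\\ (2n^2-n)\binom{4n}{i}-\binom{4n}{i+2}+2\binom{2n}{i+2} & \text{for } i\ge 2.\end{cases}$$ Moreover, $\dim Z=2n$ and $\operatorname{depth} Z=0$.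
   Context: For a finitely generated $\mathbb{N}^2$-graded $S$-module $M$, $\beta^S_{i,v}(M)=\operatorname{rank}_k\operatorname{Tor}^S_i(k,M)_v$ for $i\in\mathbb{N}$, $v=[v_1,v_2]\in\mathbb{N}^2$, where $k$ is $S$ modulo its homogeneous maximal ideal, and $\beta^S_i(M)=\sum_v\beta^S_{i,v}(M)$. $\dim$ is Krull dimension and $\operatorname{depth}$ is taken with respect to the homogeneous maximal ideal. *)

(* Defs.v *)
From HB Require Import structures.
From mathcomp Require Import all_boot all_order all_algebra.
From mathcomp Require Import generic_quotient ring_quotient mpoly.
From mathcomp Require boolp.

Set Implicit Arguments.
Unset Strict Implicit.
Unset Printing Implicit Defensive.

Import GRing.Theory.
Local Open Scope ring_scope.

(* c 0, ..., c d is a strictly increasing chain of prime ideals; idealr_closed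
   contains the properness 1 \notin c j. *)
Definition prime_chain (R : comNzRingType) (c : nat -> {pred R}) (d : nat) :
    Prop :=
  (forall j, (j <= d)%N -> idealr_closed (c j) /\ prime_idealr_closed (c j)) /\
  (forall j, (j < d)%N ->
     {subset c j <= c j.+1} /\ exists2 x, x \in c j.+1 & x \notin c j).

Definition krull_dim (R : comNzRingType) (d : nat) : Prop :=
  (exists c, @prime_chain R c d) /\
  (forall c e, @prime_chain R c e -> (e <= d)%N).

Section Depth.
Variables (R : comNzRingType) (M : lmodType R).

(* z lies in (s_0, ..., s_(l-1)) M. *)
Definition in_seqM (s : seq R) (z : M) : Prop :=
  exists w : 'I_(size s) -> M, z = \sum_(j < size s) s`_j *: w j.

Definition regular_seq (s : seq R) : Prop :=
  (forall j, (j < size s)%N -> forall z : M,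
     in_seqM (take j s) (s`_j *: z) -> in_seqM (take j s) z) /\
  (exists z, ~ in_seqM s z).

Definition depth (m : R -> Prop) (d : nat) : Prop :=
  (exists s : seq R,
     [/\ size s = d, regular_seq s & forall x, x \in s -> m x]) /\
  (forall s : seq R,
     regular_seq s -> (forall x, x \in s -> m x) -> (size s <= d)%N).
End Depth.

Section GradedBetti.
(* S = k[x_0, ..., x_(N-1)], with x_j of degree wt j in N^2. *)
Variables (k : fieldType) (N : nat) (wt : 'I_N -> nat * nat).
Local Notation S := {mpoly k[N]}.

Definition bideg (a : 'X_{1..N}) : nat * nat := \sum_(j < N) wt j *+ a j.

Definition bihomog (v : nat * nat) (f : S) : Prop :=
  forall a, a \in msupp f -> bideg a = v.

(* The homogeneous maximal ideal m: zero constant term. *)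
Definition hmax (f : S) : Prop := f@_0%MM = 0.

(* Graded resolutions of k = S/m by finitely generated graded free S-modules.
   The i-th module has a basis indexed by 'I_(rk i), of degrees dg; the
   differentials act on row vectors; f in S acts on k as its constant term. *)
Record gfree_res := GFreeRes {
  rk : nat -> nat;
  dg : forall i, 'I_(rk i) -> nat * nat;
  df : forall i, 'M[S]_(rk i.+1, rk i);
  aug : 'I_(rk 0) -> k;
  df_homog : forall i a b m,
    m \in msupp (df i a b) -> bideg m + dg b = dg a;
  aug_homog : forall b, aug b != 0 -> dg b = 0;
  res_exact : forall i (x : 'rV[S]_(rk i.+1)),
    x *m df i = 0 <-> exists y : 'rV[S]_(rk i.+2), x = y *m df i.+1;
  res_exact0 : forall x : 'rV[S]_(rk 0),
    \sum_b (x 0 b)@_0%MM * aug b = 0 <->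
    exists y : 'rV[S]_(rk 1), x = y *m df 0;
  aug_surj : forall c : k,
    exists x : 'rV[S]_(rk 0), \sum_b (x 0 b)@_0%MM * aug b = c
}.

(* dim_k (A / (A \cap B)) = r, for k-subspaces A and B of an S-module V. *)
Definition subquot_dim (V : lmodType S) (A B : V -> Prop) (r : nat) : Prop :=
  exists b : 'I_r -> V,
    [/\ forall j, A (b j),
        forall x, A x ->
          exists c : 'I_r -> k, B (x - \sum_j (c j)%:MP *: b j)
      & forall c : 'I_r -> k,
          B (\sum_j (c j)%:MP *: b j) -> forall j, c j = 0].

(* An N^2-graded S-module: gr v is the component M_v. *)
Variables (M : lmodType S) (gr : nat * nat -> M -> Prop).

Section Tensor.
(* P_i \otimes_S M is identified with M^(rk i). *)
Variable P : gfree_res.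

Definition tens_homog (i : nat) (v : nat * nat)
    (x : {ffun 'I_(rk P i) -> M}) : Prop :=
  forall a, x a = 0 \/ exists2 u, u + dg a = v & gr u (x a).

Definition tens_cycle (i : nat) : {ffun 'I_(rk P i) -> M} -> Prop :=
  match i with
  | 0%N => fun=> True
  | j.+1 => fun x => forall b, \sum_a df P j a b *: x a = 0
  end.

Definition tens_boundary (i : nat) (x : {ffun 'I_(rk P i) -> M}) : Prop :=
  exists y : {ffun 'I_(rk P i.+1) -> M},
    forall b, x b = \sum_a df P i a b *: y a.

Definition tor_rank (i : nat) (v : nat * nat) (r : nat) : Prop :=
  subquot_dim (fun x => tens_homog v x /\ tens_cycle x)
    (@tens_boundary i) r.
End Tensor.

(* rank_k Tor^S_i(k, M)_v = r, for one and for all resolutions of k. *)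
Definition graded_betti (i : nat) (v : nat * nat) (r : nat) : Prop :=
  inhabited gfree_res /\ forall P : gfree_res, tor_rank P i v r.

(* The sum over all v in N^2 of the i-th graded Betti numbers, of which only
   finitely many (all in s) are nonzero, is r. *)
Definition betti (i : nat) (r : nat) : Prop :=
  exists (b : nat * nat -> nat) (s : seq (nat * nat)),
    [/\ forall v, graded_betti i v (b v),
        uniq s,
        forall v, v \notin s -> b v = 0%N
      & r = (\sum_(v <- s) b v)%N].
End GradedBetti.

Section TheRing.
Variables (k : fieldType) (n : nat).
Local Notation S := {mpoly k[(n + n) + (n + n)]}.

Definition p1 (i : 'I_n) : S := 'X_(lshift (n + n) (lshift n i)).
Definition p2 (i : 'I_n) : S := 'X_(lshift (n + n) (rshift n i)).
Definition q1 (i : 'I_n) : S := 'X_(rshift (n + n) (lshift n i)).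
Definition q2 (i : 'I_n) : S := 'X_(rshift (n + n) (rshift n i)).

Definition pq_wt (j : 'I_((n + n) + (n + n))) : nat * nat :=
  if split j is inl _ then (1%N, 0%N) else (0%N, 1%N).

Definition quads : seq S :=
  [seq p1 i * q1 j - p2 i * q2 j | i <- enum 'I_n, j <- enum 'I_n] ++
  [seq p1 i * q2 i | i <- enum 'I_n] ++
  [seq p2 i * q1 i | i <- enum 'I_n] ++
  [seq p1 i * q2 j + p1 j * q2 i
     | i <- enum 'I_n, j <- [seq j : 'I_n <- enum 'I_n | (i < j)%N]] ++
  [seq p2 i * q1 j + p2 j * q1 i
     | i <- enum 'I_n, j <- [seq j : 'I_n <- enum 'I_n | (i < j)%N]].

Definition quad_ideal : {pred S} := fun f =>
  boolp.asbool (exists c : 'I_(size quads) -> S, f = \sum_(j < size quads) c j * quads`_j).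

Lemma quads_coef0 f : f \in quads -> f@_0%MM = 0.
Proof.
have XX i j : ('X_i * 'X_j : S)@_0%MM = 0.
  by rewrite -mpolyXD mcoeffX mnmD_eq0 mnm1_eq0.
rewrite !mem_cat => /or4P[/allpairsPdep[i [j [_ _ ->]]]|/mapP[i _ ->]
  |/mapP[i _ ->]|/orP[]/allpairsPdep[i [j [_ _ ->]]]];
  by rewrite ?mcoeffB ?mcoeffD !XX ?subr0 ?addr0.
Qed.

Lemma quad_ideal_closed : idealr_closed quad_ideal.
Proof.
split.
- apply/boolp.asboolP; exists (fun=> 0).
  by rewrite big1 // => j _; rewrite mul0r.
- apply/negP => /boolp.asboolP[c /(congr1 (mcoeff 0%MM))].
  rewrite mcoeff1 eqxx raddf_sum big1 /=.
    by move/eqP; rewrite oner_eq0.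
  move=> j _; rewrite (rmorphM (mcoeff 0%MM)) /=.
  by rewrite [X in _ * X]quads_coef0 ?mulr0 // mem_nth.
- move=> a u v /boolp.asboolP[cu ->] /boolp.asboolP[cv ->].
  apply/boolp.asboolP; exists (fun j => a * cu j + cv j).
  rewrite mulr_sumr -big_split /=; apply: eq_bigr => j _.
  by rewrite mulrDl mulrA.
Qed.

HB.instance Definition _ := isIdealr.Build S quad_ideal quad_ideal_closed.

Definition Zring : Type := {ideal_quot quad_ideal}.
HB.instance Definition _ := GRing.ComNzRing.on Zring.

Definition Zproj (f : S) : Zring := (\pi_{ideal_quot quad_ideal} f)%qT.

Lemma Zproj_monoid : monoid_morphism Zproj.
Proof. exact: (pi_is_monoid_morphism {ideal_quot quad_ideal}). Qed.

Lemma Zproj_zmod : zmod_morphism Zproj.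
Proof. exact: (pi_is_zmod_morphism {ideal_quot quad_ideal}). Qed.

HB.instance Definition _ := GRing.isZmodMorphism.Build S Zring Zproj Zproj_zmod.
HB.instance Definition _ :=
  GRing.isMonoidMorphism.Build S Zring Zproj Zproj_monoid.

Definition Zscale (f : S) (z : Zring) : Zring := Zproj f * z.

Lemma ZscaleA f g z : Zscale f (Zscale g z) = Zscale (f * g) z.
Proof. by rewrite /Zscale mulrA rmorphM. Qed.
Lemma Zscale1 : left_id 1 Zscale.
Proof. by move=> z; rewrite /Zscale rmorph1 mul1r. Qed.
Lemma ZscaleDr : right_distributive Zscale +%R.
Proof. by move=> f z t; rewrite /Zscale mulrDr. Qed.
Lemma ZscaleDl z : {morph Zscale^~ z : f g / f + g}.
Proof. by move=> f g; rewrite /Zscale rmorphD mulrDl. Qed.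

HB.instance Definition _ := GRing.Zmodule_isLmodule.Build S Zring
  ZscaleA Zscale1 ZscaleDr ZscaleDl.

Definition Zgr (v : nat * nat) (z : Zring) : Prop :=
  exists2 f, bihomog pq_wt v f & z = Zproj f.
End TheRing.

(* Main.v *)
Require Import Defs.
From HB Require Import structures.
From mathcomp Require Import all_boot all_order all_algebra.
From mathcomp Require Import generic_quotient ring_quotient mpoly.
From mathcomp Require boolp.
From mathcomp Require Import zify ring.

Set Implicit Arguments.
Unset Strict Implicit.
Unset Printing Implicit Defensive.

Import GRing.Theory.
Local Open Scope ring_scope.

(** Write V and W for the spans of the p's and of the q's, R for the span of the
quadrics in V (x) W, of dimension [2n^2+n], and e_T for the wedge product of the
indeterminates in a set T.

Structure of Z.  A product x x' y with x, x' in V and y in W is symmetric in x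
and x', while the relations rewrite it, up to sign, as a trilinear expression
that is antisymmetric in an overlapping pair of indices; as 2 is invertible it
vanishes, and likewise x y y' = 0 ([zX_xxy], [zX_xyy]).  Hence I contains all
bidegrees [a,b] with a, b >= 1 other than [1,1], and a polynomial lies in I
exactly when it has no monomial in the p's alone, none in the q's alone, and a
[1,1]-part in R ([in_idealP]).  So Z is the fiber product of k[V] and k[W] over
k, extended by the space (V (x) W)/R of dimension [2n^2-n], which the maximal
ideal kills.

Depth and dimension.  A nonzero element of (V (x) W)/R is killed by the maximal
ideal, so the depth is 0.  As x y squares to zero, every prime ideal contains V
or W, so chains of primes of Z live in a polynomial ring in 2n indeterminates.
More than 2n polynomials there are algebraically dependent, by counting
monomials ([algebraic_dependence]), whereas elements chosen successively in the
steps of a chain of primes satisfy no relation, as its lowest term would put a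
unit in the last prime ([prime_chain_independent]).

Betti numbers.  Tor may be computed from any resolution of k, by lifting
([tor_rank_indep]); the Koszul complex is one.  Its exactness comes from a
homotopy on monomials which moves the lowest indeterminate from the coefficient
to the wedge factor ([koszul_homotopy]); it exists for the part of the
differential that involves any given set of indeterminates, in particular for
d_X (the p's) and d_Y (the q's).  Represent chains with coefficients in Z by
chains with coefficients in S, and let e = v_1 + v_2 - i be the degree of the
coefficients.  The strands of pure monomials are exact, so a cycle modulo I is
homologous to one with mixed coefficients only.  For e >= 3 these lie in I; for
e = 2 and e = 1 the homology is the cokernel and the kernel of the polarization

  Lambda^(v_1) V (x) Lambda^(v_2) W
    -> Lambda^(v_1-1) V (x) Lambda^(v_2-1) W (x) (V (x) W)/R,

which sends w to the class of d_Y d_X w ([tor_rank_quadratic],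
[tor_rank_linear]).  Unless v = [1,1] it is injective, by the same conflict
between symmetry and antisymmetry as above ([polar_inj]); for v = [1,1] it is
the projection of V (x) W onto (V (x) W)/R.  Counting dimensions gives the
graded Betti numbers, and Vandermonde's identity their sums. *)

(** * Restricting and shifting monomials *)

Section Monomials.
Variables (k : fieldType) (N : nat).
Local Notation S := {mpoly k[N]}.
Implicit Types (f g : S) (a b : 'X_{1..N}).

(** The projections used below, onto pure monomials, onto constant terms and onto
bihomogeneous components, are all of this form, which makes them commute with
each other coefficient by coefficient. *)
Definition mrestr (P : pred 'X_{1..N}) f : S :=
  \sum_(b <- msupp f | P b) f@_b *: 'X_[b].

Lemma mcoeff_sum_msupp f (P : pred 'X_{1..N}) (h : 'X_{1..N} -> 'X_{1..N}) a b :
    (forall c, P c -> (h c == a) = (c == b)) ->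
  (\sum_(c <- msupp f | P c) f@_c *: 'X_[h c])@_a = if P b then f@_b else 0.
Proof.
move=> hab; rewrite raddf_sum /=.
have -> : \sum_(c <- msupp f | P c) (f@_c *: 'X_[h c])@_a
    = \sum_(c <- msupp f | P c) f@_c * (c == b)%:R.
  by apply: eq_bigr => c Pc; rewrite mcoeffZ mcoeffX hab.
case: (boolP (b \in msupp f)) => [bf|bf].
  rewrite big_mkcond (bigD1_seq b) //= eqxx mulr1 big1 ?addr0 // => c /negPf ->.
  by rewrite mulr0 if_same.
rewrite (memN_msupp_eq0 bf) if_same big1_seq // => c /andP[_ cf].
by case: eqP => [e|_]; rewrite ?mulr0 //; rewrite -e cf in bf.
Qed.

Lemma mcoeff_mrestr P f a : (mrestr P f)@_a = if P a then f@_a else 0.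
Proof. exact: mcoeff_sum_msupp. Qed.

Lemma mrestr_is_zmod_morphism P : zmod_morphism (mrestr P).
Proof.
move=> f g; apply/mpolyP => a.
by rewrite mcoeffB !mcoeff_mrestr mcoeffB; case: (P a); rewrite ?subr0.
Qed.

HB.instance Definition _ P :=
  GRing.isZmodMorphism.Build S S (mrestr P) (mrestr_is_zmod_morphism P).

Lemma mrestr_msupp P f a : a \in msupp (mrestr P f) -> P a.
Proof. by rewrite mcoeff_msupp mcoeff_mrestr; case: (P a); rewrite ?eqxx. Qed.

Lemma mrestr_id (P : pred _) f : {in msupp f, forall a, P a} -> mrestr P f = f.
Proof.
move=> Pf; apply/mpolyP => a; rewrite mcoeff_mrestr.
case: (boolP (P a)) => // nPa; rewrite memN_msupp_eq0 //.
by apply: contra nPa => /Pf.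
Qed.

(** Division by the indeterminate s: the coefficient part of the contracting
homotopy [koszul_h]. *)
Definition mdown (P : pred 'X_{1..N}) (s : 'I_N) f : S :=
  \sum_(b <- msupp f | (U_(s) <= b)%MM && P (b - U_(s))%MM)
    f@_b *: 'X_[(b - U_(s))%MM].

Lemma mcoeff_mdown P s f a :
  (mdown P s f)@_a = if P a then f@_(a + U_(s))%MM else 0.
Proof.
rewrite /mdown (@mcoeff_sum_msupp _ _ _ _ (a + U_(s))%MM).
  by rewrite lem_addl addmK.
move=> c /andP[sc _]; apply/eqP/eqP => [<-|->]; first by rewrite submK.
by rewrite addmK.
Qed.

Lemma mcoeffXM b f a :
  ('X_[b] * f)@_a = if (b <= a)%MM then f@_(a - b)%MM else 0.
Proof.
case: ifP => [ba|nba]; first by rewrite mulrC -{1}(submK ba) addmC mcoeffMX.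
apply: memN_msupp_eq0; apply: contraFN nba; rewrite mulrC.
rewrite (perm_mem (msuppMX f b)) => /mapP[c _ ->].
exact: lem_addr.
Qed.

Lemma mcoeffXUM s f a :
  ('X_s * f)@_a = if (0 < a s)%N then f@_(a - U_(s))%MM else 0.
Proof. by rewrite mcoeffXM lep1mP lt0n. Qed.

Lemma mcoeff_signM (e : nat) f a : ((-1) ^+ e * f)@_a = (-1) ^+ e * f@_a.
Proof. by rewrite -(signr_odd S) -(signr_odd k) !mulr_sign; case: odd; rewrite ?mcoeffN. Qed.

End Monomials.

(** * The Koszul differential and its contraction by monomials *)

Section Koszul.
Variable N : nat.
Implicit Types (s t : 'I_N) (T L : {set 'I_N}).

(** The number of transpositions that sort e_s e_T. *)
Definition nbelow s T := #|[set t in T | (t < s)%N]|.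

Lemma nbelowU s t T : t \notin T ->
  nbelow s (t |: T) = ((t < s) + nbelow s T)%N.
Proof.
move=> tT; rewrite /nbelow; case: (ltnP t s) => ts.
  have -> : [set u in t |: T | (u < s)%N] = t |: [set u in T | (u < s)%N].
    by apply/setP => u; rewrite !inE; case: eqP => [->|//]; rewrite ts.
  by rewrite cardsU1 !inE (negPf tT).
congr #|pred_of_set _|; apply/setP => u; rewrite !inE.
by case: eqP => // ->; rewrite (negPf tT) ltnNge ts.
Qed.

Section Contraction.
Variable A : nzRingType.
Implicit Types F G : {set 'I_N} -> A.

(** A Koszul chain is encoded by its coefficients F T on the wedge products e_T;
then [iota_ s] is the contraction with the s-th dual basis vector. *)
Definition iota_ s F T : A :=
  if s \in T then 0 else (-1) ^+ nbelow s T * F (s |: T).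

Lemma eq_iota s F G : F =1 G -> iota_ s F =1 iota_ s G.
Proof. by move=> FG T; rewrite /iota_ FG. Qed.

Lemma iotaD s F G T :
  iota_ s (fun U => F U + G U) T = iota_ s F T + iota_ s G T.
Proof. by rewrite /iota_; case: ifP; rewrite ?addr0 ?mulrDr. Qed.

Lemma iotaN s F T : iota_ s (fun U => - F U) T = - iota_ s F T.
Proof. by rewrite /iota_; case: ifP; rewrite ?oppr0 ?mulrN. Qed.

Lemma iotaMl s c F T : iota_ s (fun U => c * F U) T = c * iota_ s F T.
Proof.
rewrite /iota_; case: ifP; rewrite ?mulr0 // => _.
by rewrite !mulrA -[(-1) ^+ _ * c]commr_sign.
Qed.

Lemma iota_sum s (I : finType) (P : pred I) (F : I -> {set 'I_N} -> A) T :
  iota_ s (fun U => \sum_(j | P j) F j U) T = \sum_(j | P j) iota_ s (F j) T.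
Proof.
rewrite /iota_; case: ifP => sT; first by rewrite big1.
by rewrite mulr_sumr.
Qed.

(** The only place where signs are computed for the differential: removing s and
then t, or t and then s, differs by the comparison of s with t. *)
Lemma iotaC s t F T : iota_ s (iota_ t F) T = - iota_ t (iota_ s F) T.
Proof.
rewrite /iota_ !in_setU1; have [->|neq] := eqVneq s t.
  by rewrite /=; case: ifP; rewrite ?mulr0 ?oppr0.
rewrite /= 1?[t == s]eq_sym ?(negPf neq) /=.
case: ifP => sT; case: ifP => tT; rewrite ?mulr0 ?oppr0 //.
rewrite setUCA !mulrA -!exprD !nbelowU ?tT ?sT //.
have e : ((s < t) = ~~ (t < s))%N.
  by move: neq; rewrite -val_eqE /=; case: ltngtP.
rewrite e; case: (t < s)%N => /=; rewrite -mulNr; congr (_ * _).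
  by rewrite add0n add1n addnS exprS mulN1r opprK addnC.
by rewrite add0n add1n addnS exprS mulN1r addnC.
Qed.

Lemma iota_iota s F T : iota_ s (iota_ s F) T = 0.
Proof. by rewrite /iota_ !in_setU1 eqxx /=; case: ifP; rewrite ?mulr0. Qed.

Lemma iota_inj s F T : s \in T -> iota_ s F (T :\ s) = 0 -> F T = 0.
Proof.
move=> sT; rewrite /iota_ !inE eqxx /= setD1K // => e.
by rewrite -[F T](signrMK (nbelow s (T :\ s))) e mulr0.
Qed.

End Contraction.

Section Differential.
Variable k : fieldType.
Local Notation S := {mpoly k[N]}.
Implicit Types F G : {set 'I_N} -> S.

(** Only the indeterminates of L take part, so that the differential is the sum of
its parts for complementary sets L. *)
Definition koszul_d L F T : S := \sum_(s in L) 'X_s * iota_ s F T.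

Lemma eq_kd L F G : F =1 G -> koszul_d L F =1 koszul_d L G.
Proof. by move=> FG T; apply: eq_bigr => s _; rewrite (eq_iota s FG). Qed.

Lemma kdD L F G T : koszul_d L (fun U => F U + G U) T = koszul_d L F T + koszul_d L G T.
Proof. by rewrite -big_split; apply: eq_bigr => s _; rewrite iotaD mulrDr. Qed.

Lemma kdN L F T : koszul_d L (fun U => - F U) T = - koszul_d L F T.
Proof. by rewrite -sumrN; apply: eq_bigr => s _; rewrite iotaN mulrN. Qed.

Lemma kdB L F G T : koszul_d L (fun U => F U - G U) T = koszul_d L F T - koszul_d L G T.
Proof. by rewrite kdD kdN. Qed.

Lemma kdMl L c F T : koszul_d L (fun U => c * F U) T = c * koszul_d L F T.
Proof.
by rewrite mulr_sumr; apply: eq_bigr => s _; rewrite iotaMl mulrCA.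
Qed.

Lemma kd_sum L (I : finType) (F : I -> {set 'I_N} -> S) T :
  koszul_d L (fun U => \sum_j F j U) T = \sum_j koszul_d L (F j) T.
Proof.
rewrite exchange_big; apply: eq_bigr => s _.
by rewrite iota_sum mulr_sumr.
Qed.

Lemma iota_kd s L F T :
  iota_ s (koszul_d L F) T = \sum_(t in L) 'X_t * iota_ s (iota_ t F) T.
Proof.
by rewrite iota_sum; apply: eq_bigr => t _; rewrite iotaMl.
Qed.

Lemma kd_kd L F T : koszul_d L (koszul_d L F) T = 0.
Proof.
rewrite /koszul_d (eq_bigr _ (fun s _ => congr1 (fun x => _ * x) (iota_kd s L F T))).
under eq_bigr do rewrite mulr_sumr.
rewrite pair_big /= (bigID (fun u : 'I_N * 'I_N => (u.1 < u.2)%N)) /=.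
rewrite [X in _ + X](bigID (fun u : 'I_N * 'I_N => (u.2 < u.1)%N)) /= [X in _ + (_ + X)]big1 ?addr0.
  apply/eqP; rewrite addr_eq0 -sumrN; apply/eqP.
  rewrite (reindex_inj (h := fun u : 'I_N * 'I_N => (u.2, u.1))) /=; last by move=> [? ?] [? ?] [-> ->].
  apply: eq_big => [[s t]|[s t] _] /=.
    by rewrite -leqNgt; case: ltngtP; rewrite ?andbF ?andbT // andbC.
  by rewrite iotaC !mulrN mulrCA.
move=> [s t] /=; rewrite -!leqNgt -andbA => /and3P[_ ts st].
have -> : s = t by apply/val_inj/eqP; rewrite eqn_leq ts st.
by rewrite iota_iota !mulr0.
Qed.

Lemma kdC L L' F T : koszul_d L (koszul_d L' F) T = - koszul_d L' (koszul_d L F) T.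
Proof.
rewrite /koszul_d (eq_bigr _ (fun s _ => congr1 (fun x => _ * x) (iota_kd s L' F T))).
rewrite [in RHS](eq_bigr _ (fun s _ => congr1 (fun x => _ * x) (iota_kd s L F T))).
under eq_bigr do rewrite mulr_sumr.
under [in RHS]eq_bigr do rewrite mulr_sumr.
rewrite exchange_big -sumrN; apply: eq_bigr => s _.
rewrite -sumrN; apply: eq_bigr => t _.
by rewrite iotaC !mulrN mulrCA.
Qed.

Definition lowest L : option 'I_N := [pick m in L | [forall t in L, (m <= t)%N]].

Lemma lowestP L : 
  match lowest L with
  | Some m => m \in L /\ {in L, forall t, (m <= t)%N}
  | None => L = set0 end.
Proof.
rewrite /lowest; case: pickP => [m /andP[mL /forall_inP le]|no]; first by split.
apply/eqP; apply: contraT => /set0Pn[t0 t0L].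
case: (arg_minnP (fun t : 'I_N => val t) t0L) => m mL le.
by have /negP[] := negbT (no m); apply/andP; split=> //; apply/forall_inP.
Qed.

Lemma lowest_eq L m : m \in L -> {in L, forall t, (m <= t)%N} -> lowest L = Some m.
Proof.
move=> mL le; have := lowestP L; case: lowest => [m' [m'L le']|L0].
  by congr Some; apply/val_inj/eqP; rewrite eqn_leq le // le'.
by rewrite L0 inE in mL.
Qed.

Definition free_below L m : pred 'X_{1..N} :=
  fun a => [forall l in L, (l < m)%N ==> (a l == 0%N)].

(** Let m be the least element of L that divides x^a or occurs in T.  The
contraction sends x^a e_T to x^(a-m) e_m e_T if m is not in T, and to 0
otherwise.  Read on coefficients, the value at T comes from removing the lowest
element m of T in L, provided that the monomial has no smaller indeterminate in L. *)
Definition koszul_h L F T : S :=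
  if lowest (T :&: L) is Some m then
    (-1) ^+ nbelow m (T :\ m) * mdown (free_below L m) m (F (T :\ m))
  else 0.

Definition free_of L : pred 'X_{1..N} := fun a => [forall l in L, a l == 0%N].

(** The defect of the contraction, see [koszul_homotopy]. *)
Definition koszul_p L F T : S := if [disjoint T & L] then mrestr (free_of L) (F T) else 0.

Lemma mcoeff_kd L F T a : (koszul_d L F T)@_a =
  \sum_(s in L | (s \notin T) && (0 < a s)%N)
    (-1) ^+ nbelow s T * (F (s |: T))@_(a - U_(s))%MM.
Proof.
rewrite raddf_sum /= [RHS]big_mkcondr /=; apply: eq_bigr => s _.
rewrite mcoeffXUM /iota_; case: (s \in T) => /=; first by rewrite mcoeff0 if_same.
by case: ifP => // _; rewrite mcoeff_signM.
Qed.

Lemma mcoeff_kh L F T a : (koszul_h L F T)@_a =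
  if lowest (T :&: L) is Some m then
    if free_below L m a then
      (-1) ^+ nbelow m (T :\ m) * (F (T :\ m))@_(a + U_(m))%MM
    else 0
  else 0.
Proof.
rewrite /koszul_h; case: lowest => [m|]; last by rewrite mcoeff0.
by rewrite mcoeff_signM mcoeff_mdown; case: ifP; rewrite ?mulr0.
Qed.

(** Compare coefficients of x^a e_T.  Let m be the least element of L that divides
x^a or lies in T.  If m is in T, the term s = m of h d gives the coefficient
itself, and the terms s <> m cancel against d h because s > m.  If m is not in
T, then h d vanishes and only the term s = m of d h survives.  If there is no
such m, both sides are 0. *)
Lemma koszul_homotopy L F T :
  koszul_d L (koszul_h L F) T + koszul_h L (koszul_d L F) T = F T - koszul_p L F T.
Proof.
apply/mpolyP => a; rewrite mcoeffD mcoeffB mcoeff_kd mcoeff_kh.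
under eq_bigr do rewrite mcoeff_kh.
have := lowestP ((T :|: [set s | (0 < a s)%N]) :&: L).
case: (lowest ((T :|: _) :&: L)) => [m [mL lem]|none]; last first.
  have TL : T :&: L = set0.
    by apply/eqP; rewrite -subset0 -none setSI // subsetUl.
  have aL : free_of L a.
    apply/forall_inP => l lL; rewrite -leqn0 leqNgt; apply/negP => al.
    have : l \in set0 by rewrite -none !inE lL al orbT.
    by rewrite inE.
  rewrite /koszul_p -setI_eq0 TL eqxx mcoeff_mrestr aL subrr.
  rewrite (_ : lowest set0 = None); last first.
    by have := lowestP set0; case: lowest => // m []; rewrite inE.
  rewrite addr0 big_pred0 // => s; apply/negP => /andP[sL /andP[_ as0]].
  by have /forall_inP/(_ s sL) := aL; rewrite -leqn0 leqNgt as0.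
have mL' : m \in L by move: mL; rewrite inE => /andP[].
have lowa s : s \in L -> (0 < a s)%N -> (m <= s)%N.
  by move=> sL as0; apply: lem; rewrite !inE sL as0 orbT.
have lowT s : s \in L -> s \in T -> (m <= s)%N.
  by move=> sL sT; apply: lem; rewrite !inE sL sT.
have fbm : free_below L m a.
  apply/forall_inP => l lL; apply/implyP => lm; rewrite -leqn0 leqNgt.
  by apply/negP => /(lowa _ lL); rewrite leqNgt lm.
have -> : (koszul_p L F T)@_a = 0.
  rewrite /koszul_p -setI_eq0; case: eqP => [TL|_]; last exact: mcoeff0.
  rewrite mcoeff_mrestr; case: ifP => // /forall_inP/(_ m mL')/eqP am0.
  move: mL; rewrite !inE mL' am0 orbF andbT => mT.
  have : m \in set0 by rewrite -TL inE mT mL'.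
  by rewrite inE.
rewrite subr0; have [mT|mT] := boolP (m \in T).
  have lT : lowest (T :&: L) = Some m.
    apply: lowest_eq; first by rewrite inE mT.
    by move=> t; rewrite inE => /andP[tT tL]; apply: lowT.
  rewrite lT fbm mcoeff_kd addrC (bigD1 m) /=; last first.
    by rewrite mL' !inE eqxx mnmDE mnm1E eqxx addn1.
  rewrite setD1K // addmK mulrDr signrMK -addrA.
  rewrite [X in _ + X](_ : _ = 0) ?addr0 //.
  set U := T :\ m; have mU : m \notin U by rewrite !inE eqxx.
  have TU : T = m |: U by rewrite setD1K.
  apply/eqP; rewrite addrC addr_eq0 mulr_sumr -sumrN; apply/eqP.
  apply: eq_big => [s|s].
    rewrite mnmDE mnm1E !inE negb_and negbK; have [->|sm] /= := eqVneq s m.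
      by rewrite mT !andbF.
    by rewrite addn0 !andbT.
  case/andP=> sL /andP[sT as0].
  have sm : s != m by apply: contraNneq sT => ->.
  have ltms : (m < s)%N.
    by rewrite ltn_neqAle (lowa _ sL as0) andbT eq_sym.
  have -> : lowest ((s |: T) :&: L) = Some m.
    apply: lowest_eq; first by rewrite !inE mT mL' orbT.
    move=> t; rewrite !inE => /andP[/orP[/eqP->|tT] tL]; first exact: ltnW.
    exact: lowT.
  have -> : free_below L m (a - U_(s))%MM.
    apply/forall_inP => l lL; apply/implyP => lm; rewrite mnmBE.
    by have /forall_inP/(_ l lL)/implyP/(_ lm)/eqP-> := fbm.
  have -> : (s |: T) :\ m = s |: U.
    apply/setP => t; rewrite !inE; have [->|//] := eqVneq t m.
    by rewrite eq_sym (negPf sm).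
  have -> : (a - U_(s) + U_(m))%MM = (a + U_(m) - U_(s))%MM.
    apply/mnmP => j; rewrite !(mnmDE, mnmBE) !mnm1E.
    by have [<-|] := eqVneq s j; rewrite ?subn0 // addnBAC.
  have sU : s \notin U by rewrite !inE (negPf sT) andbF.
  rewrite !mulrA -mulNr; congr (_ * _); rewrite [in LHS]TU !nbelowU //.
  rewrite ltms ltnNge (ltnW ltms) /= add0n add1n exprS.
  by rewrite mulN1r mulNr mulrC.
have am0 : (0 < a m)%N by move: mL; rewrite !inE (negPf mT) /= => /andP[].
have -> : (match lowest (T :&: L) with Some m0 =>
     if free_below L m0 a then (-1) ^+ nbelow m0 (T :\ m0) *
       (koszul_d L F (T :\ m0))@_(a + U_(m0))%MM else 0 | None => 0 end) = 0.
  have := lowestP (T :&: L); case: lowest => // m' [m'TL _].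
  rewrite ifN //; apply/negP => /forall_inP/(_ m mL')/implyP H.
  move: m'TL; rewrite inE => /andP[m'T m'L].
  have : (a m == 0)%N.
    apply: H; rewrite ltn_neqAle lowT // andbT.
    by apply: contraNneq mT => e; rewrite (_ : m = m') //; apply: val_inj.
  by rewrite eqn0Ngt am0.
rewrite addr0 (bigD1 m) /=; last by rewrite mL' mT am0.
have -> : lowest ((m |: T) :&: L) = Some m.
  apply: lowest_eq; first by rewrite !inE eqxx.
  move=> t; rewrite !inE => /andP[/orP[/eqP->//|tT] tL]; exact: lowT.
have -> : free_below L m (a - U_(m))%MM.
  apply/forall_inP => l lL; apply/implyP => lm; rewrite mnmBE.
  by have /forall_inP/(_ l lL)/implyP/(_ lm)/eqP-> := fbm.
rewrite setU1K // signrMK submK ?lep1mP -?lt0n // big1 ?addr0 //.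
move=> s /andP[/and3P[sL sT as0] sm].
have := lowestP ((s |: T) :&: L); case: lowest => [m' [m'TL _]|]; last by rewrite mulr0.
rewrite ifN ?mulr0 //; apply/negP => /forall_inP/(_ m mL')/implyP H.
have : ((a - U_(s))%MM m == 0)%N.
  apply: H; move: m'TL; rewrite !inE => /andP[/orP m'sT m'L].
  rewrite ltn_neqAle; apply/andP; split.
    apply: contraTneq isT => e; have {}e : m = m' by apply: val_inj.
    case: m'sT => [/eqP e'|]; last by rewrite -e (negPf mT).
    by rewrite -e' -e eqxx in sm.
  by case: m'sT => [/eqP->|m'T]; [apply: lowa|apply: lowT].
by rewrite mnmBE mnm1E (negPf sm) subn0 eqn0Ngt am0.
Qed.

End Differential.
End Koszul.

(** * The Koszul complex resolves the residue field *)

Section KoszulResolution.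
Variables (k : fieldType) (N : nat) (wt : 'I_N -> nat * nat).
Local Notation S := {mpoly k[N]}.

Definition ksets i : {set {set 'I_N}} := [set T : {set 'I_N} | #|T| == i].
Definition krk i := #|ksets i|.
Definition kset i (a : 'I_(krk i)) : {set 'I_N} := enum_val a.
Definition wtset (T : {set 'I_N}) : nat * nat := \sum_(s in T) wt s.

Lemma card_kset i (a : 'I_(krk i)) : #|kset a| = i.
Proof. by have := enum_valP a; rewrite inE => /eqP. Qed.

Lemma kset_inj i : injective (@kset i).
Proof. exact: enum_val_inj. Qed.

Lemma ksetP i (T : {set 'I_N}) : #|T| = i -> exists a : 'I_(krk i), kset a = T.
Proof.
move=> Ti; have TK : T \in ksets i by rewrite inE Ti.
by exists (enum_rank_in TK T); rewrite /kset enum_rankK_in.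
Qed.

Section Unpack.
Variables (V : nmodType) (i : nat).

(** Chains of degree i are functions on all sets of indeterminates that vanish on
sets of another size; this passes to them from vectors indexed by the sets of
size i. *)
Definition unpack (x : 'I_(krk i) -> V) (T : {set 'I_N}) : V :=
  \sum_(a | kset a == T) x a.

Lemma unpackE x a : unpack x (kset a) = x a.
Proof.
rewrite /unpack (bigD1 a) //= big1 ?addr0 // => b /andP[/eqP/kset_inj->].
by rewrite eqxx.
Qed.

Lemma unpack_eq0 x (T : {set 'I_N}) : #|T| != i -> unpack x T = 0.
Proof.
move=> Ti; apply: big_pred0 => a; apply/negbTE.
by apply: contraNneq Ti => <-; rewrite card_kset.
Qed.

Lemma unpackK (F : {set 'I_N} -> V) : (forall T : {set 'I_N}, #|T| != i -> F T = 0) ->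
  unpack (fun a => F (kset a)) =1 F.
Proof.
move=> Fi T; have [/eqP/ksetP[a <-]|Ti] := boolP (#|T| == i).
  by rewrite unpackE.
by rewrite unpack_eq0 // Fi.
Qed.

End Unpack.

(** The coefficient of e_B in the differential of e_A. *)
Definition kentry (A B : {set 'I_N}) : S :=
  \sum_(s | (s \notin B) && (A == s |: B)) (-1) ^+ nbelow s B * 'X_s.

Lemma kentry_sum i (x : 'I_(krk i.+1) -> S) (T : {set 'I_N}) : #|T| = i ->
  \sum_a kentry (kset a) T * x a = koszul_d setT (unpack x) T.
Proof.
move=> Ti; under eq_bigr do rewrite mulr_suml.
rewrite (exchange_big_dep xpredT) //=; apply: eq_big => [s|s _].
  by rewrite inE.
rewrite /iota_; case: (boolP (s \in T)) => /= sT.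
  by rewrite big_pred0 ?mulr0 // => a; rewrite andbF.
by rewrite /unpack mulr_sumr mulr_sumr; apply: eq_bigr => a _; ring.
Qed.

Lemma msupp_kentry A B m : m \in msupp (kentry A B) ->
  exists2 s, (s \notin B) && (A == s |: B) & m = U_(s)%MM.
Proof.
rewrite mcoeff_msupp raddf_sum /= => /eqP ne0.
have /existsP[s /andP[sAB ms]] : [exists s, (s \notin B) && (A == s |: B) &&
    (m == U_(s)%MM)].
  apply: contra_notT ne0; rewrite negb_exists => /forallP no.
  apply: big1 => s sAB; rewrite mcoeff_signM mcoeffX.
  by have := no s; rewrite sAB eq_sym /= => /negPf->; rewrite mulr0.
by exists s => //; apply/eqP.
Qed.

Definition homog_chain i F := forall T : {set 'I_N}, #|T| != i -> F T = 0 :> S.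

Lemma kd_size L i F : homog_chain i.+1 F -> homog_chain i (koszul_d L F).
Proof.
move=> Fi T Ti; apply: big1 => s _; rewrite /iota_; case: ifP => sT; rewrite ?mulr0 //.
by rewrite Fi ?mulr0 // cardsU1 sT.
Qed.

Lemma kd_size0 L F : homog_chain 0 F -> koszul_d L F =1 fun=> 0.
Proof.
move=> F0 T; apply: big1 => s _; rewrite /iota_; case: ifP => sT; rewrite ?mulr0 //.
by rewrite F0 ?mulr0 // cardsU1 sT.
Qed.

Lemma kh_size L i F : homog_chain i F -> homog_chain i.+1 (koszul_h L F).
Proof.
move=> Fi T Ti; rewrite /koszul_h; have := lowestP (T :&: L).
case: lowest => // m [/setIP[mT _] _]; apply/mpolyP => a.
rewrite mcoeff_signM mcoeff_mdown Fi ?mcoeff0 ?if_same ?mulr0 //.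
by move: Ti; rewrite (cardsD1 m) mT.
Qed.

Lemma bideg0 : bideg wt 0%MM = 0.
Proof. by rewrite /bideg big1 // => j _; rewrite mnm0E. Qed.

Lemma bidegD a b : bideg wt (a + b)%MM = bideg wt a + bideg wt b.
Proof. by rewrite /bideg -big_split; apply: eq_bigr => j _; rewrite mnmDE mulrnDr. Qed.

Lemma bidegU s : bideg wt U_(s)%MM = wt s.
Proof.
rewrite /bideg (bigD1 s) //= mnm1E eqxx mulr1n big1 ?addr0 // => j js.
by rewrite mnm1E eq_sym (negPf js).
Qed.

Lemma wtsetU1 s (T : {set 'I_N}) : s \notin T -> wtset (s |: T) = wt s + wtset T.
Proof. by move=> sT; rewrite /wtset big_setU1. Qed.

Definition kmx i : 'M[S]_(krk i.+1, krk i) :=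
  \matrix_(a, b) kentry (kset a) (kset b).

Lemma mul_kmx i (x : 'rV[S]_(krk i.+1)) b :
  (x *m kmx i) 0 b = koszul_d setT (unpack (x 0)) (kset b).
Proof.
rewrite mxE -(@kentry_sum i) ?card_kset //.
by apply: eq_bigr => a _; rewrite mxE mulrC.
Qed.

Lemma unpack_size i (x : 'I_(krk i) -> S) : homog_chain i (unpack x).
Proof. by move=> T; apply: unpack_eq0. Qed.

Lemma unpack_mul_kmx i (y : 'rV[S]_(krk i.+1)) :
  unpack ((y *m kmx i) 0) =1 koszul_d setT (unpack (y 0)).
Proof.
move=> T; have [/eqP/ksetP[b <-]|Ti] := boolP (#|T| == i).
  by rewrite unpackE mul_kmx.
by rewrite unpack_eq0 // (kd_size _ _ Ti) //; apply: unpack_size.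
Qed.

Lemma koszul_df_homog i (a : 'I_(krk i.+1)) b m : m \in msupp (kmx i a b) ->
  bideg wt m + wtset (kset b) = wtset (kset a).
Proof.
rewrite mxE => /msupp_kentry[s /andP[sb /eqP->] ->].
by rewrite bidegU wtsetU1.
Qed.

Lemma koszul_aug_homog (b : 'I_(krk 0)) : (1 : k) != 0 -> wtset (kset b) = 0.
Proof.
move=> _; have := card_kset b => /eqP; rewrite cards_eq0 => /eqP->.
by rewrite /wtset big_set0.
Qed.

(** A cycle is the differential of its contraction: with all indeterminates in L,
the defect [koszul_p] is concentrated in T = set0. *)
Lemma koszul_exact i (x : 'rV[S]_(krk i.+1)) :
  x *m kmx i = 0 <-> exists y : 'rV[S]_(krk i.+2), x = y *m kmx i.+1.
Proof.
split=> [x0|[y ->]]; last first.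
  apply/rowP => b; rewrite mul_kmx mxE (eq_kd _ (unpack_mul_kmx y)).
  exact: kd_kd.
set F := unpack (x 0).
have F0 T : koszul_d setT F T = 0.
  have [/eqP/ksetP[b <-]|Ti] := boolP (#|T| == i).
    by rewrite -mul_kmx x0 mxE.
  by rewrite (kd_size _ _ Ti) //; apply: unpack_size.
exists (\row_a koszul_h setT F (kset a)); apply/rowP => a.
rewrite mul_kmx -[LHS]unpackE -/F.
have : koszul_p setT F (kset a) = 0.
  rewrite /koszul_p -setI_eq0 setIT; case: eqP => // e.
  by have := card_kset a; rewrite e cards0.
have := koszul_homotopy setT F (kset a).
have -> : koszul_h setT (koszul_d setT F) (kset a) = 0.
  rewrite /koszul_h; case: lowest => // m; rewrite F0.
  by apply/mpolyP => c; rewrite mcoeff_signM mcoeff_mdown !mcoeff0 if_same mulr0.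
rewrite addr0 => e kp0; rewrite kp0 subr0 in e; rewrite -e.
apply: eq_kd => T; rewrite -(@unpackK _ i.+2 (koszul_h setT F)) //.
  by apply: eq_bigr => c _; rewrite mxE.
exact/kh_size/unpack_size.
Qed.

(** In degree 0 the defect of the contraction is the constant term. *)
Lemma koszul_exact0 (x : 'rV[S]_(krk 0)) :
  \sum_b (x 0 b)@_0%MM * 1 = 0 <->
  exists y : 'rV[S]_(krk 1), x = y *m kmx 0.
Proof.
have kset0 (b : 'I_(krk 0)) : kset b = set0.
  by apply/eqP; rewrite -cards_eq0 card_kset.
split=> [x0|[y ->]]; last first.
  apply: big1 => b _; rewrite mul_kmx mcoeff_kd big_pred0 ?mul0r // => s.
  by rewrite mnm0E ltnn !andbF.
set F := unpack (x 0).
exists (\row_a koszul_h setT F (kset a)); apply/rowP => a.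
rewrite mul_kmx -[LHS]unpackE -/F.
have : koszul_p setT F (kset a) = 0.
  rewrite /koszul_p; case: ifP => // _; apply/mpolyP => c.
  rewrite mcoeff_mrestr mcoeff0; case: ifP => // /forall_inP c0.
  have -> : c = 0%MM by apply/mnmP => s; rewrite mnm0E; apply/eqP/c0; rewrite inE.
  rewrite -[RHS]x0 raddf_sum /=; apply: eq_big => [b|b _]; last by rewrite mulr1.
  by rewrite !kset0 eqxx.
have := koszul_homotopy setT F (kset a).
have -> : koszul_h setT (koszul_d setT F) (kset a) = 0.
  rewrite /koszul_h; case: lowest => // m; rewrite kd_size0; last exact: unpack_size.
  by apply/mpolyP => c; rewrite mcoeff_signM mcoeff_mdown !mcoeff0 if_same mulr0.
rewrite addr0 => e kp0; rewrite kp0 subr0 in e; rewrite -e.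
apply: eq_kd => T; rewrite -(@unpackK _ 1 (koszul_h setT F)) //.
  by apply: eq_bigr => c _; rewrite mxE.
exact/kh_size/unpack_size.
Qed.

Lemma koszul_aug_surj (c : k) :
  exists x : 'rV[S]_(krk 0), \sum_b (x 0 b)@_0%MM * 1 = c.
Proof.
exists (\row_b c%:MP); under eq_bigr do rewrite mxE mcoeffC eqxx !mulr1.
by rewrite sumr_const card_ord /krk card_draws bin0.
Qed.

Definition koszul_res : gfree_res k wt :=
  @GFreeRes k N wt krk (fun i a => wtset (kset a)) kmx (fun=> 1)
    koszul_df_homog koszul_aug_homog koszul_exact koszul_exact0 koszul_aug_surj.

End KoszulResolution.

(** * Tor does not depend on the resolution *)

Lemma dependent_choice (T : nat -> Type) (Q : forall i, T i -> Prop)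
    (R : forall i, T i -> T i.+1 -> Prop) (x0 : T 0) :
    Q 0 x0 ->
    (forall i x, Q i x -> exists2 y, Q i.+1 y & R i x y) ->
  exists2 x : forall i, T i, x 0 = x0
    & forall i, Q i (x i) /\ R i (x i) (x i.+1).
Proof.
move=> Q0 step.
pose next i (u : {x : T i | Q i x}) : {x : T i.+1 | Q i.+1 x} :=
  let: exist2 y Qy _ := boolp.cid2 (step i (sval u) (svalP u)) in exist _ y Qy.
pose u i : {x : T i | Q i x} := nat_rect (fun i => {x : T i | Q i x})
  (exist _ x0 Q0) next i.
exists (fun i => sval (u i)) => // i; split; first exact: svalP.
by rewrite /= /next; case: boolp.cid2.
Qed.

Section Comparison.
Variables (k : fieldType) (N : nat) (wt : 'I_N -> nat * nat).
Local Notation S := {mpoly k[N]}.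

Lemma mrestrXM (P Q : pred 'X_{1..N}) b (f : S) :
    (forall a, P (b + a)%MM = Q a) ->
  mrestr P ('X_[b] * f) = 'X_[b] * mrestr Q f.
Proof.
move=> PQ; apply/mpolyP => a; rewrite mcoeff_mrestr !mcoeffXM mcoeff_mrestr.
case: (boolP (b <= a)%MM) => ba; last by rewrite if_same.
by rewrite -PQ addmC submK.
Qed.

(** Selecting monomials commutes with multiplication by g when the two selections
correspond under every shift that g produces. *)
Lemma mrestr_mull (P Q : pred 'X_{1..N}) (g f : S) :
    (forall b, b \in msupp g -> forall a, P (b + a)%MM = Q a) ->
  mrestr P (g * f) = g * mrestr Q f.
Proof.
move=> PQ; rewrite [in LHS](mpolyE g) [in RHS](mpolyE g) !mulr_suml raddf_sum.
apply: eq_big_seq => b /PQ{}PQ.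
rewrite -!scalerAl -!mul_mpolyC -(mrestrXM _ PQ); apply/mpolyP => a.
rewrite mcoeffCM !mcoeff_mrestr mcoeffCM.
by case: ifP; rewrite ?mulr0.
Qed.

Section HomogeneousMatrices.

Definition hmx p q (da : 'I_p -> nat * nat) (db : 'I_q -> nat * nat)
    (A : 'M[S]_(p, q)) :=
  forall a b m, m \in msupp (A a b) -> bideg wt m + db b = da a.

(** Taking the bihomogeneous part commutes with multiplication by a homogeneous
matrix on either side, so a lift through homogeneous maps can be replaced by its
bihomogeneous part. *)
Definition hpart p q (da : 'I_p -> nat * nat) (db : 'I_q -> nat * nat)
    (A : 'M[S]_(p, q)) : 'M[S]_(p, q) :=
  \matrix_(a, b) mrestr (fun m => bideg wt m + db b == da a) (A a b).

Lemma hmx_hpart p q da db (A : 'M[S]_(p, q)) : hmx da db (hpart da db A).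
Proof. by move=> a b m; rewrite mxE => /mrestr_msupp/eqP. Qed.

Lemma hpart_id p q da db (A : 'M[S]_(p, q)) : hmx da db A -> hpart da db A = A.
Proof.
move=> hA; apply/matrixP => a b; rewrite mxE mrestr_id // => m /hA.
by move/eqP.
Qed.

Lemma addpI (u v w : nat * nat) : (u + v == u + w) = (v == w).
Proof.
case: u v w => [? ?] [? ?] [? ?].
by rewrite -!pair_eqE /= /GRing.add /= !eqn_add2l.
Qed.

Lemma hpart_mull p q r da db dc (A : 'M[S]_(p, q)) (B : 'M[S]_(q, r)) :
  hmx da db A -> hpart da dc (A *m B) = A *m hpart db dc B.
Proof.
move=> hA; apply/matrixP => a c; rewrite !mxE raddf_sum; apply: eq_bigr => b _.
rewrite mxE; apply: mrestr_mull => m /hA <- m'.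
by rewrite bidegD -addrA addpI.
Qed.

Lemma hpart_mulr p q r da db dc (A : 'M[S]_(p, q)) (B : 'M[S]_(q, r)) :
  hmx db dc B -> hpart da dc (A *m B) = hpart da db A *m B.
Proof.
move=> hB; apply/matrixP => a c; rewrite !mxE raddf_sum; apply: eq_bigr => b _.
rewrite mxE mulrC [RHS]mulrC; apply: mrestr_mull => m /hB <- m'.
by rewrite bidegD [bideg wt m + _]addrC -addrA.
Qed.

End HomogeneousMatrices.

Implicit Types P : gfree_res k wt.

Lemma df_df P i : df P i.+1 *m df P i = 0.
Proof.
apply/row_matrixP => a; rewrite row_mul row0; apply/res_exact.
by exists (delta_mx 0 a); rewrite rowE.
Qed.

Lemma res_exact_mx P i p (X : 'M[S]_(p, rk P i.+1)) : X *m df P i = 0 ->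
  exists Y : 'M[S]_(p, rk P i.+2), X = Y *m df P i.+1.
Proof.
move=> X0; have H a : exists y : 'rV[S]_(rk P i.+2), row a X = y *m df P i.+1.
  by apply/res_exact; rewrite -row_mul X0 row0.
have [y yE] := fin_all_exists H.
exists (\matrix_a y a); apply/row_matrixP => a.
by rewrite row_mul rowK.
Qed.

Definition augmx P : 'cV[k]_(rk P 0) := \col_b aug b.
Definition const_mx0 p q (A : 'M[S]_(p, q)) : 'M[k]_(p, q) := map_mx (mcoeff 0%MM) A.

Lemma res_exact0_mx P p (X : 'M[S]_(p, rk P 0)) : const_mx0 X *m augmx P = 0 ->
  exists Y : 'M[S]_(p, rk P 1), X = Y *m df P 0.
Proof.
move=> X0; have H a : exists y : 'rV[S]_(rk P 1), row a X = y *m df P 0.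
  apply/res_exact0; have /matrixP/(_ a 0) := X0; rewrite !mxE => e.
  by rewrite -[RHS]e; apply: eq_bigr => b _; rewrite !mxE.
have [y yE] := fin_all_exists H.
exists (\matrix_a y a); apply/row_matrixP => a.
by rewrite row_mul rowK.
Qed.

Lemma df_aug P : const_mx0 (df P 0) *m augmx P = 0.
Proof.
apply/matrixP => a j; have := (res_exact0 (g := P) (row a (df P 0))).2.
move=> H; rewrite !mxE -[RHS]H; last by exists (delta_mx 0 a); rewrite rowE.
by apply: eq_bigr => b _; rewrite !mxE.
Qed.

Lemma const_mx0M p q r (A : 'M[S]_(p, q)) (B : 'M[S]_(q, r)) :
  const_mx0 (A *m B) = const_mx0 A *m const_mx0 B.
Proof. exact: map_mxM. Qed.

(** Chain maps are built one degree at a time; the recursion keeps the property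
that composing with the differential of the source factors through the
differential of the target, which exactness propagates. *)
Lemma lift_exists P P' :
  exists f : forall i, 'M[S]_(rk P i, rk P' i),
  [/\ forall i, hmx (@dg _ _ _ P i) (@dg _ _ _ P' i) (f i),
      forall i, df P i *m f i = f i.+1 *m df P' i
    & const_mx0 (f 0) *m augmx P' = augmx P].
Proof.
have [x xE] := fin_all_exists (fun b => aug_surj P' (aug (g := P) b)).
(* Any lift x of the augmentation will do: passing to the bihomogeneous part
   only drops constants in rows or columns where the augmentation vanishes. *)
pose f0 := hpart (@dg _ _ _ P 0) (@dg _ _ _ P' 0) (\matrix_b x b).
have f0aug : const_mx0 f0 *m augmx P' = augmx P.
  apply/matrixP => b j; rewrite !mxE.
  have E c : (const_mx0 f0) b c * augmx P' c j =
      if dg (g := P) b == 0 then (x b 0 c)@_0%MM * aug c else 0.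
    rewrite !mxE mcoeff_mrestr bideg0 add0r.
    have [->|ac] := eqVneq (aug c) 0; first by rewrite !mulr0 if_same.
    by rewrite (aug_homog ac) eq_sym; case: ifP; rewrite ?mul0r.
  under eq_bigr do rewrite E.
  case: eqP => [_|db]; first exact: xE.
  rewrite big1 //; apply/esym/eqP/negP => /negP/aug_homog.
  exact: db.
pose Q i (f : 'M[S]_(rk P i, rk P' i)) :=
  hmx (@dg _ _ _ P i) (@dg _ _ _ P' i) f /\
  exists g, df P i *m f = g *m df P' i.
have Q0 : Q 0 f0.
  split; first exact: hmx_hpart.
  by apply: res_exact0_mx; rewrite const_mx0M -mulmxA f0aug df_aug.
have [|f f0E fE] := dependent_choice (R := fun i f g => df P i *m f = g *m df P' i) Q0.
  move=> i f [hf [g fg]]; pose h := hpart (@dg _ _ _ P i.+1) (@dg _ _ _ P' i.+1) g.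
  have fh : df P i *m f = h *m df P' i.
    rewrite -(hpart_mulr _ _ (@df_homog _ _ _ P' i)) -fg.
    rewrite (hpart_mull _ _ (@df_homog _ _ _ P i)).
    by rewrite (hpart_id hf).
  exists h => //; split; first exact: hmx_hpart.
  by apply: res_exact_mx; rewrite -mulmxA -fh mulmxA df_df mul0mx.
exists f; split=> [i|i|]; first by case: (fE i) => [[]].
  by case: (fE i).
by rewrite f0E.
Qed.

(** Null homotopies are built one degree at a time; the recursion keeps the
property that h i *m df i agrees with e i after composition with the
differential df i on the left. *)
Lemma homotopy_exists P (e : forall i, 'M[S]_(rk P i, rk P i)) :
    (forall i, df P i *m e i = e i.+1 *m df P i) ->
    const_mx0 (e 0) *m augmx P = 0 ->
  exists h : forall i, 'M[S]_(rk P i, rk P i.+1),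
    e 0 = h 0 *m df P 0 /\
    forall i, e i.+1 = df P i *m h i + h i.+1 *m df P i.+1.
Proof.
move=> ed /res_exact0_mx[h0 h0E].
pose Q i (h : 'M[S]_(rk P i, rk P i.+1)) :=
  df P i *m e i = df P i *m h *m df P i.
have Q0 : Q 0 h0 by rewrite /Q h0E mulmxA.
have [|h hE hR] := dependent_choice
    (R := fun i h h' => e i.+1 = df P i *m h + h' *m df P i.+1) Q0.
  move=> i h Qh.
  have [|h' h'E] := @res_exact_mx P i _ (e i.+1 - df P i *m h).
    by rewrite mulmxBl -ed Qh subrr.
  have eE : e i.+1 = df P i *m h + h' *m df P i.+1.
    by rewrite -h'E addrC subrK.
  by exists h' => //; rewrite /Q eE mulmxDr !mulmxA df_df mul0mx add0r.
exists h; split=> [|i]; first by rewrite hE.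
by case: (hR i).
Qed.

Section Action.
Variable M : lmodType S.

Definition mxact p q (A : 'M[S]_(p, q)) (x : {ffun 'I_p -> M}) : {ffun 'I_q -> M} :=
  [ffun b => \sum_a A a b *: x a].

Lemma mxactM p q r (A : 'M[S]_(p, q)) (B : 'M[S]_(q, r)) x :
  mxact (A *m B) x = mxact B (mxact A x).
Proof.
apply/ffunP => c; rewrite !ffunE.
under eq_bigr do rewrite mxE scaler_suml.
rewrite exchange_big; apply: eq_bigr => b _; rewrite ffunE scaler_sumr.
by apply: eq_bigr => a _; rewrite scalerA mulrC.
Qed.

Lemma mxactDl p q (A B : 'M[S]_(p, q)) x : mxact (A + B) x = mxact A x + mxact B x.
Proof.
apply/ffunP => c; rewrite !ffunE -big_split; apply: eq_bigr => b _.
by rewrite mxE scalerDl.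
Qed.

Lemma mxact1 p (x : {ffun 'I_p -> M}) : mxact 1%:M x = x.
Proof.
apply/ffunP => b; rewrite ffunE (bigD1 b) //= mxE eqxx scale1r big1 ?addr0 // => a.
by move=> /negPf ab; rewrite mxE ab scale0r.
Qed.

Lemma mxact_is_linear p q (A : 'M[S]_(p, q)) : linear (mxact A).
Proof.
move=> c x y; apply/ffunP => b; rewrite !ffunE scaler_sumr -big_split.
by apply: eq_bigr => a _; rewrite !ffunE scalerDr !scalerA mulrC.
Qed.

HB.instance Definition _ p q A :=
  GRing.isLinear.Build S {ffun 'I_p -> M} {ffun 'I_q -> M} *:%R (@mxact p q A)
    (mxact_is_linear A).

Lemma tens_cycleP P i (x : {ffun 'I_(rk P i.+1) -> M}) :
  tens_cycle x <-> mxact (df P i) x = 0.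
Proof.
split=> [c|/ffunP c b]; first by apply/ffunP => b; rewrite !ffunE; apply: c.
by have := c b; rewrite !ffunE.
Qed.

Lemma tens_boundaryP P i (x : {ffun 'I_(rk P i) -> M}) :
  tens_boundary x <-> exists y, x = mxact (df P i) y.
Proof.
split=> [[y xE]|[y ->]]; exists y; first by apply/ffunP => b; rewrite ffunE.
by move=> b; rewrite ffunE.
Qed.

Lemma boundaryD P i (x y : {ffun 'I_(rk P i) -> M}) :
  tens_boundary x -> tens_boundary y -> tens_boundary (x + y).
Proof.
move=> /tens_boundaryP[u ->] /tens_boundaryP[w ->]; apply/tens_boundaryP.
by exists (u + w); rewrite raddfD.
Qed.

Lemma cycle_sum P i r (c : 'I_r -> S) (b : 'I_r -> {ffun 'I_(rk P i) -> M}) :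
  (forall j, tens_cycle (b j)) -> tens_cycle (\sum_j c j *: b j).
Proof.
case: i b => [//|i] b bc; apply/tens_cycleP.
rewrite linear_sum big1 // => j _; rewrite linearZ /=.
by have /tens_cycleP-> := bc j; rewrite scaler0.
Qed.

Section ChainMap.
Variables (P P' : gfree_res k wt) (f : forall i, 'M[S]_(rk P i, rk P' i)).
Hypothesis fd : forall i, df P i *m f i = f i.+1 *m df P' i.

Lemma cycle_act i x : tens_cycle (P := P) x -> tens_cycle (P := P') (mxact (f i) x).
Proof.
case: i x => [//|i] x /tens_cycleP c; apply/tens_cycleP.
by rewrite -mxactM -fd mxactM c raddf0.
Qed.

Lemma boundary_act i x :
  tens_boundary (P := P) x -> tens_boundary (P := P') (mxact (f i) x).
Proof.
move=> /tens_boundaryP[y ->]; apply/tens_boundaryP.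
by exists (mxact (f i.+1) y); rewrite -!mxactM fd.
Qed.

End ChainMap.

Lemma homotopic_id P (f : forall i, 'M[S]_(rk P i, rk P i)) i x :
    (forall i, df P i *m f i = f i.+1 *m df P i) ->
    const_mx0 (f 0) *m augmx P = augmx P ->
  tens_cycle (P := P) x -> tens_boundary (P := P) (i := i) (x - mxact (f i) x).
Proof.
move=> fd f0 cx.
have [||h [h0 hS]] := @homotopy_exists P (fun i => 1%:M - f i).
- by move=> j; rewrite mulmxBl mulmxBr mulmx1 mul1mx fd.
- rewrite /const_mx0 map_mxB map_mx1 mulmxBl mul1mx.
  by rewrite -/(const_mx0 _) f0 subrr.
have -> : x - mxact (f i) x = mxact (1%:M - f i) x.
  apply/ffunP => b; rewrite -{1}[x]mxact1 !ffunE -sumrB.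
  by apply: eq_bigr => a _; rewrite -scalerBl !mxE.
apply/tens_boundaryP; case: i x cx => [|i] x cx.
  by exists (mxact (h 0) x); rewrite h0 mxactM.
exists (mxact (h i.+1) x); rewrite hS mxactDl !mxactM.
by move/tens_cycleP: cx => ->; rewrite raddf0 add0r.
Qed.

End Action.

Variables (M : lmodType S) (gr : nat * nat -> M -> Prop).
Hypothesis gr0 : forall v, gr v 0.
Hypothesis grD : forall v x y, gr v x -> gr v y -> gr v (x + y).
Hypothesis grZ : forall u v f x, bihomog wt u f -> gr v x -> gr (u + v) (f *: x).

Lemma homog_act p q da db (A : 'M[S]_(p, q)) v (x : {ffun 'I_p -> M}) :
    hmx da db A ->
    (forall a, x a = 0 \/ exists2 u, u + da a = v & gr u (x a)) ->
  forall b, mxact A x b = 0 \/ exists2 u, u + db b = v & gr u (mxact A x b).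
Proof.
move=> hA hx b; rewrite ffunE.
have term a : A a b *: x a = 0 \/ exists2 u, u + db b = v & gr u (A a b *: x a).
  have [->|[u uv gu]] := hx a; first by left; rewrite scaler0.
  case E : (msupp (A a b)) => [|m s].
    by left; rewrite (msuppnil0 E) scale0r.
  have mA : m \in msupp (A a b) by rewrite E mem_head.
  right; exists (bideg wt m + u).
    by rewrite addrAC (hA _ _ _ mA) addrC.
  apply: grZ gu => m' m'A; apply/eqP; rewrite -(addpI (db b)).
  by rewrite ![db b + _]addrC (hA _ _ _ mA) (hA _ _ _ m'A).
have [/existsP[a nz]|] := boolP [exists a, A a b *: x a != 0]; last first.
  rewrite negb_exists => /forallP z; left; apply: big1 => a _.
  by apply/eqP; have := z a; rewrite negbK.
have [z|[u uv _]] := term a; first by rewrite z eqxx in nz.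
right; exists u => //; apply: (big_ind (gr u) (gr0 u) (@grD u)) => c _.
have [->//|[w wv gw]] := term c.
suff -> : u = w by [].
by apply/eqP; rewrite -(addpI (db b)) ![db b + _]addrC uv wv.
Qed.

(** Lifts f and g in both directions carry bases of one subquotient to bases of the
other, as both composites are homotopic to the identity; f and g preserve
bidegrees because their matrices are homogeneous. *)
Theorem tor_rank_indep P P' i v r : tor_rank gr P i v r -> tor_rank gr P' i v r.
Proof.
have [f [fh fd f0]] := lift_exists P P'.
have [g [gh gd g0]] := lift_exists P' P.
have fgd j : df P j *m (f j *m g j) = (f j.+1 *m g j.+1) *m df P j.
  by rewrite mulmxA fd -!mulmxA gd.
have gfd j : df P' j *m (g j *m f j) = (g j.+1 *m f j.+1) *m df P' j.
  by rewrite mulmxA gd -!mulmxA fd.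
have fg0 : const_mx0 (f 0 *m g 0) *m augmx P = augmx P.
  by rewrite const_mx0M -mulmxA g0 f0.
have gf0 : const_mx0 (g 0 *m f 0) *m augmx P' = augmx P'.
  by rewrite const_mx0M -mulmxA f0 g0.
case=> b [bA bspan bfree].
exists (fun j => mxact (f i) (b j)); split=> [j|x' [hx' cx']|c].
- have [bh bc] := bA j; split; last exact: (cycle_act fd).
  exact: (homog_act (fh i)).
- have [|c cB] := bspan (mxact (g i) x').
    split; last exact: (cycle_act gd).
    exact: (homog_act (gh i)).
  exists c; have B1 := boundary_act fd cB.
  have B2 := homotopic_id (i := i) (f := fun i => g i *m f i) gfd gf0 cx'.
  have := boundaryD B2 B1; rewrite mxactM raddfB /= addrA subrK.
  by rewrite linear_sum /=; under eq_bigr do rewrite linearZ /=.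
move=> B'; apply: bfree.
have := boundary_act gd B'.
have -> : \sum_j (c j)%:MP *: mxact (f i) (b j) =
    mxact (f i) (\sum_j (c j)%:MP *: b j).
  by rewrite linear_sum; apply: eq_bigr => j _; rewrite linearZ.
rewrite -mxactM => B1.
have cyc : tens_cycle (P := P) (\sum_j (c j)%:MP *: b j).
  by apply: cycle_sum => j; case: (bA j).
have B2 := homotopic_id (i := i) (f := fun i => f i *m g i) fgd fg0 cyc.
by have := boundaryD B2 B1; rewrite subrK.
Qed.

End Comparison.

(** * The ideal of quadrics *)

Section Indeterminates.
Variable n : nat.
Local Notation N := ((n + n) + (n + n))%N.

(** The indices of p_1i, p_2i, q_1i and q_2i. *)
Definition va (i : 'I_n) : 'I_N := lshift (n + n) (lshift n i).
Definition vb (i : 'I_n) : 'I_N := lshift (n + n) (rshift n i).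
Definition vc (i : 'I_n) : 'I_N := rshift (n + n) (lshift n i).
Definition vd (i : 'I_n) : 'I_N := rshift (n + n) (rshift n i).

Definition Xs : {set 'I_N} := [set s : 'I_N | (s < n + n)%N].
Definition Ys : {set 'I_N} := [set s : 'I_N | (n + n <= s)%N].

Lemma XsP s : s \in Xs -> (exists i, s = va i) \/ (exists i, s = vb i).
Proof.
rewrite inE; case: (splitP s) => [x e _|//].
have -> : s = lshift (n + n) x by apply: val_inj.
case: (splitP x) => [i ei|i ei]; [left|right]; exists i; congr lshift; exact: val_inj.
Qed.

Lemma YsP s : s \in Ys -> (exists i, s = vc i) \/ (exists i, s = vd i).
Proof.
rewrite inE; case: (splitP s) => [x -> |y e _]; first by rewrite leqNgt ltn_ord.
have -> : s = rshift (n + n) y by apply: val_inj.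
case: (splitP y) => [i ei|i ei]; [left|right]; exists i; congr rshift; exact: val_inj.
Qed.

Lemma va_Xs i : va i \in Xs. Proof. by rewrite inE /=; have := ltn_ord i; lia. Qed.
Lemma vb_Xs i : vb i \in Xs. Proof. by rewrite inE /=; have := ltn_ord i; lia. Qed.
Lemma vc_Ys i : vc i \in Ys. Proof. by rewrite inE /=; have := ltn_ord i; lia. Qed.
Lemma vd_Ys i : vd i \in Ys. Proof. by rewrite inE /=; have := ltn_ord i; lia. Qed.
Lemma XsN s : (s \notin Xs) = (s \in Ys). Proof. by rewrite !inE -leqNgt. Qed.
Lemma YsN s : (s \notin Ys) = (s \in Xs). Proof. by rewrite !inE -ltnNge. Qed.

Lemma sum_Xs (V : nmodType) (F : 'I_N -> V) :
  \sum_(s in Xs) F s = \sum_i F (va i) + \sum_i F (vb i).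
Proof.
rewrite big_mkcond big_split_ord /= [X in _ + X]big1 ?addr0; last first.
  by move=> y _; rewrite inE /= ltnNge leq_addr.
rewrite big_split_ord; congr (_ + _); apply: eq_bigr => i _.
  by rewrite va_Xs.
by rewrite vb_Xs.
Qed.

Lemma sum_Ys (V : nmodType) (F : 'I_N -> V) :
  \sum_(s in Ys) F s = \sum_i F (vc i) + \sum_i F (vd i).
Proof.
rewrite big_mkcond big_split_ord /= [X in X + _]big1 ?add0r; last first.
  by move=> x _; rewrite inE /= leqNgt ltn_ord.
rewrite big_split_ord; congr (_ + _); apply: eq_bigr => i _.
  by rewrite vc_Ys.
by rewrite vd_Ys.
Qed.

Lemma XY_neq s t : s \in Xs -> t \in Ys -> (s == t) = false.
Proof. by move=> sX tY; apply/eqP => st; rewrite -st -XsN sX in tY. Qed.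

Lemma var_eqE : (forall i j, (va i == vb j) = false) * (forall i j, (vb i == va j) = false) *
  (forall i j, (vc i == vd j) = false) * (forall i j, (vd i == vc j) = false) *
  (forall i j, (va i == va j) = (i == j)) * (forall i j, (vb i == vb j) = (i == j)) *
  (forall i j, (vc i == vc j) = (i == j)) * (forall i j, (vd i == vd j) = (i == j)).
Proof.
have ab i j : (va i == vb j) = false by apply/eqP => /lshift_inj/eqP; rewrite eq_lrshift.
have cd i j : (vc i == vd j) = false by apply/eqP => /rshift_inj/eqP; rewrite eq_lrshift.
have ba i j : (vb i == va j) = false by rewrite eq_sym.
have dc i j : (vd i == vc j) = false by rewrite eq_sym.
have aa i j : (va i == va j) = (i == j) by rewrite !(inj_eq (@lshift_inj _ _)).
have bb i j : (vb i == vb j) = (i == j).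
  by rewrite (inj_eq (@lshift_inj _ _)) (inj_eq (@rshift_inj _ _)).
have cc i j : (vc i == vc j) = (i == j).
  by rewrite (inj_eq (@rshift_inj _ _)) (inj_eq (@lshift_inj _ _)).
have dd i j : (vd i == vd j) = (i == j) by rewrite !(inj_eq (@rshift_inj _ _)).
exact: (ab, ba, cd, dc, aa, bb, cc, dd).
Qed.

End Indeterminates.

Section TheIdeal.
Variables (k : fieldType) (n : nat).
Local Notation N := ((n + n) + (n + n))%N.
Local Notation S := {mpoly k[N]}.
Local Notation Z := (Zring k n).
Local Notation pi := (@Zproj k n).
Local Notation Xs := (Xs n).
Local Notation Ys := (Ys n).

Definition mixed_coef (f : S) (s t : 'I_N) : k := f@_(U_(s) + U_(t))%MM.

(** Membership in R of the element of V (x) W with coefficients g. *)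
Definition rel_coef (g : 'I_N -> 'I_N -> k) :=
  [/\ forall i j, g (va i) (vc j) = - g (vb i) (vd j),
      forall i j, g (va i) (vd j) = g (va j) (vd i)
    & forall i j, g (vb i) (vc j) = g (vb j) (vc i)].

Lemma mrestr_Ys_XX c s t : s \in Xs -> t \in Ys ->
  mrestr (free_of Ys) (c * ('X_s * 'X_t)) = 0 :> S.
Proof.
move=> sX tY; apply/mpolyP => a; rewrite mcoeff_mrestr mcoeff0.
case: ifP => // /forall_inP/(_ t tY)/eqP at0.
by rewrite mulrA mulrC mcoeffXUM at0.
Qed.

Lemma mrestr_Xs_XX c s t : s \in Xs -> t \in Ys ->
  mrestr (free_of Xs) (c * ('X_s * 'X_t)) = 0 :> S.
Proof.
move=> sX tY; apply/mpolyP => a; rewrite mcoeff_mrestr mcoeff0.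
case: ifP => // /forall_inP/(_ s sX)/eqP as0.
by rewrite mulrCA mcoeffXUM as0.
Qed.

Lemma mixed_coef_mulXX c s t s' t' :
    s \in Xs -> t \in Ys -> s' \in Xs -> t' \in Ys ->
  mixed_coef (c * ('X_s * 'X_t)) s' t' = c@_0%MM * ((s == s') && (t == t'))%:R.
Proof.
move=> sX tY s'X t'Y; rewrite /mixed_coef mulrCA mcoeffXUM mnmDE !mnm1E eq_sym.
rewrite [t' == s]eq_sym (XY_neq sX t'Y) addn0.
case: (eqVneq s s') => [<-|] /=; last by rewrite mulr0.
rewrite mulrC mcoeffXUM mnmBE mnmDE !mnm1E (XY_neq sX tY) add0n subn0.
rewrite eq_sym; case: eqP => [<-|_]; last by rewrite mulr0.
rewrite mulr1 /=; congr (_@__); apply/mnmP => u.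
by rewrite !mnmBE mnmDE mnm0E; lia.
Qed.

Lemma pi_eq0 f : (pi f == 0) = (f \in @quad_ideal k n).
Proof. by rewrite -[f in RHS]subr0 Quotient.idealrBE -/(pi _) raddf0. Qed.

Lemma pi_surj z : exists f, z = pi f.
Proof. by exists (repr z); rewrite /Zproj reprK. Qed.

Lemma pi_quads f : f \in quads k n -> pi f = 0.
Proof.
move=> fq; apply/eqP; rewrite pi_eq0; apply/boolp.asboolP.
have lt : (index f (quads k n) < size (quads k n))%N by rewrite index_mem.
exists (fun j => (j == Ordinal lt)%:R); rewrite (bigD1 (Ordinal lt)) //= eqxx mul1r.
by rewrite nth_index // big1 ?addr0 // => j /negPf->; rewrite mul0r.
Qed.

Hypothesis char_k : 2%N \notin [pchar k].

Lemma two_neq0 : (2%:R : k) != 0.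
Proof. by apply: contra char_k => h; rewrite inE. Qed.

Lemma Z_opp_eq0 (z : Z) : z = - z -> z = 0.
Proof.
move/eqP; rewrite -addr_eq0 -mulr2n -mulr_natl => /eqP z2.
rewrite -[z]mul1r -(rmorph1 pi) -[1]/((1 : k)%:MP) -(mulVf two_neq0).
by rewrite rmorphM /= rmorphM /= -mulrA !rmorph_nat z2 mulr0.
Qed.

Definition zX (s : 'I_N) : Z := pi 'X_s.

Lemma rel_ac_bd i j : zX (va i) * zX (vc j) = zX (vb i) * zX (vd j).
Proof.
apply/eqP; rewrite -subr_eq0 -!rmorphM -rmorphB; apply/eqP/pi_quads.
rewrite mem_cat; apply/orP; left; apply/allpairsP; exists (i, j).
by rewrite !mem_enum.
Qed.

Lemma rel_ad i j : zX (va i) * zX (vd j) = - (zX (va j) * zX (vd i)).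
Proof.
wlog le : i j / (i <= j)%N.
  by move=> W; case: (leqP i j) => [|/ltnW] /W // ->; rewrite opprK.
have {le}: (i == j) || (i < j)%N by rewrite -val_eqE -leq_eqVlt.
case/orP => [/eqP->|lt].
  have -> : zX (va j) * zX (vd j) = 0; last by rewrite oppr0.
  rewrite -rmorphM; apply: pi_quads; rewrite !mem_cat.
  by apply/orP; right; apply/orP; left; apply/mapP; exists j; rewrite ?mem_enum.
apply/eqP; rewrite -addr_eq0 -!rmorphM -rmorphD; apply/eqP/pi_quads.
rewrite !mem_cat; do 3!(apply/orP; right); apply/orP; left.
apply/allpairsPdep; exists i, j; rewrite mem_enum; split => //.
by rewrite mem_filter lt mem_enum.
Qed.

Lemma rel_bc i j : zX (vb i) * zX (vc j) = - (zX (vb j) * zX (vc i)).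
Proof.
wlog le : i j / (i <= j)%N.
  by move=> W; case: (leqP i j) => [|/ltnW] /W // ->; rewrite opprK.
have {le}: (i == j) || (i < j)%N by rewrite -val_eqE -leq_eqVlt.
case/orP => [/eqP->|lt].
  have -> : zX (vb j) * zX (vc j) = 0; last by rewrite oppr0.
  rewrite -rmorphM; apply: pi_quads; rewrite !mem_cat.
  do 2!(apply/orP; right); apply/orP; left.
  by apply/mapP; exists j; rewrite ?mem_enum.
apply/eqP; rewrite -addr_eq0 -!rmorphM -rmorphD; apply/eqP/pi_quads.
rewrite !mem_cat; do 4!(apply/orP; right).
apply/allpairsPdep; exists i, j; rewrite mem_enum; split => //.
by rewrite mem_filter lt mem_enum.
Qed.

(** The transpositions (1 2) and (2 3) are conjugate in S_3, so they cannot act on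
a nonzero U by different signs: applying both three times turns U into - U. *)
Lemma antisym_sym_eq0 (I : Type) (V : zmodType) (U : I -> I -> I -> V) :
    (forall x : V, x = - x -> x = 0) ->
    (forall i j l, U i j l = U j i l) -> (forall i j l, U i j l = - U i l j) ->
  forall i j l, U i j l = 0.
Proof.
move=> two sym anti i j l; apply: two.
rewrite {1}anti {1}sym {1}anti {1}sym {1}anti {1}sym opprK //.
Qed.

(** Each product is symmetric in one pair of indices and antisymmetric in an
overlapping pair.  This is immediate for p_1 p_1 q_2 and p_2 p_2 q_1; for the
other types the second symmetry appears only after exchanging p_1 q_1 with
p_2 q_2. *)
Lemma zX_xxy s s' t : s \in Xs -> s' \in Xs -> t \in Ys ->
  zX s * zX s' * zX t = 0.
Proof.
have aad i j l : zX (va i) * zX (va j) * zX (vd l) = 0.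
  move: i j l; apply: antisym_sym_eq0 Z_opp_eq0 _ _ => i j l.
    by rewrite [_ * zX (va j)]mulrC.
  by rewrite -!mulrA rel_ad mulrN.
have bbc i j l : zX (vb i) * zX (vb j) * zX (vc l) = 0.
  move: i j l; apply: antisym_sym_eq0 Z_opp_eq0 _ _ => i j l.
    by rewrite [_ * zX (vb j)]mulrC.
  by rewrite -!mulrA rel_bc mulrN.
have aac_abd i j l : zX (va i) * zX (va j) * zX (vc l) =
    zX (va i) * zX (vb j) * zX (vd l) by rewrite -mulrA rel_ac_bd mulrA.
have abd i j l : zX (va i) * zX (vb j) * zX (vd l) = 0.
  rewrite -(antisym_sym_eq0 (U := fun i j l => zX (va j) * zX (vb i) * zX (vd l))
    Z_opp_eq0 _ _ j i l) // => {}i {}j {}l.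
    by rewrite -!aac_abd [_ * zX (va i)]mulrC.
  by rewrite mulrAC rel_ad mulNr mulrAC.
have abc_bbd i j l : zX (va i) * zX (vb j) * zX (vc l) =
    zX (vb i) * zX (vb j) * zX (vd l) by rewrite mulrAC rel_ac_bd mulrAC.
have abc i j l : zX (va i) * zX (vb j) * zX (vc l) = 0.
  move: i j l; apply: antisym_sym_eq0 Z_opp_eq0 _ _ => i j l.
    by rewrite !abc_bbd [_ * zX (vb j)]mulrC.
  by rewrite -!mulrA rel_bc mulrN.
move=> /XsP[] [i ->] /XsP[] [j ->] /YsP[] [l ->].
- by rewrite aac_abd abd.
- exact: aad.
- exact: abc.
- exact: abd.
- by rewrite [_ * zX (va j)]mulrC abc.
- by rewrite [_ * zX (va j)]mulrC abd.
- exact: bbc.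
- by rewrite -abc_bbd abc.
Qed.

(** The same argument as for [zX_xxy], with two factors among the q's. *)
Lemma zX_xyy s t t' : s \in Xs -> t \in Ys -> t' \in Ys ->
  zX s * zX t * zX t' = 0.
Proof.
have add i j l : zX (va i) * zX (vd j) * zX (vd l) = 0.
  rewrite -(antisym_sym_eq0 (U := fun j l i => zX (va i) * zX (vd j) * zX (vd l))
    Z_opp_eq0 _ _ j l i) // => {}i {}j {}l; first by rewrite mulrAC.
  by rewrite mulrAC (rel_ad l) mulNr mulrAC.
have bcc i j l : zX (vb i) * zX (vc j) * zX (vc l) = 0.
  rewrite -(antisym_sym_eq0 (U := fun j l i => zX (vb i) * zX (vc j) * zX (vc l))
    Z_opp_eq0 _ _ j l i) // => {}i {}j {}l; first by rewrite mulrAC.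
  by rewrite mulrAC (rel_bc l) mulNr mulrAC.
have acc_bdc i j l : zX (va i) * zX (vc j) * zX (vc l) =
    zX (vb i) * zX (vd j) * zX (vc l) by rewrite rel_ac_bd.
have bdc i j l : zX (vb i) * zX (vd j) * zX (vc l) = 0.
  rewrite -(antisym_sym_eq0 (U := fun j l i => zX (vb i) * zX (vd j) * zX (vc l))
    Z_opp_eq0 _ _ j l i) // => {}i {}j {}l; first by rewrite -!acc_bdc mulrAC.
  by rewrite mulrAC (rel_bc l) mulNr mulrAC.
have acd_bdd i j l : zX (va i) * zX (vc j) * zX (vd l) =
    zX (vb i) * zX (vd j) * zX (vd l) by rewrite rel_ac_bd.
have acd i j l : zX (va i) * zX (vc j) * zX (vd l) = 0.
  rewrite -(antisym_sym_eq0 (U := fun j l i => zX (va i) * zX (vc j) * zX (vd l))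
    Z_opp_eq0 _ _ j l i) // => {}i {}j {}l; first by rewrite !acd_bdd mulrAC.
  by rewrite mulrAC (rel_ad l) mulNr mulrAC.
move=> /XsP[] [i ->] /YsP[] [j ->] /YsP[] [l ->].
- by rewrite acc_bdc bdc.
- exact: acd.
- by rewrite mulrAC acd.
- exact: add.
- exact: bcc.
- by rewrite mulrAC bdc.
- exact: bdc.
- by rewrite -acd_bdd acd.
Qed.

(** Mixed monomials of degree at least 3 vanish in Z, so only the coefficients of
degree 2 matter. *)
Lemma pi_mixed f :
    (forall a, a \in msupp f -> ~~ free_of Xs a /\ ~~ free_of Ys a) ->
  pi f = \sum_(s in Xs) \sum_(t in Ys)
    pi (mixed_coef f s t)%:MP * (zX s * zX t).
Proof.
move=> fm.
pose q : S := \sum_(s in Xs) \sum_(t in Ys) (mixed_coef f s t)%:MP * ('X_s * 'X_t).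
have qE (a : 'X_{1..N}) : q@_a =
   \sum_(s in Xs) \sum_(t in Ys) mixed_coef f s t * (a == (U_(s) + U_(t))%MM)%:R.
  rewrite raddf_sum; apply: eq_bigr => s _; rewrite raddf_sum; apply: eq_bigr => t _ /=.
  by rewrite mcoeffCM -mpolyXD mcoeffX eq_sym.
have q2 s t : s \in Xs -> t \in Ys -> mixed_coef q s t = mixed_coef f s t.
  move=> sX tY; rewrite /mixed_coef qE (bigD1 s) //= (bigD1 t) //= eqxx mulr1.
  have uniqst s' t' : s' \in Xs -> t' \in Ys ->
      (U_(s) + U_(t) == U_(s') + U_(t') :> 'X_{1..N})%MM -> s' = s /\ t' = t.
    move=> s'X t'Y /eqP/mnmP e; have := e s'; have := e t'.
    rewrite !mnmDE !mnm1E !eqxx.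
    have neq x y : x \in Xs -> y \in Ys -> (x == y) = false.
      by move=> xX yY; apply/eqP => xy; rewrite -xy -XsN xX in yY.
    rewrite (neq s t') // (neq s' t') // [t == s']eq_sym [t' == s']eq_sym.
    rewrite (neq s' t) // (neq s' t') //.
    by case: eqP => [->|] //; case: eqP => [->|].
  rewrite big1 ?addr0 => [|t' /andP[t'Y nt]]; last first.
    case: eqP => [/eqP/(uniqst _ _ sX t'Y)[_ e]|_]; last by rewrite mulr0.
    by rewrite e eqxx in nt.
  rewrite big1 ?addr0 // => s' /andP[s'X ns]; apply: big1 => t' t'Y.
  case: eqP => [/eqP/(uniqst _ _ s'X t'Y)[e _]|_]; last by rewrite mulr0.
  by rewrite e eqxx in ns.
have -> : \sum_(s in Xs) \sum_(t in Ys) pi (mixed_coef f s t)%:MP * (zX s * zX t) = pi q.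
  rewrite raddf_sum; apply: eq_bigr => s _; rewrite raddf_sum; apply: eq_bigr => t _ /=.
  by rewrite !rmorphM.
apply/eqP; rewrite -subr_eq0 -rmorphB; set g := f - q.
rewrite (mpolyE g) raddf_sum big1_seq // => a /andP[_ ag].
rewrite -mul_mpolyC [LHS]rmorphM /=.
have [aX aY] : ~~ free_of Xs a /\ ~~ free_of Ys a.
  have [/fm//|] := boolP (a \in msupp f); move/memN_msupp_eq0 => fa.
  move: ag; rewrite mcoeff_msupp mcoeffB fa sub0r oppr_eq0 => qa.
  have /existsP[s /existsP[t /and3P[sX tY /eqP->]]] : [exists s, exists t,
     [&& s \in Xs, t \in Ys & a == (U_(s) + U_(t))%MM]].
    apply: contraNT qa; rewrite negb_exists => /forallP no; rewrite qE.
    apply/eqP/big1 => s sX; apply: big1 => t tY.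
    have := no s; rewrite negb_exists => /forallP/(_ t); rewrite sX tY /=.
    by move/negPf->; rewrite mulr0.
  by split; apply/forall_inPn; [exists s|exists t] => //;
    rewrite mnmDE !mnm1E eqxx ?addn1.
have /forall_inPn[s sX as0] := aX; have /forall_inPn[t tY at0] := aY.
have st : s != t by apply/eqP => e; rewrite -e -XsN sX in tY.
pose b := (a - (U_(s) + U_(t)))%MM.
have aE : a = (b + (U_(s) + U_(t)))%MM.
  rewrite submK //; apply/mnm_lepP => j; rewrite mnmDE !mnm1E.
  case: (eqVneq s j) => [<-|_]; first by rewrite eq_sym (negPf st) addn0 lt0n.
  by case: (eqVneq t j) => [<-|_]; rewrite ?lt0n.
have [b0|/eqP b0] := eqVneq b 0%MM.
  move: ag; rewrite aE b0 add0m mcoeff_msupp mcoeffB.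
  by rewrite -!/(mixed_coef _ _ _) q2 // subrr eqxx.
have [u bu] : exists u, (0 < b u)%N.
  apply/existsP; apply: contra_notT b0; rewrite negb_exists => /forallP no.
  by apply/mnmP => u; rewrite mnm0E; apply/eqP; rewrite -leqn0 leqNgt no.
rewrite aE mpolyXD -(@submK _ U_(u)%MM b) ?lep1mP -?lt0n // mpolyXD.
have z3 : zX s * zX t * zX u = 0.
  have [uX|] := boolP (u \in Xs); first by rewrite mulrAC zX_xxy.
  by rewrite XsN => uY; rewrite zX_xyy.
rewrite mpolyXD !rmorphM /= -/(zX u) -/(zX s) -/(zX t).
by rewrite -[_ * zX u * _]mulrA [zX u * _]mulrC z3 !mulr0.
Qed.

(** One direction checks the three conditions on multiples of the generators.  For
the other, the class of a mixed polynomial is a combination of products x y; the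
first condition of [rel_coef] cancels p_1 q_1 against p_2 q_2, and in the other
two parts symmetric coefficients meet antisymmetric products. *)
Lemma in_idealP f : pi f = 0 <->
  [/\ mrestr (free_of Ys) f = 0, mrestr (free_of Xs) f = 0
    & rel_coef (mixed_coef f)].
Proof.
split=> [/eqP|[f0Y f0X [g1 g2 g3]]]; last first.
  rewrite pi_mixed => [|a af]; last first.
    split; apply: contraL af => aX; rewrite mcoeff_msupp negbK.
      by have := mcoeff_mrestr (free_of Xs) f a; rewrite aX f0X mcoeff0 => <-.
    by have := mcoeff_mrestr (free_of Ys) f a; rewrite aX f0Y mcoeff0 => <-.
  pose G s t := pi (mixed_coef f s t)%:MP * (zX s * zX t).
  have ab : \sum_i \sum_j G (va i) (vd j) = 0.
    apply: Z_opp_eq0; rewrite {1}exchange_big /= -sumrN; apply: eq_bigr => i _.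
    rewrite -sumrN; apply: eq_bigr => j _.
    by rewrite /G g2 rel_ad mulrN.
  have ba : \sum_i \sum_j G (vb i) (vc j) = 0.
    apply: Z_opp_eq0; rewrite {1}exchange_big /= -sumrN; apply: eq_bigr => i _.
    rewrite -sumrN; apply: eq_bigr => j _.
    by rewrite /G g3 rel_bc mulrN.
  rewrite -/(\sum_(s in Xs) \sum_(t in Ys) G s t) sum_Xs.
  under eq_bigr do rewrite sum_Ys.
  under [X in _ + X]eq_bigr do rewrite sum_Ys.
  rewrite !big_split /= ab ba addr0 add0r -big_split big1 // => i _.
  rewrite -big_split big1 // => j _.
  by rewrite /G rel_ac_bd g1 mpolyCN rmorphN mulNr; exact: addNr.
rewrite pi_eq0 => /boolp.asboolP[c ->].
pose good f := [/\ mrestr (free_of Ys) f = 0, mrestr (free_of Xs) f = 0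
    & rel_coef (mixed_coef f)].
rewrite -/(good _).
have gD f1 f2 : good f1 -> good f2 -> good (f1 + f2).
  case=> e1 e2 [g1 g2 g3] [e3 e4 [g4 g5 g6]].
  split; [by rewrite raddfD /= e1 e3 addr0|by rewrite raddfD /= e2 e4 addr0|].
  split=> i j; rewrite /mixed_coef !mcoeffD -!/(mixed_coef _ _ _).
  - by rewrite g1 g4 opprD.
  - by rewrite g2 g5.
  - by rewrite g3 g6.
apply: (big_ind good) => //.
  split; [exact: raddf0|exact: raddf0|].
  by split=> i j; rewrite /mixed_coef !mcoeff0 ?oppr0.
move=> j _; move: (c j) (mem_nth 0 (ltn_ord j)); move: (_`_j) => q {}c.
have pure s t sX tY := conj (@mrestr_Ys_XX c s t sX tY) (@mrestr_Xs_XX c s t sX tY).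
have mixE := (mixed_coef_mulXX c, va_Xs, vb_Xs, vc_Ys, vd_Ys, var_eqE).
have mcD f1 f2 s t : mixed_coef (f1 + f2) s t = mixed_coef f1 s t + mixed_coef f2 s t.
  exact: mcoeffD.
have mcB f1 f2 s t : mixed_coef (f1 - f2) s t = mixed_coef f1 s t - mixed_coef f2 s t.
  exact: mcoeffB.
rewrite !mem_cat => /or4P[/allpairsPdep[i [l [_ _ ->]]]|/mapP[i _ ->]
  |/mapP[i _ ->]|/orP[]/allpairsPdep[i [l [_ _ ->]]]].
- have [e1 e2] := pure _ _ (va_Xs i) (vc_Ys l).
  have [e3 e4] := pure _ _ (vb_Xs i) (vd_Ys l).
  rewrite mulrBr /good !raddfB /= e1 e2 e3 e4 subrr; split=> //.
  by split=> i' j'; rewrite !mcB !mixE /= ?andbF ?mulr0 ?subr0 ?sub0r ?opprK.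
- have [e1 e2] := pure _ _ (va_Xs i) (vd_Ys i).
  rewrite /good e1 e2; split=> //; split=> i' j'; rewrite !mixE /= ?andbF ?mulr0 ?oppr0 //.
  by rewrite andbC.
- have [e1 e2] := pure _ _ (vb_Xs i) (vc_Ys i).
  rewrite /good e1 e2; split=> //; split=> i' j'; rewrite !mixE /= ?andbF ?mulr0 ?oppr0 //.
  by rewrite andbC.
- have [e1 e2] := pure _ _ (va_Xs i) (vd_Ys l).
  have [e3 e4] := pure _ _ (va_Xs l) (vd_Ys i).
  rewrite mulrDr /good !raddfD /= e1 e2 e3 e4 addr0; split=> //.
  split=> i' j'; rewrite !mcD !mixE /= ?andbF ?mulr0 ?addr0 ?oppr0 //.
  by rewrite addrC ![(_ == i') && _]andbC.
- have [e1 e2] := pure _ _ (vb_Xs i) (vc_Ys l).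
  have [e3 e4] := pure _ _ (vb_Xs l) (vc_Ys i).
  rewrite mulrDr /good !raddfD /= e1 e2 e3 e4 addr0; split=> //.
  split=> i' j'; rewrite !mcD !mixE /= ?andbF ?mulr0 ?addr0 ?oppr0 //.
  by rewrite addrC ![(_ == i') && _]andbC.
Qed.

End TheIdeal.

(** * Bihomogeneous Koszul chains *)

Section HomogeneousChains.
Variables (k : fieldType) (N : nat) (wt : 'I_N -> nat * nat).
Local Notation S := {mpoly k[N]}.
Implicit Types F G : {set 'I_N} -> S.

(** Bidegree v for Koszul chains, e_T having the total degree of its
indeterminates. *)
Definition hchain v F := forall T a, (F T)@_a != 0 -> bideg wt a + wtset wt T = v.

Lemma hchain_kd L v F : hchain v F -> hchain v (koszul_d L F).
Proof.
move=> hF T a; rewrite mcoeff_kd => nz.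
have /existsP[s /andP[/and3P[_ sT as0] nzs]] : [exists s,
    [&& s \in L, s \notin T & (0 < a s)%N] && ((F (s |: T))@_(a - U_(s))%MM != 0)].
  apply: contraNT nz; rewrite negb_exists => /forallP no.
  apply/eqP/big1 => s sLT; have := no s; rewrite sLT /= negbK => /eqP->.
  by rewrite mulr0.
have := hF _ _ nzs; rewrite wtsetU1 // addrA -(bidegU wt s) -bidegD.
by rewrite submK // lep1mP -lt0n.
Qed.

Lemma hchain_kh L v F : hchain v F -> hchain v (koszul_h L F).
Proof.
move=> hF T a; rewrite mcoeff_kh; have := lowestP (T :&: L).
case: lowest => [m [/setIP[mT _] _]|_]; last by rewrite eqxx.
case: ifP => _; last by rewrite eqxx.
rewrite mulf_eq0 signr_eq0 => /hF.
by rewrite bidegD bidegU -addrA -wtsetU1 ?setD1K // !inE eqxx.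
Qed.

Lemma hchain_mrestr (P : pred 'X_{1..N}) v F :
  hchain v F -> hchain v (fun T => mrestr P (F T)).
Proof. by move=> hF T a; rewrite mcoeff_mrestr; case: ifP => [_ /hF|]; rewrite ?eqxx. Qed.

Lemma hchainD v F G : hchain v F -> hchain v G -> hchain v (fun T => F T + G T).
Proof.
move=> hF hG T a; rewrite mcoeffD; have [->|/hF//] := eqVneq (F T)@_a 0.
by rewrite add0r => /hG.
Qed.

Lemma hchainB v F G : hchain v F -> hchain v G -> hchain v (fun T => F T - G T).
Proof.
move=> hF hG; apply: hchainD => // T a; rewrite mcoeffN oppr_eq0; exact: hG.
Qed.

Lemma iota_mrestr (P : pred 'X_{1..N}) s F T :
  iota_ s (fun U => mrestr P (F U)) T = mrestr P (iota_ s F T).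
Proof.
rewrite /iota_; case: ifP => _; first by rewrite raddf0.
by apply/mpolyP => a; rewrite !(mcoeff_signM, mcoeff_mrestr); case: ifP; rewrite ?mulr0.
Qed.

Lemma kh_eq0 L F : (forall T, F T = 0) -> forall T, koszul_h L F T = 0.
Proof.
move=> F0 T; apply/mpolyP => a; rewrite mcoeff_kh mcoeff0.
by case: lowest => // m; rewrite F0 mcoeff0 mulr0 if_same.
Qed.

Lemma kd_eq0 L F : (forall T, F T = 0) -> forall T, koszul_d L F T = 0.
Proof.
move=> F0 T; apply: big1 => s _.
by rewrite /iota_; case: ifP; rewrite ?F0 !mulr0.
Qed.

Lemma free_of_setT a : free_of [set: 'I_N] a -> a = 0%MM.
Proof.
by move/forall_inP => a0; apply/mnmP => s; rewrite mnm0E; apply/eqP/a0; rewrite inE.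
Qed.

(** With all indeterminates in L, the defect of the contraction is confined to
constants at T = set0, hence to homological degree 0 and bidegree 0. *)
Lemma koszul_acyclic v i F : homog_chain i F -> hchain v F ->
    (i, v) != (0%N, 0) -> (forall T, koszul_d setT F T = 0) ->
  forall T, F T = koszul_d setT (koszul_h setT F) T.
Proof.
move=> Fi hF nz dF T; have := koszul_homotopy setT F T.
rewrite (kh_eq0 setT dF) addr0 => ->; suff -> : koszul_p setT F T = 0 by rewrite subr0.
rewrite /koszul_p -setI_eq0 setIT; case: eqP => // T0; apply/mpolyP => a.
rewrite mcoeff_mrestr mcoeff0; case: ifP => // /free_of_setT a0.
apply/eqP; apply: contraNT nz => Fa; have := hF _ _ Fa.
rewrite a0 bideg0 add0r T0 /wtset big_set0 => <-.
apply/eqP; congr (_, _); have [//|i0] := eqVneq i 0%N.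
by move: Fa; rewrite T0 Fi ?mcoeff0 ?eqxx // cards0 eq_sym.
Qed.

Definition const_chain (w : {set 'I_N} -> k) T : S := (w T)%:MP.

Lemma iota_const s w T : iota_ s (const_chain w) T = (iota_ s w T)%:MP.
Proof.
rewrite /iota_; case: ifP; rewrite ?mpolyC0 // => _.
by rewrite mpolyCM rmorphXn rmorphN rmorph1.
Qed.

End HomogeneousChains.

(** * Pure strands of the Koszul complex of Z *)

Section BigradedChains.
Variables (k : fieldType) (n : nat).
Local Notation N := ((n + n) + (n + n))%N.
Local Notation S := {mpoly k[N]}.
Local Notation pi := (@Zproj k n).
Local Notation wt := (@pq_wt n).
Local Notation Xs := (Xs n).
Local Notation Ys := (Ys n).
Implicit Types F G : {set 'I_N} -> S.

Lemma pq_wtE s : wt s = if s \in Xs then (1%N, 0%N) else (0%N, 1%N).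
Proof.
by rewrite /pq_wt inE; case: (splitP s).
Qed.

Lemma addpE (u w : nat * nat) : u + w = ((u.1 + w.1)%N, (u.2 + w.2)%N).
Proof. by []. Qed.

Lemma sum_pair (I : Type) (r : seq I) (P : pred I) (f : I -> nat * nat) :
  \sum_(j <- r | P j) f j =
  ((\sum_(j <- r | P j) (f j).1)%N, (\sum_(j <- r | P j) (f j).2)%N).
Proof.
rewrite [LHS]surjective_pairing.
by rewrite (big_morph fst (id1 := 0%N) (op1 := addn)) // (big_morph snd (id1 := 0%N) (op1 := addn)).
Qed.

Lemma wtsetE (T : {set 'I_N}) : wtset wt T = (#|T :&: Xs|, #|T :&: Ys|).
Proof.
rewrite /wtset sum_pair; congr (_, _).
  rewrite -sum1_card (big_setID Xs) /= [X in (_ + X)%N]big1 ?addn0.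
    by apply: eq_bigr => s; rewrite inE => /andP[_ sX]; rewrite pq_wtE sX.
  by move=> s; rewrite inE => /andP[/negPf sX _]; rewrite pq_wtE sX.
rewrite -sum1_card (big_setID Ys) /= [X in (_ + X)%N]big1 ?addn0.
  by apply: eq_bigr => s; rewrite inE => /andP[_]; rewrite -XsN pq_wtE => /negPf->.
by move=> s; rewrite inE => /andP[]; rewrite YsN pq_wtE => ->.
Qed.

Lemma pairMn (u : nat * nat) m : u *+ m = ((u.1 * m)%N, (u.2 * m)%N).
Proof.
elim: m => [|m IH]; first by rewrite mulr0n !muln0.
by rewrite mulrS IH addpE !mulnS.
Qed.

Lemma bidegE (a : 'X_{1..N}) :
  bideg wt a = ((\sum_(s in Xs) a s)%N, (\sum_(s in Ys) a s)%N).
Proof.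
rewrite /bideg sum_pair; congr (_, _); rewrite [RHS]big_mkcond.
  by apply: eq_bigr => s _; rewrite pq_wtE pairMn; case: ifP => _; rewrite /= ?mul1n.
by apply: eq_bigr => s _; rewrite pq_wtE pairMn -XsN; case: ifP => _; rewrite /= ?mul1n.
Qed.

Lemma card_setXY (T : {set 'I_N}) : #|T| = (#|T :&: Xs| + #|T :&: Ys|)%N.
Proof.
rewrite -(cardsID Xs T); congr (_ + _)%N; apply: eq_card => s.
by rewrite !inE -leqNgt andbC.
Qed.

Lemma free_of_sum L (a : 'X_{1..N}) : free_of L a = ((\sum_(s in L) a s)%N == 0%N).
Proof.
rewrite sum_nat_eq0; apply: eq_forallb => s; by [].
Qed.

Lemma free_XsE a : free_of Xs a = ((bideg wt a).1 == 0%N).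
Proof. by rewrite free_of_sum bidegE. Qed.

Lemma free_YsE a : free_of Ys a = ((bideg wt a).2 == 0%N).
Proof. by rewrite free_of_sum bidegE. Qed.

Lemma hchain_deg (v : nat * nat) i F T a : homog_chain i F -> hchain wt v F -> (F T)@_a != 0 ->
  ((bideg wt a).1 + (bideg wt a).2 + i)%N = (v.1 + v.2)%N.
Proof.
move=> Fi hF Fa; have := hF _ _ Fa; rewrite wtsetE addpE => <- /=.
have -> : i = #|T|.
  by apply/esym/eqP; apply: contraNT Fa => /Fi->; rewrite mcoeff0.
by rewrite card_setXY addnACA.
Qed.

(** The strands in which the coefficients involve the p's only, or the q's only. *)
Definition pureX F T := mrestr (free_of Ys) (F T).
Definition pureY F T := mrestr (free_of Xs) (F T).

Lemma mrestrXU L s (f : S) : 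
  mrestr (free_of L) ('X_s * f) = if s \in L then 0 else 'X_s * mrestr (free_of L) f.
Proof.
apply/mpolyP => a; case: ifP => sL; rewrite mcoeff_mrestr ?mcoeff0 !mcoeffXUM ?mcoeff_mrestr.
  by case: ifP => // /forall_inP/(_ s sL)/eqP->.
have [as0|_] := ltnP 0 (a s); last by rewrite if_same.
congr (if _ then _ else _); apply: eq_forallb_in => l lL; rewrite mnmBE mnm1E.
rewrite (_ : (s == l) = false) ?subn0 //.
by apply/eqP => e; rewrite e lL in sL.
Qed.

Lemma mrestr_kd L F T : mrestr (free_of L) (koszul_d setT F T) =
  koszul_d (~: L) (fun U => mrestr (free_of L) (F U)) T.
Proof.
rewrite raddf_sum /= [RHS]big_mkcond /= [LHS]big_mkcond; apply: eq_bigr => s _.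
by rewrite !inE mrestrXU iota_mrestr; case: (s \in L).
Qed.

Lemma setCXs : ~: Xs = Ys. Proof. by apply/setP => s; rewrite !inE -leqNgt. Qed.
Lemma setCYs : ~: Ys = Xs. Proof. by rewrite -setCXs setCK. Qed.

Lemma pureX_kd F T : pureX (koszul_d setT F) T = koszul_d Xs (pureX F) T.
Proof. by rewrite /pureX mrestr_kd setCYs. Qed.

Lemma pureY_kd F T : pureY (koszul_d setT F) T = koszul_d Ys (pureY F) T.
Proof. by rewrite /pureY mrestr_kd setCXs. Qed.

Lemma kd_split F T : koszul_d setT F T = koszul_d Xs F T + koszul_d Ys F T.
Proof.
rewrite /koszul_d (bigID (fun s => s \in Xs)) /=; congr (_ + _); apply: eq_bigl => s.
  by rewrite inE.
by rewrite XsN inE.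
Qed.

Lemma kdXX F T : koszul_d setT (koszul_d Xs F) T = koszul_d Ys (koszul_d Xs F) T.
Proof. by rewrite kd_split kd_kd add0r. Qed.

Lemma kdYY F T : koszul_d setT (koszul_d Ys F) T = - koszul_d Ys (koszul_d Xs F) T.
Proof. by rewrite kd_split kd_kd addr0 kdC. Qed.

Lemma pureX_kh F L T : pureX (koszul_h L (pureX F)) T = koszul_h L (pureX F) T.
Proof.
apply: mrestr_id => a; rewrite mcoeff_msupp mcoeff_kh.
case: lowest => [m|]; last by rewrite eqxx.
case: ifP => _; last by rewrite eqxx.
rewrite mcoeff_mrestr; case: ifP => [|_]; last by rewrite mulr0 eqxx.
move=> /forall_inP aY _; apply/forall_inP => s /aY; rewrite mnmDE addn_eq0.
by case/andP.
Qed.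

Lemma pureY_kh F L T : pureY (koszul_h L (pureY F)) T = koszul_h L (pureY F) T.
Proof.
apply: mrestr_id => a; rewrite mcoeff_msupp mcoeff_kh.
case: lowest => [m|]; last by rewrite eqxx.
case: ifP => _; last by rewrite eqxx.
rewrite mcoeff_mrestr; case: ifP => [|_]; last by rewrite mulr0 eqxx.
move=> /forall_inP aY _; apply/forall_inP => s /aY; rewrite mnmDE addn_eq0.
by case/andP.
Qed.

Lemma free_XY a : free_of Xs a -> free_of Ys a -> a = 0%MM.
Proof.
move=> /forall_inP aX /forall_inP aY; apply/mnmP => s; rewrite mnm0E; apply/eqP.
by have [/aX//|] := boolP (s \in Xs); rewrite XsN => /aY.
Qed.

(** The contraction in the p's; its defect consists of constant coefficients. *)
Lemma pureX_exact F : (forall T, (F T)@_0%MM = 0) ->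
    (forall T, koszul_d Xs (pureX F) T = 0) ->
  forall T, pureX F T = koszul_d Xs (koszul_h Xs (pureX F)) T.
Proof.
move=> F0 dF T; have := koszul_homotopy Xs (pureX F) T.
rewrite (kh_eq0 Xs dF) addr0 => ->; suff -> : koszul_p Xs (pureX F) T = 0 by rewrite subr0.
rewrite /koszul_p; case: ifP => // _; apply/mpolyP => a.
rewrite !mcoeff_mrestr mcoeff0; case: ifP => // aX; case: ifP => // aY.
by rewrite (free_XY aX aY).
Qed.

Lemma pureY_exact F : (forall T, (F T)@_0%MM = 0) ->
    (forall T, koszul_d Ys (pureY F) T = 0) ->
  forall T, pureY F T = koszul_d Ys (koszul_h Ys (pureY F)) T.
Proof.
move=> F0 dF T; have := koszul_homotopy Ys (pureY F) T.
rewrite (kh_eq0 Ys dF) addr0 => ->; suff -> : koszul_p Ys (pureY F) T = 0 by rewrite subr0.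
rewrite /koszul_p; case: ifP => // _; apply/mpolyP => a.
rewrite !mcoeff_mrestr mcoeff0; case: ifP => // aY; case: ifP => // aX.
by rewrite (free_XY aX aY).
Qed.

(** A linear form is the sum of its two pure parts, and the contractions of these
have constant coefficients. *)
Lemma linear_chain (v : nat * nat) i F : homog_chain i F -> hchain wt v F ->
    (i + 1)%N = (v.1 + v.2)%N ->
    (forall T, koszul_d Xs (pureX F) T = 0) -> (forall T, koszul_d Ys (pureY F) T = 0) ->
  exists u w : {set 'I_N} -> k,
  [/\ forall T, wtset wt T != v -> u T = 0, forall T, wtset wt T != v -> w T = 0
    & forall T, F T = koszul_d Xs (const_chain u) T + koszul_d Ys (const_chain w) T].
Proof.
move=> Fi hF le cX cY.
have F0 T : (F T)@_0%MM = 0.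
  apply/eqP; apply: contraPT le => /(hchain_deg Fi hF).
  by rewrite bideg0 /= => <-; lia.
have iX : homog_chain i (pureX F) by move=> T /Fi e; rewrite /pureX e raddf0.
have iY : homog_chain i (pureY F) by move=> T /Fi e; rewrite /pureY e raddf0.
have hX : hchain wt v (pureX F) by apply: hchain_mrestr.
have hY : hchain wt v (pureY F) by apply: hchain_mrestr.
pose u := koszul_h Xs (pureX F); pose w := koszul_h Ys (pureY F).
have iu : homog_chain i.+1 u by apply: kh_size.
have iw : homog_chain i.+1 w by apply: kh_size.
have hu : hchain wt v u by apply: hchain_kh.
have hw : hchain wt v w by apply: hchain_kh.
have cst (H : {set 'I_N} -> S) : homog_chain i.+1 H -> hchain wt v H ->
    H =1 const_chain (fun T => (H T)@_0%MM).
  move=> Hi hH T; apply/mpolyP => a; rewrite mcoeffC.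
  have [->|a0] := eqVneq a 0%MM; first by rewrite mulr1.
  rewrite mulr0; apply/eqP; apply: contraNT a0 => /(hchain_deg Hi hH) e.
  by apply/eqP/free_XY; rewrite ?free_XsE ?free_YsE; apply/eqP; lia.
have supp (H : {set 'I_N} -> S) : hchain wt v H -> forall T, wtset wt T != v -> (H T)@_0%MM = 0.
  move=> hH T; apply: contraNeq => /hH; rewrite bideg0 add0r => ->.
  by rewrite eqxx.
exists (fun T => (u T)@_0%MM), (fun T => (w T)@_0%MM).
split; [exact: supp|exact: supp|] => T.
rewrite -(eq_kd Xs (cst _ iu hu)) -(eq_kd Ys (cst _ iw hw)).
rewrite -(pureX_exact F0 cX) -(pureY_exact F0 cY).
apply/mpolyP => a; rewrite mcoeffD !mcoeff_mrestr.
have [->|Fa] := eqVneq (F T)@_a 0; first by rewrite !if_same addr0.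
have := hchain_deg Fi hF Fa; rewrite free_XsE free_YsE => e.
have {e} : (bideg wt a).1 + (bideg wt a).2 = 1%N by rewrite /GRing.add /=; lia.
case: (bideg wt a) => [[|[|x]] [|[|y]]] //= _; by rewrite ?addr0 ?add0r.
Qed.

Hypothesis char_k : 2%N \notin [pchar k].

(** Both pure parts of an element of I vanish. *)
Lemma pi_unmixed_eq0 f : pi f = 0 ->
  (forall a, f@_a != 0 -> free_of Xs a || free_of Ys a) -> f = 0.
Proof.
move=> /(in_idealP char_k)[fY fX _] fm; apply/mpolyP => a; rewrite mcoeff0.
apply/eqP; apply/negPn/negP => nz; case/orP: (fm _ nz) => [aX|aY].
  by move: nz; have := mcoeff_mrestr (free_of Xs) f a; rewrite aX fX mcoeff0 => <-; rewrite eqxx.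
by move: nz; have := mcoeff_mrestr (free_of Ys) f a; rewrite aY fY mcoeff0 => <-; rewrite eqxx.
Qed.

Definition zcycle F := forall T, pi (koszul_d setT F T) = 0.

Lemma zcycle_pure F : zcycle F ->
  (forall T, koszul_d Xs (pureX F) T = 0) /\ (forall T, koszul_d Ys (pureY F) T = 0).
Proof.
move=> cF; split=> T; have [fY fX _] := (in_idealP char_k _).1 (cF T).
  by rewrite -pureX_kd.
by rewrite -pureY_kd.
Qed.

(** Contract the two pure parts of F separately.  The corrections u and w have
coefficients of positive degree, so u contributes nothing to the part in the
q's, and w nothing to the part in the p's. *)
Lemma zcycle_mixed (v : nat * nat) i F : homog_chain i F -> hchain wt v F ->
    (i + 2 <= v.1 + v.2)%N -> zcycle F ->
  exists G, [/\ homog_chain i.+1 G, hchain wt v G,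
    forall T, pureX (fun U => F U - koszul_d setT G U) T = 0
    & forall T, pureY (fun U => F U - koszul_d setT G U) T = 0].
Proof.
move=> Fi hF le /zcycle_pure[cX cY].
have F0 T : (F T)@_0%MM = 0.
  apply/eqP; apply: contraTT le => /(hchain_deg Fi hF).
  by rewrite bideg0 /= -ltnNge => <-; lia.
have iX : homog_chain i (pureX F) by move=> T /Fi e; rewrite /pureX e raddf0.
have iY : homog_chain i (pureY F) by move=> T /Fi e; rewrite /pureY e raddf0.
have hX : hchain wt v (pureX F) by apply: hchain_mrestr.
have hY : hchain wt v (pureY F) by apply: hchain_mrestr.
pose u := koszul_h Xs (pureX F); pose w := koszul_h Ys (pureY F).
have eX := pureX_exact F0 cX; have eY := pureY_exact F0 cY.
have iu : homog_chain i.+1 u by apply: kh_size.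
have iw : homog_chain i.+1 w by apply: kh_size.
have hu : hchain wt v u by apply: hchain_kh.
have hw : hchain wt v w by apply: hchain_kh.
have nocst (H : {set 'I_N} -> S) T : homog_chain i.+1 H -> hchain wt v H -> (H T)@_0%MM = 0.
  move=> Hi hH; apply/eqP; apply: contraTT le => /(hchain_deg Hi hH).
  by rewrite bideg0 /= -ltnNge => <-; lia.
have uY T : pureY u T = 0.
  rewrite /pureY -[u T]pureX_kh; apply/mpolyP => a.
  rewrite !mcoeff_mrestr mcoeff0; case: ifP => // aX; case: ifP => // aY.
  by rewrite (free_XY aX aY) nocst.
have wX T : pureX w T = 0.
  rewrite /pureX -[w T]pureY_kh; apply/mpolyP => a.
  rewrite !mcoeff_mrestr mcoeff0; case: ifP => // aX; case: ifP => // aY.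
  by rewrite (free_XY aY aX) nocst.
exists (fun U => u U + w U); split.
- by move=> T Ti; rewrite iu // iw // addr0.
- exact: hchainD.
- move=> T; rewrite /pureX raddfB /= kdD raddfD /= -!/(pureX _ T) !pureX_kd.
  rewrite (eq_kd _ (pureX_kh _ _)) -eX (kd_eq0 _ wX) addr0.
  by rewrite subrr.
move=> T; rewrite /pureY raddfB /= kdD raddfD /= -!/(pureY _ T) !pureY_kd.
rewrite (eq_kd _ (pureY_kh _ _)) -eY (kd_eq0 _ uY) add0r.
by rewrite subrr.
Qed.

End BigradedChains.

(** * Quadrics modulo relations, and injectivity of the polarization *)

Section PolarizationMap.
Variables (k : fieldType) (n : nat).
Local Notation N := ((n + n) + (n + n))%N.
Local Notation S := {mpoly k[N]}.
Local Notation wt := (@pq_wt n).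
Local Notation Xs := (Xs n).
Local Notation Ys := (Ys n).

(** Index set for coordinates on (V (x) W)/R: one for each equation of [rel_coef],
where the symmetry equations are indexed by pairs i < j. *)
Definition relI : finType :=
  (('I_n * 'I_n) + {p : 'I_n * 'I_n | (p.1 < p.2)%N} * bool)%type.

Lemma card_relI : #|{: relI}| = (n * (2 * n - 1))%N.
Proof.
rewrite card_sum !card_prod card_bool !card_ord card_sig.
have -> : #|[pred p : 'I_n * 'I_n | (p.1 < p.2)%N]| = 'C(n, 2).
  rewrite -sum1_card (eq_bigl (fun p : 'I_n * 'I_n => (p.1 < p.2)%N)) // -bin2_sum.
  rewrite -(pair_big_dep xpredT (fun i j : 'I_n => (i < j)%N) (fun _ _ => 1%N)) /=.
  rewrite (exchange_big_dep xpredT) //= big_mkord; apply: eq_bigr => j _.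
  rewrite sum1_card -[RHS]card_ord.
  have lt := ltnW (ltn_ord j).
  rewrite -[RHS](card_image (f := widen_ord lt)); last first.
    by move=> x y /(congr1 val) /= e; apply: val_inj.
  apply: eq_card => i; apply/idP/imageP => [ij|[x _ ->]].
    by exists (Ordinal ij) => //; apply: val_inj.
  exact: (ltn_ord x).
have := bin2_sum n; rewrite bin2 => _; have := odd_double_half (n * n.-1).
by case: n => [|m] //=; rewrite oddM /= andNb /=; lia.
Qed.

Definition rel_map (g : 'I_N -> 'I_N -> k) (j : relI) : k :=
  match j with
  | inl p => g (va p.1) (vc p.2) + g (vb p.1) (vd p.2)
  | inr (p, true) => g (va (val p).1) (vd (val p).2) - g (va (val p).2) (vd (val p).1)
  | inr (p, false) => g (vb (val p).1) (vc (val p).2) - g (vb (val p).2) (vc (val p).1)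
  end.

Lemma rel_mapP g : (forall j, rel_map g j = 0) <-> rel_coef g.
Proof.
split=> [g0|[r1 r2 r3] [p|[p []]] /=]; last 3 first.
- by rewrite r1 addNr.
- by rewrite r2 subrr.
- by rewrite r3 subrr.
have sym (f : 'I_n -> 'I_n -> k) :
    (forall i j : 'I_n, (i < j)%N -> f i j = f j i) -> forall i j, f i j = f j i.
  move=> H i j; have [/H//|/H//|/val_inj->//] := ltngtP i j.
split=> [i j||].
- by apply/eqP; rewrite -addr_eq0; apply/eqP/(g0 (inl (i, j))).
- apply: (sym (fun i j => g (va i) (vd j))) => i j ij; apply/eqP; rewrite -subr_eq0.
  by apply/eqP/(g0 (inr (exist _ (i, j) ij, true))).
apply: (sym (fun i j => g (vb i) (vc j))) => i j ij; apply/eqP; rewrite -subr_eq0.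
by apply/eqP/(g0 (inr (exist _ (i, j) ij, false))).
Qed.

Definition relx (j : relI) : 'I_N :=
  match j with
  | inl p => va p.1 | inr (p, true) => va (val p).1 | inr (p, false) => vb (val p).1
  end.
Definition rely (j : relI) : 'I_N :=
  match j with
  | inl p => vc p.2 | inr (p, true) => vd (val p).2 | inr (p, false) => vc (val p).2
  end.

Lemma relx_Xs j : relx j \in Xs.
Proof. by case: j => [p|[p []]]; [apply: va_Xs|apply: va_Xs|apply: vb_Xs]. Qed.
Lemma rely_Ys j : rely j \in Ys.
Proof. by case: j => [p|[p []]]; [apply: vc_Ys|apply: vd_Ys|apply: vc_Ys]. Qed.

(** The products of [relx j] and [rely j] form a basis of a complement of R, dual
to the coordinates. *)
Lemma rel_map_basis (g : 'I_N -> 'I_N -> k) j :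
    (forall s t, s \in Xs -> t \in Ys -> g s t = ((s == relx j) && (t == rely j))%:R) ->
  forall j', rel_map g j' = (j == j')%:R.
Proof.
move=> gE.
have gac i l : g (va i) (vc l) = ((va i == relx j) && (vc l == rely j))%:R.
  by rewrite gE ?va_Xs ?vc_Ys.
have gad i l : g (va i) (vd l) = ((va i == relx j) && (vd l == rely j))%:R.
  by rewrite gE ?va_Xs ?vd_Ys.
have gbc i l : g (vb i) (vc l) = ((vb i == relx j) && (vc l == rely j))%:R.
  by rewrite gE ?vb_Xs ?vc_Ys.
have gbd i l : g (vb i) (vd l) = ((vb i == relx j) && (vd l == rely j))%:R.
  by rewrite gE ?vb_Xs ?vd_Ys.
have inlE (T1 T2 : eqType) (x y : T1) : ((inl x : (T1 + T2)%type) == inl y) = (x == y).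
  by [].
have inrE (T1 T2 : eqType) (x y : T2) : ((inr x : (T1 + T2)%type) == inr y) = (x == y).
  by [].
have swap (p1 p2 q1 q2 : 'I_n) : (p1 < p2)%N -> (q1 < q2)%N ->
    ((p2 == q1) && (p1 == q2)) = false.
  by move=> lt lt'; apply/negP => /andP[/eqP e /eqP e']; move: lt'; rewrite -e -e'; lia.
case=> [[p1' p2']|[[[p1' p2'] lt'] []]];
  rewrite /rel_map ?gac ?gad ?gbc ?gbd {gac gad gbc gbd gE};
  case: j => [[p1 p2]|[[[p1 p2] lt] []]];
  rewrite /relx /rely !var_eqE ?andbF ?addr0 ?subr0 //=
    ?inlE ?inrE xpair_eqE ?andbT ?andbF ?sub0r ?oppr0 -?val_eqE /= ?xpair_eqE //;
  rewrite ?(swap p1' p2') ?subr0 //; congr (nat_of_bool _)%:R;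
  rewrite -?val_eqE /= -?val_eqE /=; lia.
Qed.

Hypothesis char_k : 2%N \notin [pchar k].

Lemma k_opp_eq0 (x : k) : x = - x -> x = 0.
Proof.
move/eqP; rewrite -addr_eq0 -mulr2n -mulr_natl mulf_eq0 (negPf (two_neq0 char_k)).
by move/eqP.
Qed.

(** No nonzero element of Lambda^2 V (x) W has all its contractions along V in R.
The proof is dual to that of [zX_xxy]: each block of U is symmetric in one pair of
indices and antisymmetric in an overlapping one. *)
Lemma rel_alternating_X (U : 'I_N -> 'I_N -> 'I_N -> k) :
    (forall x', rel_coef (fun x y => U x x' y)) ->
    (forall x x' y, U x x' y = - U x' x y) ->
  forall x x' y, x \in Xs -> x' \in Xs -> y \in Ys -> U x x' y = 0.
Proof.
move=> rel alt.
have r1 x' i j : U (va i) x' (vc j) = - U (vb i) x' (vd j) by case: (rel x').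
have r2 x' i j : U (va i) x' (vd j) = U (va j) x' (vd i) by case: (rel x').
have r3 x' i j : U (vb i) x' (vc j) = U (vb j) x' (vc i) by case: (rel x').
have aad i j l : U (va i) (va j) (vd l) = 0.
  exact: (antisym_sym_eq0 (U := fun p q r => U (va q) (va r) (vd p)) k_opp_eq0
    (fun p q r => r2 _ _ _) (fun p q r => alt _ _ _) l i j).
have bbc i j l : U (vb i) (vb j) (vc l) = 0.
  exact: (antisym_sym_eq0 (U := fun p q r => U (vb q) (vb r) (vc p)) k_opp_eq0
    (fun p q r => r3 _ _ _) (fun p q r => alt _ _ _) l i j).
have aacE i j l : U (va i) (va j) (vc l) = - U (vb i) (va j) (vd l) by exact: r1.
have bbdE i j l : U (vb i) (vb j) (vd l) = - U (va i) (vb j) (vc l).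
  by rewrite r1 opprK.
have bad i j l : U (vb i) (va j) (vd l) = 0.
  apply: (antisym_sym_eq0 (U := fun p q r => U (vb r) (va q) (vd p)) k_opp_eq0
    _ _ l j i) => p q r; first by rewrite alt r2 -alt.
  by rewrite -[LHS]opprK -aacE alt aacE opprK.
have abc i j l : U (va i) (vb j) (vc l) = 0.
  apply: (antisym_sym_eq0 (U := fun p q r => U (va r) (vb q) (vc p)) k_opp_eq0
    _ _ l j i) => p q r; first by rewrite alt r3 -alt.
  by rewrite -[LHS]opprK -bbdE alt bbdE opprK.
move=> x x' y /XsP[] [i ->] /XsP[] [j ->] /YsP[] [l ->].
- by rewrite aacE bad oppr0.
- exact: aad.
- exact: abc.
- by rewrite alt bad oppr0.
- by rewrite alt abc oppr0.
- exact: bad.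
- exact: bbc.
- by rewrite bbdE abc oppr0.
Qed.

(** The analogue for V (x) Lambda^2 W. *)
Lemma rel_alternating_Y (U : 'I_N -> 'I_N -> 'I_N -> k) :
    (forall y', rel_coef (fun x y => U x y y')) ->
    (forall x y y', U x y y' = - U x y' y) ->
  forall x y y', x \in Xs -> y \in Ys -> y' \in Ys -> U x y y' = 0.
Proof.
move=> rel alt.
have r1 y' i j : U (va i) (vc j) y' = - U (vb i) (vd j) y' by case: (rel y').
have r2 y' i j : U (va i) (vd j) y' = U (va j) (vd i) y' by case: (rel y').
have r3 y' i j : U (vb i) (vc j) y' = U (vb j) (vc i) y' by case: (rel y').
have add i j l : U (va i) (vd j) (vd l) = 0.
  exact: (antisym_sym_eq0 (U := fun p q r => U (va p) (vd q) (vd r)) k_opp_eq0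
    (fun p q r => r2 _ _ _) (fun p q r => alt _ _ _) i j l).
have bcc i j l : U (vb i) (vc j) (vc l) = 0.
  exact: (antisym_sym_eq0 (U := fun p q r => U (vb p) (vc q) (vc r)) k_opp_eq0
    (fun p q r => r3 _ _ _) (fun p q r => alt _ _ _) i j l).
have accE i j l : U (va i) (vc j) (vc l) = - U (vb i) (vd j) (vc l) by exact: r1.
have bddE i j l : U (vb i) (vd j) (vd l) = - U (va i) (vc j) (vd l).
  by rewrite r1 opprK.
have bdc i j l : U (vb i) (vd j) (vc l) = 0.
  apply: (antisym_sym_eq0 (U := fun p q r => U (vb p) (vd r) (vc q)) k_opp_eq0
    _ _ i l j) => p q r; first by rewrite alt r3 -alt.
  by rewrite -[LHS]opprK -accE alt accE opprK.
have acd i j l : U (va i) (vc j) (vd l) = 0.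
  apply: (antisym_sym_eq0 (U := fun p q r => U (va p) (vc r) (vd q)) k_opp_eq0
    _ _ i l j) => p q r; first by rewrite alt r2 -alt.
  by rewrite -[LHS]opprK -bddE alt bddE opprK.
move=> x y y' /XsP[] [i ->] /YsP[] [j ->] /YsP[] [l ->].
- by rewrite accE bdc oppr0.
- exact: acd.
- by rewrite alt acd oppr0.
- exact: add.
- exact: bcc.
- by rewrite alt bdc oppr0.
- exact: bdc.
- by rewrite bddE acd oppr0.
Qed.

Lemma rel_iota (g : 'I_N -> 'I_N -> {set 'I_N} -> k) s T :
    (forall U, rel_coef (fun x y => g x y U)) ->
  rel_coef (fun x y => iota_ s (g x y) T).
Proof.
move=> rel; rewrite /iota_; case: (s \in T); first by split=> *; rewrite ?oppr0.
have [r1 r2 r3] := rel (s |: T); split=> i j /=.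
- by rewrite -mulrN; congr (_ * _); apply: r1.
- by congr (_ * _); apply: r2.
by congr (_ * _); apply: r3.
Qed.

(** To see that w vanishes on T, contract w with all elements of T but three, two
of which lie on the same side.  What remains is an element of
Lambda^2 V (x) W or V (x) Lambda^2 W to which the previous lemmas apply. *)
Lemma polar_inj (v : nat * nat) (w : {set 'I_N} -> k) :
    (0 < v.1)%N -> (0 < v.2)%N -> (2 < v.1 + v.2)%N ->
    (forall T, wtset wt T != v -> w T = 0) ->
    (forall T, rel_coef (fun s t => iota_ t (iota_ s w) T)) ->
  forall T, w T = 0.
Proof.
move=> v1 v2 v12 wv rel T; have [/eqP|/wv//] := boolP (wtset wt T == v).
rewrite wtsetE => vT.
have cX : #|T :&: Xs| = v.1 by rewrite -vT.
have cY : #|T :&: Ys| = v.2 by rewrite -vT.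
have nz3 r s t : r \in T -> s \in T -> t \in T -> s != t -> s != r -> t != r ->
    iota_ r (iota_ t (iota_ s w)) (T :\ s :\ t :\ r) = 0 -> w T = 0.
  move=> rT sT tT st sr tr e; apply: (iota_inj sT); apply: (@iota_inj _ _ t).
    by rewrite !inE eq_sym st.
  by apply: iota_inj e; rewrite !inE ![r == _]eq_sym sr tr.
have [t tTY] : exists t, t \in T :&: Ys by apply/card_gt0P; rewrite cY.
have [s sTX] : exists s, s \in T :&: Xs by apply/card_gt0P; rewrite cX.
move: (tTY) (sTX); rewrite !in_setI => /andP[tT tY] /andP[sT sX].
have st : s != t by rewrite (XY_neq sX tY).
(* v_1 + v_2 > 2, so T has two p's or two q's *)
have [le|gt] := leqP 2 v.1.
  have [r] : exists r, r \in (T :&: Xs) :\ s.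
    by apply/card_gt0P; have := cardsD1 s (T :&: Xs); rewrite cX sTX /=; lia.
  rewrite in_setD1 in_setI => /and3P[rs rT rX].
  apply: (nz3 r s t) => //; rewrite 1?eq_sym ?(XY_neq rX tY) //.
  set T0 := (X in iota_ r _ X).
  pose U x x' y := iota_ x' (iota_ y (iota_ x w)) T0.
  apply: (rel_alternating_X (U := U)) => // [x'|x x' y].
    exact: (@rel_iota (fun x y => iota_ y (iota_ x w))).
  rewrite /U iotaC (eq_iota _ (fun V => iotaC _ _ _ V)) iotaN opprK.
  by rewrite iotaC.
have gt2 : (2 <= v.2)%N by lia.
have [r] : exists r, r \in (T :&: Ys) :\ t.
  by apply/card_gt0P; have := cardsD1 t (T :&: Ys); rewrite cY tTY /=; lia.
rewrite in_setD1 in_setI => /and3P[rt rT rY].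
apply: (nz3 r s t) => //; rewrite 1?[t == r]eq_sym ?(XY_neq sX rY) //.
set T0 := (X in iota_ r _ X).
pose U x y y' := iota_ y' (iota_ y (iota_ x w)) T0.
apply: (rel_alternating_Y (U := U)) => // [y'|x y y'].
  exact: (@rel_iota (fun x y => iota_ y (iota_ x w))).
exact: iotaC.
Qed.

End PolarizationMap.

(** * Tor through polynomial representatives of Koszul chains *)

Section KoszulTor.
Variables (k : fieldType) (n : nat).
Local Notation N := ((n + n) + (n + n))%N.
Local Notation S := {mpoly k[N]}.
Local Notation pi := (@Zproj k n).
Local Notation wt := (@pq_wt n).
Local Notation K := (koszul_res k wt).

Lemma scaleZ (f : S) (z : Zring k n) : f *: z = pi f * z.
Proof. by []. Qed.

Lemma kmx_scale i (F : {set 'I_N} -> S) (b : 'I_(krk N i)) : homog_chain i.+1 F ->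
  \sum_a kmx k N i a b *: pi (F (kset a)) = pi (koszul_d setT F (kset b)).
Proof.
move=> Fi; rewrite -(eq_kd setT (unpackK Fi)) -kentry_sum ?card_kset //.
rewrite raddf_sum; apply: eq_bigr => a _.
by rewrite scaleZ mxE /= rmorphM.
Qed.

Lemma df_scale i (F : {set 'I_N} -> S) (b : 'I_(krk N i)) : homog_chain i.+1 F ->
  \sum_a df K i a b *: [ffun a : 'I_(krk N i.+1) => pi (F (kset a))] a =
  pi (koszul_d setT F (kset b)).
Proof. by move=> Fi; under eq_bigr do rewrite ffunE; apply: kmx_scale. Qed.

Lemma tens_cycle_zcycle i (F : {set 'I_N} -> S) : homog_chain i F ->
  tens_cycle (P := K) [ffun a : 'I_(krk N i) => pi (F (kset a))] <-> zcycle F.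
Proof.
case: i => [|i] Fi; first by split=> // _ T; rewrite kd_size0 ?raddf0.
split=> [c T|c b]; last by rewrite df_scale.
have [/eqP/ksetP[a <-]|Ti] := boolP (#|T| == i); first by rewrite -df_scale.
by rewrite (kd_size _ Fi Ti) raddf0.
Qed.

(** A Koszul chain over Z is the class of a chain over S, unique up to I.  The
degree of the boundary G is left free in the last hypothesis, as it is in the
definition of Tor. *)
Lemma tor_rank_koszul i v r (b : 'I_r -> {set 'I_N} -> S) :
    (forall j, [/\ homog_chain i (b j), hchain wt v (b j) & zcycle (b j)]) ->
    (forall F, homog_chain i F -> hchain wt v F -> zcycle F ->
      exists (c : 'I_r -> k) (G : {set 'I_N} -> S), homog_chain i.+1 G /\
        forall T, pi (F T - \sum_j (c j)%:MP * b j T - koszul_d setT G T) = 0) ->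
    (forall (c : 'I_r -> k) G, homog_chain i.+1 G ->
      (forall T, pi (\sum_j (c j)%:MP * b j T - koszul_d setT G T) = 0) ->
      forall j, c j = 0) ->
  tor_rank (@Zgr k n) K i v r.
Proof.
move=> bP bspan bfree.
exists (fun j => [ffun a : 'I_(krk N i) => pi (b j (kset a))]).
have sumE (c : 'I_r -> k) a :
    (\sum_j (c j)%:MP *: [ffun a0 : 'I_(krk N i) => pi (b j (kset a0))]
      : {ffun 'I_(krk N i) -> Zring k n}) a =
    pi (\sum_j (c j)%:MP * b j (kset a)).
  rewrite sum_ffunE raddf_sum; apply: eq_bigr => j _.
  by rewrite !ffunE scaleZ /= rmorphM.
split=> [j|x [hx cx]|c [y yE]].
- have [bi bh bc] := bP j; split.
    move=> a; rewrite ffunE.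
    case E : (msupp (b j (kset a))) => [|m s].
      by left; rewrite (msuppnil0 E) raddf0.
    have mb : m \in msupp (b j (kset a)) by rewrite E mem_head.
    right; exists (bideg wt m); first by apply: bh; rewrite -mcoeff_msupp.
    exists (b j (kset a)) => // m' m'b; apply/eqP; rewrite -(addpI (wtset wt (kset a))).
    by rewrite ![wtset _ _ + _]addrC !bh -?mcoeff_msupp.
  exact/tens_cycle_zcycle.
- have lift a : exists f : S, pi f = x a /\
      forall m, f@_m != 0 -> bideg wt m + wtset wt (kset a) = v.
    have [->|[u uv [f hf ->]]] := hx a.
      by exists 0; rewrite raddf0; split=> // m; rewrite mcoeff0 eqxx.
    by exists f; split=> // m; rewrite -mcoeff_msupp => /hf ->.
  have [f fP] := fin_all_exists lift.
  pose F := unpack f.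
  have iF : homog_chain i F by exact: unpack_size.
  have hF : hchain wt v F.
    move=> T m; have [/eqP/ksetP[a <-]|Ti] := boolP (#|T| == i).
      by rewrite /F unpackE; case: (fP a) => _; apply.
    by rewrite iF // mcoeff0 eqxx.
  have cF : zcycle F.
    apply/(tens_cycle_zcycle iF); suff -> : [ffun a => pi (F (kset a))] = x by [].
    by apply/ffunP => a; rewrite ffunE /F unpackE; case: (fP a).
  have [c [G [iG GE]]] := bspan F iF hF cF.
  exists c, [ffun a => pi (G (kset a))] => a.
  rewrite [RHS](df_scale _ iG); apply/eqP; rewrite -subr_eq0.
  have [fa _] := fP a; have := GE (kset a); rewrite /F unpackE.
  move=> e; apply/eqP; rewrite -[RHS]e !ffunE sumE.
  by rewrite !rmorphB /= fa.
have lift a : exists f : S, y a = pi f by apply: pi_surj.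
have [f fP] := fin_all_exists lift.
have iG : homog_chain i.+1 (unpack f) by exact: unpack_size.
apply: (bfree c (unpack f)) => // T.
have [/eqP/ksetP[a <-]|Ti] := boolP (#|T| == i).
  rewrite rmorphB /= -sumE yE -kmx_scale //; apply/eqP; rewrite subr_eq0; apply/eqP.
  by apply: eq_bigr => a' _; rewrite unpackE fP.
rewrite (kd_size _ iG Ti) subr0 big1 ?raddf0 // => j _.
by have [bi _ _] := bP j; rewrite bi ?mulr0.
Qed.

End KoszulTor.

(** * The polarization as a linear map *)

Section PolarLinear.
Variables (k : fieldType) (n : nat).
Local Notation N := ((n + n) + (n + n))%N.
Local Notation wt := (@pq_wt n).
Local Notation Xs := (Xs n).
Local Notation Ys := (Ys n).

(** A basis of Lambda^(v_1) V (x) Lambda^(v_2) W. *)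
Definition wsets v : finType := {T : {set 'I_N} | wtset wt T == v}.

Lemma card_Xs : #|Xs| = (2 * n)%N.
Proof.
by rewrite -sum1_card sum_Xs !sum1_card !card_ord mul2n -addnn.
Qed.

Lemma card_Ys : #|Ys| = (2 * n)%N.
Proof.
by rewrite -sum1_card sum_Ys !sum1_card !card_ord mul2n -addnn.
Qed.

(** A set of indeterminates is a set of p's together with a set of q's. *)
Lemma card_wsets v : #|{: wsets v}| = ('C(2 * n, v.1) * 'C(2 * n, v.2))%N.
Proof.
rewrite card_sig -[X in 'C(X, v.1)]card_Xs -[X in 'C(X, v.2)]card_Ys.
rewrite -!cards_draws -cardsX.
pose f (T : {set 'I_N}) := (T :&: Xs, T :&: Ys).
have finj : injective f.
  move=> T T' [eX eY]; apply/setP => s.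
  have := congr1 (fun A : {set 'I_N} => s \in A) eX; rewrite /= !in_setI.
  have := congr1 (fun A : {set 'I_N} => s \in A) eY; rewrite /= !in_setI.
  by rewrite -XsN; case: (s \in Xs); rewrite /= ?andbT.
rewrite -(card_imset _ finj); apply: eq_card => -[A B].
apply/imsetP/idP => [[T]|].
  by rewrite inE wtsetE => /eqP<- [-> ->]; rewrite inE /= !inE !subsetIr !eqxx.
rewrite !inE /= => /andP[/andP[AX /eqP cA] /andP[BY /eqP cB]].
have fAB : f (A :|: B) = (A, B).
  congr (_, _); apply/setP => s; rewrite !in_setI in_setU.
    have [sA|sA] := boolP (s \in A); first by rewrite (subsetP AX).
    have [/(subsetP BY)|//] := boolP (s \in B); by rewrite -XsN => /negPf->.
  have [sB|sB] := boolP (s \in B); first by rewrite (subsetP BY) // orbT.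
  have [/(subsetP AX)|//] := boolP (s \in A); by rewrite -YsN => /negPf->.
exists (A :|: B); last by [].
rewrite inE wtsetE; case: fAB => -> ->; rewrite cA cB.
by case: v {cA cB}.
Qed.

Definition ext v (w : {ffun wsets v -> k^o}) (T : {set 'I_N}) : k :=
  if insub T is Some x then w x else 0.

Lemma ext_val v w (x : wsets v) : ext w (val x) = w x.
Proof. by rewrite /ext valK. Qed.

Lemma ext_out v (w : {ffun wsets v -> k^o}) T : wtset wt T != v -> ext w T = 0.
Proof. by move=> Tv; rewrite /ext insubN. Qed.

Lemma ext_linear v a (w w' : {ffun wsets v -> k^o}) T :
  ext (a *: w + w') T = a * ext w T + ext w' T.
Proof. by rewrite /ext; case: insub => [x|]; rewrite ?ffunE ?mulr0 ?addr0. Qed.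

Variable v : nat * nat.
Definition shift11 : nat * nat := (v.1.+1, v.2.+1).
Local Notation U := {ffun wsets shift11 -> k^o}.
Local Notation W := {ffun wsets v * relI n -> k^o}.

(** The coefficient of x_s y_t e_T in d_Y d_X w. *)
Definition contract2 (w : {set 'I_N} -> k) T s t := iota_ t (iota_ s w) T.

Definition polar_fun (w : U) : W :=
  [ffun p => rel_map (contract2 (ext w) (val p.1)) p.2].

Lemma contract2_linear a (w w' : U) T s t :
  contract2 (ext (a *: w + w')) T s t =
  a * contract2 (ext w) T s t + contract2 (ext w') T s t.
Proof.
rewrite /contract2 -iotaMl -iotaD; apply: eq_iota => T'.
by rewrite -iotaMl -iotaD; apply: eq_iota => T''; apply: ext_linear.
Qed.

Lemma rel_map_linear a (g g' g'' : 'I_N -> 'I_N -> k) j :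
    (forall s t, g'' s t = a * g s t + g' s t) ->
  rel_map g'' j = a * rel_map g j + rel_map g' j.
Proof. by move=> gE; case: j => [p|[p []]] /=; rewrite !gE; ring. Qed.

Lemma polar_fun_linear : linear polar_fun.
Proof.
move=> a w w'; apply/ffunP => p; rewrite !ffunE.
by apply: rel_map_linear => s t; apply: contract2_linear.
Qed.

HB.instance Definition _ := GRing.isLinear.Build k U W *:%R polar_fun polar_fun_linear.

Definition polar : 'Hom(U, W) := linfun polar_fun.

Lemma contract2_out w T s t : (forall T', wtset wt T' != shift11 -> w T' = 0) ->
  s \in Xs -> t \in Ys -> wtset wt T != v -> contract2 w T s t = 0.
Proof.
move=> w0 sX tY Tv; rewrite /contract2 /iota_; case: ifP => // tT.
case: ifP => sT; first by rewrite mulr0.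
rewrite w0 ?mulr0 //; apply: contraNneq Tv.
have tX : (t \in Xs) = false by apply/negbTE; rewrite XsN.
rewrite wtsetU1 ?sT // wtsetU1 ?tT // (pq_wtE s) (pq_wtE t) sX tX.
rewrite /shift11; case: (wtset wt T) => x y; rewrite !addpE /= => -[].
by case: v => x' y' /= e1 e2; apply/eqP; congr (_, _); lia.
Qed.

Lemma rel_coef0 (g : 'I_N -> 'I_N -> k) :
  (forall s t, s \in Xs -> t \in Ys -> g s t = 0) -> rel_coef g.
Proof.
by move=> g0; split=> i j; rewrite !g0 ?oppr0 ?va_Xs ?vb_Xs ?vc_Ys ?vd_Ys.
Qed.

(** Outside the weight v the contractions vanish, so the condition extends to all
sets T. *)
Lemma polar_eq0 w : polar w = 0 <-> forall T, rel_coef (contract2 (ext w) T).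
Proof.
rewrite lfunE /=; split=> [w0 T|rel]; last first.
  by apply/ffunP => p; rewrite !ffunE; have /rel_mapP/(_ p.2) := rel (val p.1).
have [Tv|Tv] := boolP (wtset wt T == v); last first.
  by apply: rel_coef0 => s t sX tY; apply: contract2_out => // T'; apply: ext_out.
apply/rel_mapP => j; move/ffunP/(_ (exist _ T Tv, j)): w0.
by rewrite !ffunE.
Qed.

End PolarLinear.

(** * Rank of the polarization *)

Section QuadraticForms.
Variables (k : fieldType) (n : nat).
Local Notation N := ((n + n) + (n + n))%N.
Local Notation S := {mpoly k[N]}.
Local Notation wt := (@pq_wt n).
Local Notation pi := (@Zproj k n).
Local Notation Xs := (Xs n).
Local Notation Ys := (Ys n).

Definition quad (g : 'I_N -> 'I_N -> k) : S :=
  \sum_(s in Xs) \sum_(t in Ys) (g s t)%:MP * ('X_s * 'X_t).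

Lemma quad_pureX g : mrestr (free_of Ys) (quad g) = 0.
Proof.
rewrite raddf_sum big1 // => s sX; rewrite raddf_sum big1 // => t tY.
exact: mrestr_Ys_XX.
Qed.

Lemma quad_pureY g : mrestr (free_of Xs) (quad g) = 0.
Proof.
rewrite raddf_sum big1 // => s sX; rewrite raddf_sum big1 // => t tY.
exact: mrestr_Xs_XX.
Qed.

Lemma mixed_coef_quad g s t : s \in Xs -> t \in Ys -> mixed_coef (quad g) s t = g s t.
Proof.
move=> sX tY; rewrite /mixed_coef raddf_sum (bigD1 s) //= raddf_sum (bigD1 t) //=.
have E s' t' : s' \in Xs -> t' \in Ys ->
    ((g s' t')%:MP * ('X_s' * 'X_t') : S)@_(U_(s) + U_(t))%MM =
    g s' t' * ((s' == s) && (t' == t))%:R.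
  by move=> s'X t'Y; rewrite -/(mixed_coef _ s t) mixed_coef_mulXX // mcoeffC eqxx mulr1.
rewrite E // !eqxx mulr1 big1 ?addr0 => [|t' /andP[t'Y /negPf nt]]; last first.
  by rewrite E // nt andbF mulr0.
rewrite big1 ?addr0 // => s' /andP[s'X /negPf ns].
by rewrite raddf_sum big1 //= => t' t'Y; rewrite E // ns mulr0.
Qed.

Lemma msupp_quad g a : (quad g)@_a != 0 ->
  exists s t, [/\ s \in Xs, t \in Ys, a = (U_(s) + U_(t))%MM & g s t != 0].
Proof.
move=> nz; have /existsP[s /existsP[t /and4P[sX tY /eqP e gn]]] : [exists s, exists t,
    [&& s \in Xs, t \in Ys, a == (U_(s) + U_(t))%MM & g s t != 0]].
  apply: contraNT nz => /existsPn no; rewrite raddf_sum big1 // => s sX.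
  rewrite raddf_sum big1 //= => t tY; rewrite mcoeffCM -mpolyXD mcoeffX eq_sym.
  have /existsPn/(_ t) := no s; rewrite sX tY /= negb_and negbK.
  by case/orP => [/negPf->|/eqP->]; rewrite ?mulr0 ?mul0r.
by exists s, t.
Qed.

Lemma rel_map_ext (g g' : 'I_N -> 'I_N -> k) j :
  (forall s t, s \in Xs -> t \in Ys -> g s t = g' s t) -> rel_map g j = rel_map g' j.
Proof.
by move=> E; case: j => [p|[p []]] /=; rewrite !E ?va_Xs ?vb_Xs ?vc_Ys ?vd_Ys.
Qed.

Lemma rel_coef_ext (g g' : 'I_N -> 'I_N -> k) :
  (forall s t, s \in Xs -> t \in Ys -> g s t = g' s t) -> rel_coef g -> rel_coef g'.
Proof.
by move=> E /rel_mapP g0; apply/rel_mapP => j; rewrite -(rel_map_ext j E).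
Qed.

Lemma rel_mapB (g g' : 'I_N -> 'I_N -> k) j :
  rel_map (fun s t => g s t - g' s t) j = rel_map g j - rel_map g' j.
Proof. by case: j => [p|[p []]] /=; ring. Qed.

Lemma rel_map_sum (I : finType) (c : I -> k) (g : I -> 'I_N -> 'I_N -> k) j :
  rel_map (fun s t => \sum_l c l * g l s t) j = \sum_l c l * rel_map (g l) j.
Proof.
case: j => [p|[p []]] /=; rewrite -?big_split -?sumrB; apply: eq_bigr => l _ /=; ring.
Qed.

Lemma quad_sum r (c : 'I_r -> k) (g : 'I_r -> 'I_N -> 'I_N -> k) :
  \sum_j (c j)%:MP * quad (g j) = quad (fun s t => \sum_j c j * g j s t).
Proof.
under eq_bigr do rewrite mulr_sumr.
rewrite exchange_big; apply: eq_bigr => s _.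
under eq_bigr do rewrite mulr_sumr.
rewrite exchange_big; apply: eq_bigr => t _.
by rewrite raddf_sum mulr_suml; apply: eq_bigr => j _; rewrite mulrA -rmorphM.
Qed.

(** The element of the span of the products [relx j] [rely j] with given
coordinates modulo R. *)
Definition rel_section (y : relI n -> k) s t : k :=
  \sum_l y l * ((s == relx l) && (t == rely l))%:R.

Lemma rel_sectionK y j : rel_map (rel_section y) j = y j.
Proof.
rewrite rel_map_sum (bigD1 j) //= big1 ?addr0 => [|l lj].
  by rewrite (rel_map_basis (j := j)) // eqxx mulr1.
by rewrite (rel_map_basis (j := l)) // (negPf lj) mulr0.
Qed.

Lemma bideg_XY s t : s \in Xs -> t \in Ys -> bideg wt (U_(s) + U_(t))%MM = (1%N, 1%N).
Proof.
move=> sX tY; have tX : (t \in Xs) = false by apply/negbTE; rewrite XsN.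
by rewrite bidegD !bidegU !pq_wtE sX tX.
Qed.

Lemma add11 v : (1%N, 1%N) + v = shift11 v. Proof. by []. Qed.

Lemma hchain_quad v (g : {set 'I_N} -> 'I_N -> 'I_N -> k) :
    (forall T s t, s \in Xs -> t \in Ys -> wtset wt T != v -> g T s t = 0) ->
  hchain wt (shift11 v) (fun T => quad (g T)).
Proof.
move=> g0 T a /msupp_quad[s [t [sX tY -> nz]]]; rewrite bideg_XY //.
have [/eqP->|Tv] := boolP (wtset wt T == v); first exact: add11.
by rewrite g0 ?eqxx in nz.
Qed.

Lemma kdYX (w : {set 'I_N} -> k) T :
  koszul_d Ys (koszul_d Xs (const_chain w)) T = quad (contract2 w T).
Proof.
rewrite /quad exchange_big; apply: eq_bigr => t _.
rewrite iota_kd mulr_sumr; apply: eq_bigr => s _.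
rewrite (eq_iota t (iota_const s w)) [X in 'X_s * X](iota_const t (iota_ s w)).
by rewrite -/(contract2 w T s t); ring.
Qed.

End QuadraticForms.

Section PolarRank.
Variables (k : fieldType) (n : nat).
Local Notation N := ((n + n) + (n + n))%N.
Local Notation wt := (@pq_wt n).
Local Notation Xs := (Xs n).
Local Notation Ys := (Ys n).
Local Notation polar := (@polar k n).

Lemma dim_kffun (I : finType) : \dim {: {ffun I -> k^o}} = #|I|.
Proof. by rewrite dimvf /dim /= muln1. Qed.

Lemma polar_rank_nullity v :
  (\dim (lker (polar v)) + \dim (limg (polar v)))%N = #|{: wsets n (shift11 v)}|.
Proof. by rewrite -dim_kffun -(limg_ker_dim (polar v) fullv) capfv. Qed.

Lemma wtset_pair s t : s \in Xs -> t \in Ys -> wtset wt [set s; t] = (1%N, 1%N).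
Proof.
move=> sX tY; rewrite wtsetU1 ?inE ?(XY_neq sX tY) // /wtset big_set1.
have tX : (t \in Xs) = false by apply/negbTE; rewrite XsN.
by rewrite !pq_wtE sX tX.
Qed.

Lemma contract2_set0 (w : {set 'I_N} -> k) s t : s \in Xs -> t \in Ys ->
  contract2 w set0 s t = w [set s; t].
Proof.
move=> sX tY; rewrite /contract2 /iota_ !inE (XY_neq sX tY) /=.
have below (x : 'I_N) (T : {set 'I_N}) : {in T, forall y : 'I_N, (x <= y)%N} -> nbelow x T = 0%N.
  move=> le; apply/eqP; rewrite cards_eq0; apply/eqP/setP => y; rewrite !inE.
  by apply/negP => /andP[/le]; rewrite leqNgt => /negbTE->.
rewrite !below ?expr0 ?mul1r ?setU0 // => y; rewrite !inE ?orbF // => /eqP->.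
by move: sX tY; rewrite !inE => sX tY; apply: ltnW; apply: leq_trans tY.
Qed.

Lemma set2_XY s t s' t' : s \in Xs -> t \in Ys -> s' \in Xs -> t' \in Ys ->
  ([set s; t] == [set s'; t']) = (s == s') && (t == t').
Proof.
move=> sX tY s'X t'Y; apply/eqP/andP => [/setP E|[/eqP-> /eqP->//]]; split.
  have : s \in [set s'; t'] by rewrite -E set21.
  by case/set2P => [->//|st]; rewrite st -YsN t'Y in sX.
have : t \in [set s'; t'] by rewrite -E set22.
by case/set2P => [ts|->//]; rewrite ts -XsN s'X in tY.
Qed.

(** For sets with one p and one q the polarization is the map from V (x) W to its
quotient by R. *)
Lemma limg_polar00 : limg (polar (0%N, 0%N)) = fullv.
Proof.
apply/eqP; rewrite eqEsubv subvf /=; apply/subvP => y _.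
have w0 : wtset wt set0 == (0%N, 0%N) by rewrite wtsetE !set0I !cards0.
pose x0 : wsets n (0%N, 0%N) := exist _ set0 w0.
pose wj j : {ffun wsets n (shift11 (0%N, 0%N)) -> k^o} :=
  [ffun x => (val x == [set relx j; rely j])%:R].
suff -> : y = \sum_j y (x0, j) *: polar _ (wj j).
  by apply: memv_suml => j _; apply: memvZ; apply: memv_img; apply: memvf.
apply/ffunP => -[x l]; have -> : x = x0.
  apply: val_inj => /=; apply/eqP; rewrite -cards_eq0 card_setXY.
  by have := valP x; rewrite /= wtsetE => /eqP[-> ->].
rewrite sum_ffunE (bigD1 l) //= big1 ?addr0 => [|j jl]; rewrite ffunE lfunE ffunE /=.
  rewrite (rel_map_basis (j := l)) ?eqxx; first by rewrite [_ *: _]mulr1.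
  move=> s t sX tY; rewrite contract2_set0 // /ext insubT ?wtset_pair // => e.
  rewrite ffunE /=; congr (nat_of_bool _)%:R.
  by apply: set2_XY; rewrite ?relx_Xs ?rely_Ys.
rewrite (rel_map_basis (j := j)) ?(negPf jl); first by rewrite [_ *: _]mulr0.
move=> s t sX tY; rewrite contract2_set0 // /ext insubT ?wtset_pair // => e.
rewrite ffunE /=; congr (nat_of_bool _)%:R.
by apply: set2_XY; rewrite ?relx_Xs ?rely_Ys.
Qed.

Hypothesis char_k : 2%N \notin [pchar k].

Lemma lker_polar v : v != (0%N, 0%N) -> lker (polar v) = 0%VS.
Proof.
move=> v0; apply/eqP; rewrite -subv0; apply/subvP => w; rewrite memv_ker memv0.
move=> /eqP/polar_eq0 rel; apply/eqP/ffunP => x; rewrite ffunE -ext_val.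
apply: (polar_inj char_k (v := shift11 v)) => //; last by move=> T; apply: ext_out.
by move: v0; case: v {w rel x} => [[|x] [|y]] //= _; rewrite addnS.
Qed.

End PolarRank.

(** * Koszul homology of Z *)

Section KoszulHomology.
Variables (k : fieldType) (n : nat).
Local Notation N := ((n + n) + (n + n))%N.
Local Notation S := {mpoly k[N]}.
Local Notation pi := (@Zproj k n).
Local Notation wt := (@pq_wt n).
Local Notation Xs := (Xs n).
Local Notation Ys := (Ys n).
Local Notation K := (koszul_res k wt).
Local Notation polar := (@polar k n).
Implicit Types (F G : {set 'I_N} -> S) (v : nat * nat).

Lemma hchain_const v w : (forall T, wtset wt T != v -> w T = 0) ->
  hchain wt v (const_chain w : {set 'I_N} -> S).
Proof.
move=> w0 T a; rewrite mcoeffC; case: (eqVneq a 0%MM) => [->|]; last by rewrite mulr0 eqxx.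
by rewrite mulr1 bideg0 add0r => nz; apply/eqP; apply: contraNT nz => /w0->.
Qed.

Lemma size_supp v i F : (v.1 + v.2)%N = i ->
  (forall T, wtset wt T != v -> F T = 0) -> homog_chain i F.
Proof.
move=> vi F0 T Ti; apply: F0; apply: contraNneq Ti => Tv.
by rewrite card_setXY -vi -Tv wtsetE.
Qed.

Lemma ext_sum v r (c : 'I_r -> k) (w : 'I_r -> {ffun wsets n v -> k^o}) T :
  ext (\sum_j c j *: w j) T = \sum_j c j * ext (w j) T.
Proof.
rewrite /ext; case: insub => [x|]; last by rewrite big1 // => j _; rewrite mulr0.
by rewrite sum_ffunE; apply: eq_bigr => j _; rewrite ffunE.
Qed.

Lemma ext_restr v (u : {set 'I_N} -> k) : (forall T, wtset wt T != v -> u T = 0) ->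
  ext [ffun x : wsets n v => u (val x) : k^o] =1 u.
Proof.
move=> u0 T; rewrite /ext; case: insubP => [x _ <-|/u0->//].
by rewrite ffunE.
Qed.

Lemma kd_const_sum L r (c : 'I_r -> k) v (w : 'I_r -> {ffun wsets n v -> k^o}) T :
  \sum_j (c j)%:MP * koszul_d L (const_chain (ext (w j))) T =
  koszul_d L (const_chain (ext (\sum_j c j *: w j))) T.
Proof.
rewrite [RHS](_ : _ = koszul_d L (fun U => \sum_j (c j)%:MP * const_chain (ext (w j)) U) T).
  by rewrite kd_sum; apply: eq_bigr => j _; rewrite kdMl.
apply: eq_kd => U; rewrite /const_chain ext_sum raddf_sum.
by apply: eq_bigr => j _; rewrite /= mpolyCM.
Qed.

Lemma mcoeff_kd_const G (T : {set 'I_N}) s : s \notin T ->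
  (koszul_d setT G T)@_(U_(s))%MM = iota_ s (fun U => (G U)@_0%MM) T.
Proof.
move=> sT; rewrite mcoeff_kd /iota_ (negPf sT) (bigD1 s) /=; last first.
  by rewrite inE sT mnm1E eqxx.
rewrite big1 ?addr0 => [|s' /andP[/and3P[_ _ ss'] ne]]; last first.
  by move: ss'; rewrite mnm1E eq_sym (negPf ne).
congr (_ * _@__); apply/mnmP => j; rewrite mnmBE mnm0E; lia.
Qed.

Hypothesis char_k : 2%N \notin [pchar k].

(** In these bidegrees the boundary of a chain has no mixed monomial, because only
one kind of indeterminate occurs or because its coefficients have degree at most
1.  A cycle modulo I is then a cycle over S. *)
Lemma tor_rank_acyclic i v : (i, v) != (0%N, 0) ->
    [|| v.1 == 0%N, v.2 == 0%N | (v.1 + v.2 <= i)%N] ->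
  tor_rank (@Zgr k n) K i v 0.
Proof.
move=> nz hv; apply: (@tor_rank_koszul _ _ i v 0 (fun _ _ => 0)) => [[]//|F Fi hF cF|c G _ _ []//].
exists (fun=> 0), (koszul_h setT F); split; first exact: kh_size.
move=> T; rewrite big_ord0 subr0 -(koszul_acyclic Fi hF nz) ?subrr ?raddf0 // => {}T.
apply: (pi_unmixed_eq0 char_k (cF T)) => a; rewrite free_XsE free_YsE => nza.
have := hchain_kd (L:=setT) hF nza; rewrite addpE => e.
case: i nz hv Fi {cF} => [|i] nz hv Fi.
  by rewrite kd_size0 ?mcoeff0 ?eqxx in nza.
have := hchain_deg (kd_size setT Fi) (hchain_kd (L:=setT) hF) nza.
have e1 := congr1 fst e; have e2 := congr1 snd e; rewrite /= in e1 e2.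
by lia.
Qed.

(** Here Tor is k (x) Z = k, generated by the class of 1. *)
Lemma tor_rank_00 : tor_rank (@Zgr k n) K 0%N (0%N, 0%N) 1%N.
Proof.
pose b (T : {set 'I_N}) : S := if T == set0 then 1 else 0.
apply: (@tor_rank_koszul k n 0%N (0%N, 0%N) 1%N (fun _ => b)) => [_|F F0 hF _|c G Gi e j].
- split=> [T|T a|T]; rewrite /b.
  + by rewrite cards_eq0 => /negPf->.
  + case: (eqVneq T set0) => [->|_]; last by rewrite mcoeff0 eqxx.
    rewrite mcoeff1; case: (eqVneq a 0%MM) => [-> _|]; last by rewrite eqxx.
    by rewrite bideg0 /wtset big_set0.
  by rewrite kd_size0 ?raddf0 // => T'; rewrite cards_eq0 => /negPf->.
- exists (fun=> (F set0)@_0%MM), (fun=> 0); split=> // T.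
  rewrite kd_eq0 // subr0 big_ord1 /b; case: (eqVneq T set0) => [->|T0]; last first.
    by rewrite mulr0 subr0 F0 ?raddf0 // cards_eq0.
  rewrite mulr1 [X in pi X](_ : _ = 0) ?raddf0 //; apply/mpolyP => a.
  rewrite mcoeffB mcoeffC mcoeff0; case: (eqVneq a 0%MM) => [->|a0].
    by rewrite mulr1 subrr.
  rewrite mulr0 subr0; apply/eqP; apply: contraNT a0 => nza.
  have := hchain_deg F0 hF nza; rewrite addn0 => /eqP; rewrite addn_eq0 => /andP[/eqP x /eqP y].
  by apply/eqP/free_XY; rewrite ?free_XsE ?free_YsE ?x ?y.
have [/mpolyP/(_ 0%MM) + _ _] := (in_idealP char_k _).1 (e set0).
rewrite mcoeff_mrestr mcoeff0 big_ord1 /b eqxx mulr1 mcoeffB mcoeffC eqxx mulr1.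
have -> : free_of Ys 0%MM by rewrite free_YsE bideg0.
rewrite mcoeff_kd big_pred0 ?subr0 => [<-|s]; first by rewrite (ord1 j).
by rewrite mnm0E ltnn !andbF.
Qed.

(** After removing the pure parts, the coefficients are mixed of degree at least 3,
hence in I. *)
Lemma tor_rank_high i v : (i + 2 < v.1 + v.2)%N -> tor_rank (@Zgr k n) K i v 0.
Proof.
move=> lt; apply: (@tor_rank_koszul _ _ i v 0 (fun _ _ => 0)) => [[]//|F Fi hF cF|c G _ _ []//].
have [G [Gi hG GX GY]] := zcycle_mixed char_k Fi hF (ltnW lt) cF.
exists (fun=> 0), G; split=> // T; rewrite big_ord0 subr0.
apply/(in_idealP char_k); split; [exact: GX|exact: GY|].
apply: rel_coef0 => s t sX tY; apply/eqP; rewrite /mixed_coef; apply: contraTT lt.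
have hFG := hchainB hF (hchain_kd (L:=setT) hG).
move=> /(@hchain_deg _ _ v i (fun U => F U - koszul_d setT G U) T _) e.
have := e _ hFG; rewrite bideg_XY // => <- /=; first by lia.
by move=> T' T'i; rewrite Fi // (kd_size setT Gi) // subr0.
Qed.

(** The isomorphism from the kernel of the polarization is induced by d_X.  A cycle
F = d_X u + d_Y w is homologous to d_X (u - w), since subtracting d w removes
d_Y w and d_X w; it is a cycle modulo I when d_Y d_X (u - w) has coefficients in
R.  Conversely a boundary among the d_X w is detected by its linear
coefficients: comparing those in the q's and then those in the p's shows
that w = 0. *)
Lemma tor_rank_linear v i : (i + 1)%N = ((shift11 v).1 + (shift11 v).2)%N ->
  tor_rank (@Zgr k n) K i (shift11 v) (\dim (lker (polar v))).
Proof.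
move=> iv; pose B := vbasis (lker (polar v)).
have Bker (j : 'I_(\dim (lker (polar v)))) : polar v B`_j = 0.
  apply/eqP; rewrite -memv_ker; apply: vbasis_mem; apply: mem_nth.
  by rewrite size_tuple.
have iw w : (forall T, wtset wt T != shift11 v -> w T = 0) ->
    homog_chain i.+1 (const_chain w : {set 'I_N} -> S).
  move=> w0; apply: (@size_supp (shift11 v)) => [|T /w0]; first by lia.
  by rewrite /const_chain => ->; rewrite mpolyC0.
apply: (@tor_rank_koszul _ _ i (shift11 v) _ (fun j => koszul_d Xs (const_chain (ext B`_j)))).
- move=> j; split.
  + by apply: kd_size; apply: iw; apply: ext_out.
  + by apply: hchain_kd; apply: hchain_const; apply: ext_out.
  move=> T; rewrite kdXX kdYX; apply/(in_idealP char_k).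
  split; [exact: quad_pureX|exact: quad_pureY|].
  apply: rel_coef_ext; last exact: ((polar_eq0 _).1 (Bker j) T).
  by move=> s t sX tY; rewrite mixed_coef_quad.
- move=> F Fi hF cF; have [cX cY] := zcycle_pure char_k cF.
  have [u [w [u0 w0 FE]]] := linear_chain Fi hF iv cX cY.
  have uw0 T : wtset wt T != shift11 v -> u T - w T = 0.
    by move=> Tv; rewrite u0 // w0 // subrr.
  pose om : {ffun wsets n (shift11 v) -> k^o} := [ffun x => u (val x) - w (val x)].
  have omE T : ext om T = u T - w T by apply: (ext_restr uw0).
  have FwE T : F T - koszul_d setT (const_chain w) T = koszul_d Xs (const_chain (ext om)) T.
    rewrite FE kd_split opprD addrACA subrr addr0 -kdB; apply: eq_kd => U.
    by rewrite /const_chain omE raddfB.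
  have omker : om \in lker (polar v).
    rewrite memv_ker; apply/eqP/polar_eq0 => T.
    have : pi (koszul_d setT (koszul_d Xs (const_chain (ext om))) T) = 0.
      by rewrite -(eq_kd _ FwE) kdB kd_kd subr0.
    rewrite kdXX kdYX => /(in_idealP char_k)[_ _]; apply: rel_coef_ext => s t sX tY.
    exact: mixed_coef_quad.
  exists (fun j => coord B j om), (const_chain w); split; first exact: iw.
  move=> T; rewrite kd_const_sum -(coord_vbasis omker) -FwE addrAC subrr.
  exact: raddf0.
move=> c G Gi e; have /freeP fr := basis_free (vbasisP (lker (polar v))); apply: fr.
set om := (X in X = 0); rewrite -/B in om *.
pose g U := (G U)@_0%MM.
have iotaX s (T : {set 'I_N}) : s \in Xs -> s \notin T -> iota_ s (ext om) T = iota_ s g T.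
  move=> sX sT; have [/mpolyP/(_ U_(s)%MM) + _ _] := (in_idealP char_k _).1 (e T).
  rewrite kd_const_sum -/om mcoeff_mrestr mcoeff0 mcoeffB mcoeff_kd_const //.
  have -> : free_of Ys U_(s)%MM by rewrite free_YsE bidegU pq_wtE sX.
  rewrite mcoeff_kd (bigD1 s) /=; last by rewrite sX sT mnm1E eqxx.
  rewrite big1 ?addr0 => [|s' /andP[/and3P[_ _ ss'] ne]]; last first.
    by move: ss'; rewrite mnm1E eq_sym (negPf ne).
  rewrite mcoeffC (_ : (_ == 0%MM)); last first.
    by apply/eqP/mnmP => j; rewrite mnmBE mnm0E; lia.
  by rewrite mulr1 => /eqP; rewrite subr_eq0 => /eqP <-; rewrite /iota_ (negPf sT).
have iotaY s (T : {set 'I_N}) : s \in Ys -> s \notin T -> iota_ s g T = 0.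
  move=> sY sT; have [_ /mpolyP/(_ U_(s)%MM) + _] := (in_idealP char_k _).1 (e T).
  have sX : (s \in Xs) = false by apply/negbTE; rewrite XsN.
  rewrite kd_const_sum -/om mcoeff_mrestr mcoeff0 mcoeffB mcoeff_kd_const //.
  have -> : free_of Xs U_(s)%MM by rewrite free_XsE bidegU pq_wtE sX.
  rewrite mcoeff_kd big1 => [|s' /and3P[s'X _]]; last first.
    by rewrite mnm1E; case: eqP => // ss'; rewrite -ss' sX in s'X.
  by rewrite sub0r => /eqP; rewrite oppr_eq0 => /eqP.
apply/ffunP => x; rewrite ffunE -ext_val; set T := val x.
have := valP x; rewrite -/T wtsetE => /eqP[cX cY].
have [s] : exists s, s \in T :&: Xs by apply/card_gt0P; rewrite cX.
have [t] : exists t, t \in T :&: Ys by apply/card_gt0P; rewrite cY.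
rewrite !in_setI => /andP[tT tY] /andP[sT sX].
apply: (iota_inj sT); rewrite iotaX //; last by rewrite !inE eqxx.
have gT : g T = 0 by apply: (iota_inj tT); apply: iotaY => //; rewrite !inE eqxx.
by rewrite /iota_ !inE eqxx /= setD1K // gT mulr0.
Qed.

End KoszulHomology.

Section KoszulHomologyQuadratic.
Variables (k : fieldType) (n : nat).
Local Notation N := ((n + n) + (n + n))%N.
Local Notation S := {mpoly k[N]}.
Local Notation pi := (@Zproj k n).
Local Notation wt := (@pq_wt n).
Local Notation Xs := (Xs n).
Local Notation Ys := (Ys n).
Local Notation K := (koszul_res k wt).
Local Notation polar := (@polar k n).
Local Notation W v := {ffun wsets n v * relI n -> k^o}.
Implicit Types (F G : {set 'I_N} -> S) (v : nat * nat).

Definition extW v (y : W v) (T : {set 'I_N}) l : k :=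
  if insub T is Some x then y (x, l) else 0.

(** The chain with coefficients in the chosen complement of R in V (x) W whose
class modulo R is y. *)
Definition quad_chain v (y : W v) (T : {set 'I_N}) : S :=
  quad (rel_section (extW y T)).

Lemma hchain_quad_chain v (y : W v) : hchain wt (shift11 v) (quad_chain y).
Proof.
apply: hchain_quad => T s t _ _ Tv; rewrite /rel_section big1 // => l _.
by rewrite /extW insubN // mul0r.
Qed.

Lemma size_quad_chain v i (y : W v) : (i + 2)%N = ((shift11 v).1 + (shift11 v).2)%N ->
  homog_chain i (quad_chain y).
Proof.
move=> iv; apply: (size_supp (v := v)) => [|T Tv]; first by rewrite /shift11 /= in iv; lia.
rewrite /quad_chain /quad big1 // => s _; rewrite big1 // => t _.
rewrite /rel_section big1 ?mpolyC0 ?mul0r // => l _.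
by rewrite /extW insubN // mul0r.
Qed.

Lemma quad_chain_sum v r (c : 'I_r -> k) (y : 'I_r -> W v) T :
  \sum_j (c j)%:MP * quad_chain (y j) T = quad_chain (\sum_j c j *: y j) T.
Proof.
rewrite /quad_chain quad_sum; apply: eq_bigr => s _; apply: eq_bigr => t _.
congr (_%:MP * _); rewrite /rel_section.
under eq_bigr do rewrite mulr_sumr.
rewrite exchange_big; apply: eq_bigr => l _.
under eq_bigr do rewrite mulrA.
rewrite -mulr_suml; congr (_ * _); rewrite /extW; case: insub => [x|].
  by rewrite sum_ffunE; apply: eq_bigr => j _; rewrite ffunE.
by rewrite big1 // => j _; rewrite mulr0.
Qed.

(** The class modulo R of the mixed quadratic coefficients of a chain. *)
Definition rel_part v F : W v := [ffun p => rel_map (mixed_coef (F (val p.1))) p.2].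

Lemma rel_partB v F G : rel_part v (fun T => F T - G T) = rel_part v F - rel_part v G.
Proof.
apply/ffunP => p; rewrite !ffunE -rel_mapB; apply: rel_map_ext => s t _ _.
exact: mcoeffB.
Qed.

Lemma rel_part_quad_chain v (y : W v) : rel_part v (quad_chain y) = y.
Proof.
apply/ffunP => -[x l]; rewrite ffunE /=.
rewrite (rel_map_ext (g' := rel_section (extW y (val x)))).
  by rewrite rel_sectionK /extW valK.
by move=> s t sX tY; rewrite mixed_coef_quad.
Qed.

Lemma rel_part_polar v (w : {ffun wsets n (shift11 v) -> k^o}) :
  rel_part v (koszul_d Ys (koszul_d Xs (const_chain (ext w)))) = polar v w.
Proof.
rewrite lfunE; apply/ffunP => p; rewrite !ffunE; apply: rel_map_ext => s t sX tY.
by rewrite kdYX mixed_coef_quad.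
Qed.

Lemma kd_mrestr_deg v G T :
  mrestr (fun a => bideg wt a + wtset wt T == v) (koszul_d setT G T) =
  koszul_d setT (fun U => mrestr (fun a => bideg wt a + wtset wt U == v) (G U)) T.
Proof.
apply/mpolyP => a; rewrite mcoeff_mrestr !mcoeff_kd.
have E (s : 'I_N) : s \notin T -> (0 < a s)%N ->
    bideg wt (a - U_(s))%MM + wtset wt (s |: T) = bideg wt a + wtset wt T.
  move=> sT as0; rewrite wtsetU1 // addrA -(bidegU wt s) -bidegD.
  by rewrite submK // lep1mP -lt0n.
case: ifP => va; last first.
  by rewrite big1 // => s /and3P[_ sT as0]; rewrite mcoeff_mrestr E // va mulr0.
by apply: eq_bigr => s /and3P[_ sT as0]; rewrite mcoeff_mrestr E // va.
Qed.

Hypothesis char_k : 2%N \notin [pchar k].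

(** I is generated by bihomogeneous elements. *)
Lemma pi_mrestr_deg u v f : pi f = 0 ->
  pi (mrestr (fun a => bideg wt a + u == v) f) = 0.
Proof.
move=> /(in_idealP char_k)[fY fX fr]; apply/(in_idealP char_k); split.
- apply/mpolyP => a; rewrite !mcoeff_mrestr mcoeff0; case: ifP => // aY.
  case: ifP => // _; have := mcoeff_mrestr (free_of Ys) f a.
  by rewrite fY aY mcoeff0 => <-.
- apply/mpolyP => a; rewrite !mcoeff_mrestr mcoeff0; case: ifP => // aX.
  case: ifP => // _; have := mcoeff_mrestr (free_of Xs) f a.
  by rewrite fX aX mcoeff0 => <-.
have [uv|uv] := boolP ((1%N, 1%N) + u == v).
  by apply: rel_coef_ext fr => s t sX tY; rewrite /mixed_coef mcoeff_mrestr bideg_XY // uv.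
apply: rel_coef0 => s t sX tY.
by rewrite /mixed_coef mcoeff_mrestr bideg_XY // (negPf uv).
Qed.

Lemma rel_part_ideal v F : (forall T, pi (F T) = 0) -> rel_part v F = 0.
Proof.
move=> F0; apply/ffunP => p; rewrite !ffunE.
by have [_ _ /rel_mapP] := (in_idealP char_k _).1 (F0 (val p.1)).
Qed.

(** A chain of the right bidegree with mixed coefficients of degree 2 is zero
modulo I when its class modulo R is. *)
Lemma pi_chain_eq0 v F : hchain wt (shift11 v) F ->
    (forall T, pureX F T = 0) -> (forall T, pureY F T = 0) -> rel_part v F = 0 ->
  forall T, pi (F T) = 0.
Proof.
move=> hF FX FY Fr T; apply/(in_idealP char_k); split; [exact: FX|exact: FY|].
have [Tv|Tv] := boolP (wtset wt T == v).
  by apply/rel_mapP => l; have /ffunP/(_ (exist _ T Tv, l)) := Fr; rewrite !ffunE.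
apply: rel_coef0 => s t sX tY; apply/eqP; apply: contraNT Tv => /hF.
by rewrite bideg_XY // -add11 => /eqP; rewrite addpI.
Qed.

(** Modulo boundaries a cycle has mixed quadratic coefficients, and its class modulo
R matters only up to the image of the polarization, because
d (d_X w) = d_Y d_X w.  Conversely, let a chain with mixed coefficients be the
boundary of G modulo I, where G may be taken of the same bidegree.  Both pure
parts of G are cycles, so G = d_X u + d_Y w and d G = d_Y d_X (u - w). *)
Lemma tor_rank_quadratic v i : (i + 2)%N = ((shift11 v).1 + (shift11 v).2)%N ->
  tor_rank (@Zgr k n) K i (shift11 v) (\dim (limg (polar v))^C%VS).
Proof.
move=> iv; pose D := (limg (polar v))^C%VS; pose B := vbasis D.
apply: (@tor_rank_koszul _ _ i (shift11 v) _ (fun j => quad_chain B`_j)).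
- move=> j; split; [exact: size_quad_chain|exact: hchain_quad_chain|].
  move=> T; apply/(in_idealP char_k); split.
  + rewrite -/(pureX _ T) pureX_kd kd_eq0 // => U; exact: quad_pureX.
  + rewrite -/(pureY _ T) pureY_kd kd_eq0 // => U; exact: quad_pureY.
  apply: rel_coef0 => s t sX tY; apply/eqP; rewrite /mixed_coef.
  case: i iv => [|i] iv.
    by rewrite kd_size0 ?mcoeff0 //; apply: size_quad_chain.
  apply/negPn/negP => nz.
  have := hchain_deg (kd_size setT (size_quad_chain _ iv))
    (hchain_kd (L := setT) (hchain_quad_chain (y := B`_j))) nz.
  by move: iv; rewrite bideg_XY // /shift11 /=; lia.
- move=> F Fi hF cF.
  have [|G [Gi hG GX GY]] := zcycle_mixed char_k Fi hF _ cF; first by rewrite -iv.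
  pose F' T := F T - koszul_d setT G T.
  have [u uI [d dD yE]] : exists2 u, u \in limg (polar v) & exists2 d, d \in D &
      rel_part v F' = u + d.
    by apply/memv_addP; rewrite addv_complf memvf.
  have [w _ uE] := memv_imgP uI.
  exists (fun j => coord B j d), (fun T => G T + koszul_d Xs (const_chain (ext w)) T).
  have iw : homog_chain i.+1 (koszul_d Xs (const_chain (ext w) : {set 'I_N} -> S)).
    apply: kd_size; apply: (size_supp (v := shift11 v)) => [|T Tv]; first by lia.
    by rewrite /const_chain ext_out ?mpolyC0.
  split=> [T Ti|T]; first by rewrite Gi // iw // addr0.
  rewrite quad_chain_sum -(coord_vbasis dD) kdD opprD addrAC addrA addrAC -/(F' T).
  rewrite kdXX addrAC.
  apply: (pi_chain_eq0 (v := v) (F := fun T =>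
    F' T - koszul_d Ys (koszul_d Xs (const_chain (ext w))) T - quad_chain d T)).
  + apply: hchainB (hchain_quad_chain (y := d)); apply: hchainB.
      by apply: hchainB => //; apply: hchain_kd.
    by do 2!apply: hchain_kd; apply: hchain_const; apply: ext_out.
  + move=> U; rewrite /pureX 2!raddfB /= -/(pureX F' U) GX kdYX !quad_pureX.
    by rewrite !subr0.
  + move=> U; rewrite /pureY 2!raddfB /= -/(pureY F' U) GY kdYX !quad_pureY.
    by rewrite !subr0.
  by rewrite 2!rel_partB rel_part_quad_chain rel_part_polar yE uE addrAC addrK subrr.
move=> c G Gi e; have /freeP fr := basis_free (vbasisP D); apply: fr.
set d := (X in X = 0); rewrite -/B in d *.
have dD : d \in D.
  apply: memv_suml => j _; apply: memvZ; apply: vbasis_mem; apply: mem_nth.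
  by rewrite size_tuple.
(* the component of G in the bidegree of the chain that it bounds *)
pose G' U := mrestr (fun a => bideg wt a + wtset wt U == shift11 v) (G U).
have hG' : hchain wt (shift11 v) G'.
  by move=> T a; rewrite mcoeff_mrestr; case: ifP => [/eqP//|]; rewrite eqxx.
have Gi' : homog_chain i.+1 G' by move=> T Ti; rewrite /G' Gi ?raddf0.
have e' T : pi (quad_chain d T - koszul_d setT G' T) = 0.
  rewrite -kd_mrestr_deg -(mrestr_id (P := fun a => bideg wt a + wtset wt T == shift11 v)
     (f := quad_chain d T)).
    rewrite -raddfB /=; apply: pi_mrestr_deg.
    by rewrite -[RHS](e T) quad_chain_sum.
  by move=> a; rewrite mcoeff_msupp => /hchain_quad_chain/eqP.
have [|||u [w [u0 w0 GE]]] := linear_chain Gi' hG'.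
- by rewrite -iv addn1 addn2.
- move=> T; have [+ _ _] := (in_idealP char_k _).1 (e' T).
  by rewrite raddfB /= quad_pureX sub0r -/(pureX _ T) pureX_kd => /eqP; rewrite oppr_eq0 => /eqP.
- move=> T; have [_ + _] := (in_idealP char_k _).1 (e' T).
  by rewrite raddfB /= quad_pureY sub0r -/(pureY _ T) pureY_kd => /eqP; rewrite oppr_eq0 => /eqP.
have uw0 T : wtset wt T != shift11 v -> u T - w T = 0.
  by move=> Tv; rewrite u0 // w0 // subrr.
pose om : {ffun wsets n (shift11 v) -> k^o} := [ffun x => u (val x) - w (val x)].
have omE T : ext om T = u T - w T by apply: (ext_restr uw0).
have dGE T : koszul_d setT G' T = koszul_d Ys (koszul_d Xs (const_chain (ext om))) T.
  rewrite (eq_kd _ GE) kdD kdXX kdYY -kdB; apply: eq_kd => U; rewrite -kdB.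
  by apply: eq_kd => V; rewrite /const_chain omE raddfB.
have dE : d = polar v om.
  have := rel_part_ideal v e'; rewrite rel_partB rel_part_quad_chain.
  rewrite -rel_part_polar => /eqP; rewrite subr_eq0 => /eqP ->.
  by apply/ffunP => p; rewrite !ffunE dGE.
apply/eqP; rewrite -memv0 -(capv_compl (limg (polar v))) memv_cap dD andbT.
by rewrite dE memv_img ?memvf.
Qed.

End KoszulHomologyQuadratic.

(** * Betti numbers *)

Section BettiNumbers.
Variables (k : fieldType) (n : nat).
Hypothesis char_k : 2%N \notin [pchar k].
Local Notation N := ((n + n) + (n + n))%N.
Local Notation S := {mpoly k[N]}.
Local Notation wt := (@pq_wt n).
Local Notation K := (koszul_res k wt).
Local Notation polar := (@polar k n).

Lemma Zgr0 v : @Zgr k n v 0.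
Proof. by exists 0; rewrite ?raddf0 // => a; rewrite msupp0. Qed.

Lemma ZgrD v x y : @Zgr k n v x -> Zgr v y -> Zgr v (x + y).
Proof.
move=> [f hf ->] [g hg ->]; exists (f + g); last by rewrite raddfD.
by move=> a /msuppD_le; rewrite mem_cat => /orP[/hf|/hg].
Qed.

Lemma ZgrZ u v f x : bihomog wt u f -> @Zgr k n v x -> Zgr (u + v) (f *: x).
Proof.
move=> hf [g hg ->]; exists (f * g); last by rewrite scaleZ rmorphM.
by move=> a /msuppM_le/allpairsP[[b c] /= [/hf <- /hg <- ->]]; rewrite bidegD.
Qed.

Lemma graded_betti_koszul i v r :
  tor_rank (@Zgr k n) K i v r -> graded_betti wt (@Zgr k n) i v r.
Proof.
move=> tor; split; first exact: (inhabits K).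
by move=> P; apply: tor_rank_indep tor; [exact: Zgr0|exact: ZgrD|exact: ZgrZ].
Qed.

(** Natural-number form of the graded Betti numbers; the subtraction never
truncates, by [binomial_le]. *)
Definition betti_num i (v : nat * nat) : nat :=
  if (i == 0%N) && (v == (0%N, 0%N)) then 1%N
  else if (i == 1%N) && (v == (1%N, 1%N)) then (2 * n ^ 2 + n)%N
  else if [&& 2 <= i, 1 <= v.1, 1 <= v.2 & v.1 + v.2 == i + 2]%N
  then (n * (2 * n - 1) * 'C(2 * n, v.1 - 1) * 'C(2 * n, v.2 - 1)
    - 'C(2 * n, v.1) * 'C(2 * n, v.2))%N
  else 0%N.

Lemma dim_target v : \dim {: {ffun wsets n v * relI n -> k^o}} =
  (n * (2 * n - 1) * 'C(2 * n, v.1) * 'C(2 * n, v.2))%N.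
Proof. by rewrite dim_kffun card_prod card_relI card_wsets; lia. Qed.

Lemma dim_limg (v : nat * nat) : v != (0%N, 0%N) ->
  \dim (limg (polar v)) = ('C(2 * n, v.1.+1) * 'C(2 * n, v.2.+1))%N.
Proof.
move=> v0; have := @polar_rank_nullity k n v.
by rewrite (@lker_polar k n char_k v v0) dimv0 add0n card_wsets.
Qed.

(** The source of an injective linear map is no larger than its target. *)
Lemma binomial_le (v : nat * nat) : v != (0%N, 0%N) ->
  ('C(2 * n, v.1.+1) * 'C(2 * n, v.2.+1) <=
     n * (2 * n - 1) * 'C(2 * n, v.1) * 'C(2 * n, v.2))%N.
Proof. by move=> v0; rewrite -dim_limg // -dim_target dimvS ?subvf. Qed.

(** The special values come from the polarization at [1,1], whose kernel has
dimension 4n^2 - (2n^2-n) and whose cokernel is 0.  For i = 1 and v = [2,1] or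
[1,2] the cokernel vanishes because the two binomial products agree. *)
Theorem graded_betti_num i v : graded_betti wt (@Zgr k n) i v (betti_num i v).
Proof.
apply: graded_betti_koszul; rewrite /betti_num.
have [iv|iv] := boolP ((i == 0%N) && (v == (0%N, 0%N))).
  by case/andP: iv => /eqP-> /eqP->; apply: tor_rank_00.
have nz : (i, v) != (0%N, 0) by rewrite xpair_eqE.
have [hv|] := boolP [|| v.1 == 0%N, v.2 == 0%N | (v.1 + v.2 <= i)%N].
  rewrite ifN; last by apply: contraL hv => /andP[/eqP-> /eqP->].
  by rewrite ifN; [apply: tor_rank_acyclic|move: hv; lia].
rewrite !negb_or -ltnNge -!lt0n => /and3P[].
case: v iv nz => [[|a] [|b]] //= iv nz _ _ lt.
rewrite -/(shift11 (a, b)) in lt *.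
have [e1|ne1] := eqVneq (i + 1)%N (a.+1 + b.+1)%N.
  have := tor_rank_linear n char_k (v := (a, b)) e1.
  have [[ea eb]|ab0] := eqVneq (a, b) (0%N, 0%N).
    have -> : i = 1%N by lia.
    rewrite ea eb; have := @polar_rank_nullity k n (0%N, 0%N).
    rewrite limg_polar00 dim_target card_wsets /= !bin0 bin1 => e.
    by have -> : \dim (lker (polar (0%N, 0%N))) = (2 * n ^ 2 + n)%N by nia.
  rewrite (@lker_polar k n char_k (a, b) ab0) dimv0.
  rewrite ifN; last by apply: contra ab0 => /andP[_ /eqP[-> ->]].
  by rewrite ifN //; lia.
have [e2|ne2] := eqVneq (i + 2)%N (a.+1 + b.+1)%N; last first.
  rewrite ifN; last by apply: contra ne1 => /andP[/eqP-> /eqP[-> ->]].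
  by rewrite ifN; [apply: (@tor_rank_high k n char_k) => /=|]; lia.
have := tor_rank_quadratic n char_k (v := (a, b)) e2.
rewrite dimv_compl dim_target.
have [[ea eb]|ab0] := eqVneq (a, b) (0%N, 0%N).
  have -> : i = 0%N by lia.
  by rewrite ea eb limg_polar00 dim_target subnn.
rewrite dim_limg //= ifN; last by apply: contra ab0 => /andP[_ /eqP[-> ->]].
rewrite !subn1 /=; case: ifP => [//|h].
have {h} i1 : (i < 2)%N by move: h; lia.
have : (a, b) = (1%N, 0%N) \/ (a, b) = (0%N, 1%N).
  case: a b ab0 {iv nz lt ne1} e2 => [|[|a]] [|[|b]] //= ab0 e2; by [left|right|lia].
have e : ('C(2 * n, 2) = n * (2 * n - 1))%N.
  by rewrite bin2 -subn1; case: (n) => // m; rewrite -mulnA mul2n doubleK.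
case=> -[-> ->]; rewrite !bin0 !bin1 e.
  by rewrite (_ : _ - _ = 0)%N //; lia.
by rewrite (_ : _ - _ = 0)%N //; lia.
Qed.

Lemma betti_numE i v : (betti_num i v)%:Z =
  if (i == 0)%N && (v == (0, 0)%N) then 1
  else if (i == 1)%N && (v == (1, 1)%N) then 2 * n%:Z ^+ 2 + n%:Z
  else if [&& 2 <= i, 1 <= v.1, 1 <= v.2 & v.1 + v.2 == i + 2]%N
  then (2 * n%:Z ^+ 2 - n%:Z)
         * 'C(2 * n, v.1 - 1)%:Z * 'C(2 * n, v.2 - 1)%:Z
       - 'C(2 * n, v.1)%:Z * 'C(2 * n, v.2)%:Z
  else 0.
Proof.
rewrite /betti_num; case: ifP => // _; case: ifP => _; first by lia.
case: ifP => // /and4P[i2]; case: v => [[|a] [|b]] //= _ _ e.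
have := @binomial_le (a, b); rewrite xpair_eqE !subn1 /= => le.
rewrite -subzn; last by apply: le; lia.
rewrite !PoszM; congr (_ * _ * _ - _).
by case: (n) => [|m]; nia.
Qed.

(** Vandermonde's identity without its two extreme terms. *)
Lemma sum_binomial_products i :
  (\sum_(1 <= a < i.+2) 'C(2 * n, a) * 'C(2 * n, i + 2 - a) + 2 * 'C(2 * n, i + 2))%N
  = 'C(4 * n, i + 2).
Proof.
rewrite -[in RHS](_ : 2 * n + 2 * n = 4 * n)%N; last by lia.
rewrite -binomial.Vandermonde -(big_mkord xpredT (fun j => 'C(2 * n, j) * 'C(2 * n, i + 2 - j))%N).
rewrite addn2 [RHS]big_ltn // [in RHS]big_nat_recr //= subnn subn0 bin0; lia.
Qed.

Lemma betti_num_sum i : (2 <= i)%N ->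
  (\sum_(1 <= a < i.+2) betti_num i (a, i + 2 - a)%N)%:Z =
  (2 * n%:Z ^+ 2 - n%:Z) * 'C(4 * n, i)%:Z
                 - 'C(4 * n, i + 2)%:Z + 2 * 'C(2 * n, i + 2)%:Z.
Proof.
move=> i2; rewrite -(sum_binomial_products i).
have -> : 'C(4 * n, i) = (\sum_(1 <= a < i.+2) 'C(2 * n, a - 1) * 'C(2 * n, i + 2 - a - 1))%N.
  rewrite (_ : 4 * n = 2 * n + 2 * n)%N; last by lia.
  rewrite -binomial.Vandermonde big_add1 /= big_mkord; apply: eq_bigr => j _.
  by congr ('C(_, _) * 'C(_, _))%N; lia.
rewrite PoszD PoszM opprD addrA subrK !(big_morph Posz PoszD (erefl _)).
rewrite mulr_sumr -sumrB; apply: eq_big_nat => a /andP[a1 a2].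
have i0 : (i == 0%N) = false by apply/negbTE; rewrite -lt0n ltnW.
have i1 : (i == 1%N) = false by apply/negbTE; rewrite neq_ltn i2 orbT.
have h : [&& 2 <= i, 1 <= a, 1 <= i + 2 - a & a + (i + 2 - a) == i + 2]%N.
  by rewrite i2 a1 /=; lia.
rewrite betti_numE i0 i1 /= h.
by rewrite !PoszM mulrA.
Qed.

Lemma betti_support i v : v \notin
    (if i == 0%N then [:: (0%N, 0%N)] else if i == 1%N then [:: (1%N, 1%N)]
     else [seq (a, i + 2 - a)%N | a <- index_iota 1 i.+2]) ->
  betti_num i v = 0%N.
Proof.
rewrite /betti_num; have [->|i0] := eqVneq i 0%N; first by rewrite inE => /negPf->.
have [->|i1] := eqVneq i 1%N; first by rewrite inE => /negPf->.
move=> nin; rewrite ifN //; apply: contra nin => /and4P[i2 v1 v2 /eqP e].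
case: v v1 v2 e => a b /= a0 b0 e.
suff : (a, b) \in [seq (a, i + 2 - a)%N | a <- index_iota 1 i.+2] by [].
apply/mapP; exists a.
  by rewrite mem_index_iota a0 /=; lia.
by congr (_, _); lia.
Qed.

Lemma betti_total i : exists2 b : nat, betti wt (@Zgr k n) i b
  & b%:Z = if (i == 0)%N then 1
           else if (i == 1)%N then 2 * n%:Z ^+ 2 + n%:Z
           else (2 * n%:Z ^+ 2 - n%:Z) * 'C(4 * n, i)%:Z
                 - 'C(4 * n, i + 2)%:Z + 2 * 'C(2 * n, i + 2)%:Z.
Proof.
set s := if i == 0%N then [:: (0%N, 0%N)] else if i == 1%N then [:: (1%N, 1%N)]
     else [seq (a, i + 2 - a)%N | a <- index_iota 1 i.+2].
exists (\sum_(v <- s) betti_num i v)%N.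
  exists (betti_num i), s; split=> //; [exact: graded_betti_num| |exact: betti_support].
  rewrite /s; case: ifP => // _; case: ifP => // _.
  by rewrite map_inj_uniq ?iota_uniq // => x y [].
rewrite /s; have [->|i0] := eqVneq i 0%N; first by rewrite big_seq1.
have [->|i1] := eqVneq i 1%N; first by rewrite big_seq1 betti_numE.
by rewrite big_map betti_num_sum //; lia.
Qed.

End BettiNumbers.

(** * Algebraic dependence and chains of prime ideals *)

Section CoordinateSubrings.
Variables (k : fieldType) (N : nat).
Local Notation S := {mpoly k[N]}.
Implicit Types (L : {set 'I_N}) (f g : S).

Lemma free_ofD L (a b : 'X_{1..N}) : free_of L (a + b)%MM = free_of L a && free_of L b.
Proof.
apply/forall_inP/andP => [h|[/forall_inP ha /forall_inP hb] s sL].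
  by split; apply/forall_inP => s /h; rewrite mnmDE addn_eq0 => /andP[].
by rewrite mnmDE (eqP (ha s sL)) (eqP (hb s sL)).
Qed.

(** Setting the indeterminates of L to zero is multiplicative. *)
Lemma mrestr_freeM L f g :
  mrestr (free_of L) (f * g) = mrestr (free_of L) f * mrestr (free_of L) g.
Proof.
rewrite [in LHS](mpolyE f) mulr_suml raddf_sum [in RHS]/mrestr mulr_suml.
rewrite [RHS]big_mkcond; apply: eq_bigr => b _; rewrite -!scalerAl /=.
have -> (c : k) (h : S) : mrestr (free_of L) (c *: h) = c *: mrestr (free_of L) h.
  apply/mpolyP => a; rewrite !(mcoeff_mrestr, mcoeffZ).
  by case: ifP; rewrite ?mulr0.
have [fb|nfb] := boolP (free_of L b).
  by rewrite (@mrestrXM _ _ _ (free_of L)) // => a; rewrite free_ofD fb.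
rewrite (_ : mrestr _ _ = 0) ?scaler0 //; apply/mpolyP => a.
rewrite mcoeff_mrestr mcoeffXM mcoeff0; case: ifP => // fa; case: ifP => // ba.
by rewrite -(submK ba) free_ofD (negPf nfb) andbF in fa.
Qed.

Lemma mrestr_free1 L : mrestr (free_of L) (1 : S) = 1.
Proof.
apply: mrestr_id => a; rewrite msupp1 inE => /eqP->.
by apply/forall_inP => s _; rewrite mnm0E.
Qed.

Definition deg_le e f := forall a, f@_a != 0 -> (mdeg a <= e)%N.

Lemma deg_leM e e' f g : deg_le e f -> deg_le e' g -> deg_le (e + e')%N (f * g).
Proof.
move=> hf hg a; rewrite -mcoeff_msupp => /msuppM_le/allpairsP[[b c] /= [bf cg ->]].
by rewrite mdegD leq_add ?hf ?hg -?mcoeff_msupp.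
Qed.

Lemma deg_le1 : deg_le 0 1.
Proof. by move=> a; rewrite mcoeff1; case: (eqVneq a 0%MM) => [->|]; rewrite ?mdeg0 ?eqxx. Qed.

Lemma deg_leX e f j : deg_le e f -> deg_le (j * e)%N (f ^+ j).
Proof.
move=> hf; elim: j => [|j IH]; first exact: deg_le1.
by rewrite exprS mulSn; apply: deg_leM.
Qed.

Lemma deg_le_prod m e (g : 'I_m -> S) :
  (forall i, deg_le e (g i)) -> deg_le (m * e)%N (\prod_i g i).
Proof.
elim: m g => [|m IH] g hg; first by rewrite big_ord0; apply: deg_le1.
by rewrite big_ord_recl mulSn; apply: deg_leM => //; apply: IH.
Qed.

Lemma deg_le_trans e e' f : (e <= e')%N -> deg_le e f -> deg_le e' f.
Proof. by move=> le hf a /hf/leq_trans; apply. Qed.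

Lemma deg_le_exists f : exists e, deg_le e f.
Proof.
exists (msize f) => a; rewrite -mcoeff_msupp => /msize_mdeg_lt; exact: ltnW.
Qed.

Definition monval m D (R : comNzRingType) (y : 'I_m -> R) (al : {ffun 'I_m -> 'I_D.+1}) :=
  \prod_i y i ^+ al i.

(** The products of powers of the m polynomials with exponents at most D number
(D+1)^m, while they lie in the span of the monomials in #|~: L| indeterminates
with exponents at most a multiple of D; for large D the former number is
larger. *)
Lemma algebraic_dependence L m (g : 'I_m -> S) :
    (#|~: L| < m)%N -> (forall i, mrestr (free_of L) (g i) = g i) ->
  exists D (u : {ffun 'I_m -> 'I_D.+1} -> k),
    (exists al, u al != 0) /\ \sum_al (u al)%:MP * monval g al = 0.
Proof.
move=> Lm gL; set r := #|~: L| in Lm.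
have [d gd] : exists d, forall i, deg_le d (g i).
  have [e eP] := fin_all_exists (fun i => deg_le_exists (g i)).
  exists (\max_i e i) => i; apply: (deg_le_trans _ (eP i)).
  exact: leq_bigmax.
(* D + 1 exceeds C ^ r, and the exponents of the products are below C * (D + 1) *)
pose C := (m * d + 1)%N; pose D := (C ^ r)%N; pose E := (m * (D * d))%N.
pose A : finType := {ffun 'I_m -> 'I_D.+1}.
pose B : finType := {ffun {s : 'I_N | s \in ~: L} -> 'I_E.+1}.
have cardAB : (#|B| < #|A|)%N.
  rewrite !card_ffun !card_ord card_sig -/r.
  have EC : (E.+1 <= C * D.+1)%N by rewrite /E /C; nia.
  apply: (@leq_ltn_trans ((C * D.+1) ^ r)%N); first by case: (r) => // r'; rewrite leq_exp2r.
  rewrite expnMn -/D; apply: (@leq_trans (D.+1 * D.+1 ^ r)%N).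
    by rewrite ltn_pmul2r // expn_gt0.
  by rewrite -expnS leq_pexp2l.
pose box (b : B) : 'X_{1..N} :=
  [multinom (if insub s is Some x then val (b x) else 0%N) | s < N].
pose Mx := \matrix_(i < #|A|, j < #|B|) (monval g (enum_val i))@_(box (enum_val j)).
have : kermx Mx != 0.
  rewrite kermx_eq0 /row_free; apply: contraTneq cardAB => <-.
  by rewrite -leqNgt rank_leq_col.
case/rowV0Pn => w /sub_kermxP wM w0.
exists D, (fun al => w 0 (enum_rank al)); split.
  have [j wj] := rV0Pn _ w0.
  by exists (enum_val j); rewrite enum_valK.
have sumE a : (\sum_al (w 0 (enum_rank al))%:MP * monval g al)@_a =
    \sum_i w 0 i * (monval g (enum_val i))@_a.
  rewrite raddf_sum (reindex (fun i : 'I_#|A| => enum_val i)) /=; last first.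
    by exists enum_rank => x _; rewrite ?enum_valK ?enum_rankK.
  by apply: eq_bigr => i _; rewrite mcoeffCM enum_valK.
apply/mpolyP => a; rewrite sumE mcoeff0.
have [/andP[/forall_inP fa /forallP Ea]|nbox] :=
    boolP (free_of L a && [forall s, (a s <= E)%N]).
  pose b : B := [ffun x => inord (a (val x))].
  have -> : a = box b.
    apply/mnmP => s; rewrite mnmE; case: insubP => [x _ <-|].
      by rewrite ffunE /= inordK // ltnS.
    by rewrite inE negbK => /fa/eqP.
  have /rowP/(_ (enum_rank b)) := wM; rewrite !mxE => e.
  by rewrite -[RHS]e; apply: eq_bigr => i _; rewrite !mxE enum_rankK.
apply: big1 => i _; rewrite (_ : _@_a = 0) ?mulr0 //; apply/eqP.
apply: contraNT nbox => nz; apply/andP; split.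
  apply: contraTT nz => /negPf nfa; rewrite negbK.
  have <- : mrestr (free_of L) (monval g (enum_val i)) = monval g (enum_val i).
    rewrite /monval; elim/big_ind: _ => [|x y ex ey|j _].
    - exact: mrestr_free1.
    - by rewrite mrestr_freeM ex ey.
    elim: (nat_of_ord _) => [|e IH]; first exact: mrestr_free1.
    by rewrite exprS mrestr_freeM gL IH.
  by rewrite mcoeff_mrestr nfa.
have degm : deg_le E (monval g (enum_val i)).
  apply: deg_le_prod => j; apply: (deg_le_trans _ (deg_leX (gd j))).
  by rewrite leq_mul2r -ltnS ltn_ord orbT.
apply/forallP => s; apply: leq_trans (degm _ nz).
by rewrite mdegE (bigD1 s) //= leq_addr.
Qed.

(** Start from the support of u and keep, for i = 0, 1, and so on, the exponents
that are minimal in position i.  The partial sum over the exponents kept so far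
stays in c i: the common power of y i can be divided out because c i is prime
and does not contain y i, and the remaining multiples of y i lie in c (i+1).  At
the end a single term is left, and its coefficient is a unit in c m. *)
Lemma prime_chain_independent (R : comNzRingType) (kz : {rmorphism k -> R}) m D
    (c : nat -> {pred R}) (y : 'I_m -> R) (u : {ffun 'I_m -> 'I_D.+1} -> k) :
    prime_chain c m -> (forall i : 'I_m, y i \in c i.+1 /\ y i \notin c i) ->
    \sum_al kz (u al) * monval y al \in c 0%N ->
  forall al, u al = 0.
Proof.
move=> [cP cS] yP u0 al0; apply/eqP; apply: contraT => ual0.
have step i : (i <= m)%N -> exists A : {set {ffun 'I_m -> 'I_D.+1}},
    [/\ A != set0, {in A, forall al, u al != 0},
      forall al be : {ffun 'I_m -> 'I_D.+1}, al \in A -> be \in A ->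
        forall j : 'I_m, (j < i)%N -> al j = be j
      & \sum_(al in A) kz (u al) * \prod_(j < m | (i <= j)%N) y j ^+ al j \in c i].
  elim: i => [_|i IH im].
    exists [set al | u al != 0]; split=> //.
    - by apply/set0Pn; exists al0; rewrite inE.
    - by move=> al; rewrite inE.
    rewrite [X in X \in _](_ : _ = \sum_al kz (u al) * monval y al) //.
    rewrite [RHS](bigID (fun al => u al != 0)) /= [X in _ + X]big1 ?addr0.
      by apply: eq_bigl => al; rewrite inE.
    by move=> al; rewrite negbK => /eqP->; rewrite rmorph0 mul0r.
  have [A [/set0Pn[al1 al1A] Au Aagree Ac]] := IH (ltnW im).
  pose ii := Ordinal im.
  case: (arg_minnP (fun al : {ffun 'I_m -> 'I_D.+1} => val (al ii)) al1A) => al aA0 amin0.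
  have aA : al \in A := aA0.
  have amin be : be \in A -> (al ii <= be ii)%N := @amin0 be.
  pose A' := [set be in A | be ii == al ii].
  exists A'; split.
  - by apply/set0Pn; exists al; rewrite inE aA eqxx.
  - by move=> be; rewrite inE => /andP[/Au].
  - move=> be ga; rewrite !inE => /andP[bA /eqP bi] /andP[gA /eqP gi] j.
    rewrite ltnS leq_eqVlt => /orP[/eqP ji|/(Aagree _ _ bA gA)//].
    by rewrite (_ : j = ii) ?bi ?gi //; apply: val_inj.
  have [[c0 c1 cD] cp] := cP i (ltnW im).
  have [[c0' c1' cD'] cp'] := cP i.+1 im.
  have [cSi _] := cS i im.
  have [yi nyi] := yP ii.
  set P := (X in X \in _).
  pose rest (be : {ffun 'I_m -> 'I_D.+1}) :=
    kz (u be) * \prod_(j < m | (i < j)%N) y j ^+ be j.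
  (* the exponents outside A' leave at least one more factor y ii *)
  pose Q := \sum_(be in A | be \notin A') y ii ^+ (be ii - al ii).-1 * rest be.
  have sumE : \sum_(be in A) kz (u be) * \prod_(j < m | (i <= j)%N) y j ^+ be j =
      y ii ^+ al ii * (P + y ii * Q).
    have split_prod be : kz (u be) * \prod_(j < m | (i <= j)%N) y j ^+ be j =
        y ii ^+ be ii * rest be.
      rewrite (bigD1 ii) //= /rest mulrCA; congr (_ * (_ * _)).
      by apply: eq_bigl => j; rewrite [RHS]ltn_neqAle andbC -val_eqE /= eq_sym.
    under eq_bigr do rewrite split_prod.
    rewrite (bigID (fun be => be \in A')) /= mulrDr; congr (_ + _).
      rewrite /P mulr_sumr; apply: eq_big => [be|be /andP[_]].
        by rewrite inE; case: (be \in A).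
      by rewrite inE => /andP[_ /eqP->].
    rewrite /Q !mulr_sumr; apply: eq_bigr => be /andP[bA]; rewrite inE bA /= => ne.
    have le := amin _ bA.
    have lt : (al ii < be ii)%N by rewrite ltn_neqAle eq_sym val_eqE ne.
    rewrite !mulrA; congr (_ * _ * _); rewrite -mulrA -exprS -exprD; congr (_ ^+ _).
    by rewrite prednK ?subn_gt0 // subnKC // ltnW.
  rewrite sumE in Ac.
  have nyX j : y ii ^+ j \notin c i.
    elim: j => [//|j IHj]; apply/negP; rewrite exprS => /cp.
    by rewrite (negPf nyi) (negPf IHj).
  have /orP[] := cp _ _ Ac; first by rewrite (negPf (nyX _)).
  move/cSi => PQ; have -> : P = - Q * y ii + (P + y ii * Q) by ring.
  exact: cD'.
have [A [/set0Pn[al aA] Au Aagree]] := step m (leqnn m).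
have [[c0 c1 cD] _] := cP m (leqnn m).
have -> : A = [set al].
  apply/setP => be; rewrite inE; apply/idP/eqP => [bA|->//].
  by apply/ffunP => j; apply: Aagree.
rewrite big_set1 big_pred0 ?mulr1 => [|j]; last by rewrite leqNgt ltn_ord.
move=> ual; have := cD (kz (u al)^-1) _ _ ual c0.
by rewrite addr0 -rmorphM mulVf ?Au // rmorph1 (negPf c1).
Qed.

End CoordinateSubrings.

(** * Krull dimension and depth of Z *)

Section KrullDimension.
Variables (k : fieldType) (n : nat).
Hypothesis char_k : 2%N \notin [pchar k].
Local Notation N := ((n + n) + (n + n))%N.
Local Notation S := {mpoly k[N]}.
Local Notation Z := (Zring k n).
Local Notation pi := (@Zproj k n).
Local Notation Xs := (Xs n).
Local Notation Ys := (Ys n).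

(** The primes of the chain are generated by all the q's and an initial segment of
the p's. *)
Definition killed (j : nat) : {set 'I_N} := Ys :|: [set s : 'I_N | (s < j)%N].

Definition coord_prime (j : nat) : {pred Z} :=
  fun z => mrestr (free_of (killed j)) (repr z) == 0.

Lemma mrestr_subset (L L' : {set 'I_N}) (f : S) : L \subset L' ->
  mrestr (free_of L) f = 0 -> mrestr (free_of L') f = 0.
Proof.
move=> /subsetP LL' f0; apply/mpolyP => a; rewrite mcoeff_mrestr mcoeff0.
case: ifP => // /forall_inP aL'; have := mcoeff_mrestr (free_of L) f a.
rewrite f0 mcoeff0 ifT => [<-//|].
by apply/forall_inP => s /LL'; apply: aL'.
Qed.

Lemma coord_primeE j f : (pi f \in coord_prime j) = (mrestr (free_of (killed j)) f == 0).
Proof.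
rewrite /coord_prime -topredE /=; congr (_ == 0); apply/eqP; rewrite -subr_eq0 -raddfB /=.
apply/eqP/(@mrestr_subset Ys); first exact: subsetUl.
suff /(in_idealP char_k)[] : pi (repr (pi f) - f) = 0 by [].
by rewrite raddfB /= /Zproj reprK subrr.
Qed.

Lemma coord_prime_chain : prime_chain coord_prime (2 * n).
Proof.
split=> j jn; split.
- split; first by rewrite -(raddf0 pi) coord_primeE raddf0.
    by rewrite -(rmorph1 pi) coord_primeE mrestr_free1 oner_eq0.
  move=> a u w; have [fa ->] := pi_surj a; have [fu ->] := pi_surj u.
  have [fw ->] := pi_surj w; rewrite -rmorphM -rmorphD !coord_primeE.
  move=> /eqP u0 /eqP w0; rewrite raddfD /= mrestr_freeM.
  by rewrite u0 w0 mulr0 addr0.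
- move=> u w; have [fu ->] := pi_surj u; have [fw ->] := pi_surj w.
  by rewrite -rmorphM !coord_primeE mrestr_freeM mulf_eq0.
- move=> z; have [f ->] := pi_surj z; rewrite !coord_primeE => /eqP f0.
  apply/eqP/(mrestr_subset _ f0)/setUS/subsetP => s; rewrite !inE => sj.
  exact: ltnW.
have jN : (j < N)%N by move: jn; clear; lia.
exists (pi 'X_(Ordinal jN)); rewrite coord_primeE.
  apply/eqP/mpolyP => a; rewrite mcoeff_mrestr mcoeff0 mcoeffX.
  case: ifP => // /forall_inP h; case: eqP => // e.
  have := h (Ordinal jN); rewrite -e mnm1E eqxx => /(_ _)/eqP-> //.
  by rewrite !inE /= ltnSn orbT.
apply/negP => /eqP/mpolyP/(_ U_(Ordinal jN)%MM)/eqP.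
rewrite mcoeff_mrestr mcoeffX eqxx mcoeff0 ifT ?oner_eq0 //.
apply/forall_inP => s; rewrite !inE mnm1E => h; apply/eqP.
case: eqP => // e; move: h; rewrite -e /= ltnn orbF leqNgt.
by rewrite (_ : (j < n + n)%N) //; move: jn; clear; lia.
Qed.

Lemma prime_chain_sub (R : comNzRingType) (c : nat -> {pred R}) d e :
  (e <= d)%N -> prime_chain c d -> prime_chain c e.
Proof.
move=> ed [cP cS]; split=> j je; first exact: (cP j (leq_trans je ed)).
exact: (cS j (leq_trans je ed)).
Qed.

Lemma prime_chain_mono (R : comNzRingType) (c : nat -> {pred R}) d j :
  prime_chain c d -> (j <= d)%N -> {subset c 0%N <= c j}.
Proof.
move=> [_ cS]; elim: j => [|j IH] jd x xc; first by [].
by have [+ _] := cS j jd; apply; apply: IH => //; apply: ltnW.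
Qed.

(** The product of x in V and y in W squares to x x y y = 0. *)
Lemma prime_contains_side (P : {pred Z}) : idealr_closed P -> prime_idealr_closed P ->
  (forall s, s \in Xs -> zX k s \in P) \/ (forall t, t \in Ys -> zX k t \in P).
Proof.
move=> [P0 P1 PD] Pp.
have [/forall_inP|/forall_inPn[s sX sP]] := boolP [forall s in Xs, zX k s \in P].
  by left.
right=> t tY; have : zX k s * zX k t \in P.
  have : (zX k s * zX k t) * (zX k s * zX k t) \in P.
    by rewrite mulrA [_ * zX k s]mulrAC (zX_xxy char_k) // !mul0r.
  by move/Pp; rewrite orbb.
by move/Pp; rewrite (negPf sP).
Qed.

(** Every monomial that is dropped is a multiple of an indeterminate in L. *)
Lemma prime_contains_killed (P : {pred Z}) (L : {set 'I_N}) (f : S) : idealr_closed P ->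
    (forall s, s \in L -> zX k s \in P) -> pi (f - mrestr (free_of L) f) \in P.
Proof.
move=> [P0 P1 PD] LP; rewrite {1}(mpolyE f) /mrestr.
rewrite (bigID (free_of L)) /= addrC addrK raddf_sum.
have PA : forall u w, u \in P -> w \in P -> u + w \in P.
  by move=> u w uP wP; rewrite -[u]mul1r PD.
apply: (big_ind (fun z => z \in P)) => // a /forall_inPn[s sL as0].
rewrite /= -mul_mpolyC -(@submK _ U_(s)%MM a) ?lep1mP // mpolyXD mulrA rmorphM.
by rewrite -[X in X \in _]addr0 PD // LP.
Qed.

(** The lower bound is the chain [coord_prime].  For the upper bound, pick elements
in the successive steps of a chain; modulo the smallest prime they may be
replaced by polynomials in the indeterminates of one side only. *)
Lemma krull_dim_Z : krull_dim Z (2 * n).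
Proof.
split; first by exists coord_prime; apply: coord_prime_chain.
move=> c e ce; rewrite leqNgt; apply/negP => lt.
have {ce lt} := prime_chain_sub lt ce; set m := (2 * n).+1 => cm.
have [I0 p0] := cm.1 0%N (leq0n _).
have [L cardL LP] : exists2 L : {set 'I_N}, (#|~: L| < m)%N &
    forall s, s \in L -> zX k s \in c 0%N.
  have [h|h] := prime_contains_side I0 p0.
    by exists Xs => //; rewrite setCXs card_Ys.
  by exists Ys => //; rewrite setCYs card_Xs.
have H (i : 'I_m) : exists f : S, pi f \in c i.+1 /\ pi f \notin c i.
  have [_ [z z1 z0]] := cm.2 i (ltn_ord i).
  by have [f fE] := pi_surj z; exists f; rewrite -fE.
have [f fP] := fin_all_exists H.
pose g i := mrestr (free_of L) (f i).
have fgP i j : (j <= m)%N -> (pi (g i) \in c j) = (pi (f i) \in c j).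
  move=> jm; have [[_ _ cD] _] := cm.1 j jm.
  have d0 := prime_chain_mono cm jm (prime_contains_killed (f i) I0 LP).
  rewrite raddfB /= -/(g i) in d0; apply/idP/idP => h.
    by have := cD 1 _ _ d0 h; rewrite mul1r subrK.
  by have := cD (-1) _ _ d0 h; rewrite mulN1r opprB subrK.
have [|D [u [[al ual] u0]]] := @algebraic_dependence k N L m g cardL.
  move=> i; apply: mrestr_id => a; exact: mrestr_msupp.
have := @prime_chain_independent k Z (pi \o @mpolyC N k) m D c (fun i => pi (g i)) u cm.
move=> /(_ _ _ al) h; move: ual; rewrite h ?eqxx // => [i|].
  by have [f1 f0] := fP i; rewrite !fgP // ltnW.
have [c0 _ _] := I0; rewrite (_ : \sum_al0 _ = 0) // -[RHS](raddf0 pi) -u0 raddf_sum.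
apply: eq_bigr => be _; rewrite /= rmorphM /= /monval rmorph_prod.
by congr (_ * _); apply: eq_bigr => i _; rewrite rmorphXn.
Qed.

(** Multiplying x y by any indeterminate gives x x' y or x y y'. *)
Lemma socle_killed f i : hmax f -> pi f * (zX k (va i) * zX k (vc i)) = 0.
Proof.
rewrite /hmax => f0; rewrite (mpolyE f) raddf_sum mulr_suml big1_seq // => a /andP[_ af].
have [s as0] : exists s, (0 < a s)%N.
  apply/existsP; apply: contraTT af => /existsPn a0.
  rewrite mcoeff_msupp negbK (_ : a = 0%MM) ?f0 //.
  by apply/mnmP => s; rewrite mnm0E; apply/eqP; rewrite -leqn0 leqNgt a0.
rewrite -mul_mpolyC -(@submK _ U_(s)%MM a) ?lep1mP -?lt0n // mpolyXD.
rewrite /= !rmorphM /= -/(zX k s) -!mulrA [X in _ * (_ * X)](_ : _ = 0) ?mulr0 //.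
have [sX|] := boolP (s \in Xs).
  by rewrite mulrA (zX_xxy char_k) ?va_Xs ?vc_Ys.
by rewrite XsN => sY; rewrite mulrC (zX_xyy char_k) ?va_Xs ?vc_Ys.
Qed.

Lemma socle_neq0 i : zX k (va i) * zX k (vc i) != 0 :> Z.
Proof.
apply/eqP; rewrite -rmorphM -['X_(va i) * _]mul1r => /(in_idealP char_k)[_ _ [+ _ _]].
move=> /(_ i i)/eqP; rewrite !mixed_coef_mulXX ?va_Xs ?vb_Xs ?vc_Ys ?vd_Ys //.
rewrite !var_eqE !eqxx mulr0 oppr0 mulr1 mcoeff1 eqxx.
by rewrite oner_eq0.
Qed.

Lemma depth_Z : (1 <= n)%N -> depth Z (@hmax k N) 0.
Proof.
move=> n1; pose i : 'I_n := Ordinal n1; split.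
  exists [::]; split=> //; split=> //; exists 1 => -[w].
  by rewrite big_ord0 => /eqP; rewrite oner_eq0.
case=> [//|f s] [reg _] /(_ f (mem_head _ _)) fm.
have := reg 0%N isT (zX k (va i) * zX k (vc i)); rewrite /= scaleZ socle_killed //.
case; first by exists (fun=> 0); rewrite big_ord0.
by move=> w; rewrite big_ord0 => /eqP; rewrite (negPf (socle_neq0 i)).
Qed.

End KrullDimension.

Theorem theorem6p3 (n : nat) (k : fieldType)
    (n_ge1 : (1 <= n)%N) (char_k : 2%N \notin [pchar k]) :
  [/\ forall (i : nat) (v : nat * nat),
        exists2 b : nat,
          graded_betti (@pq_wt n) (@Zgr k n) i v b
        & b%:Z =
            if (i == 0)%N && (v == (0, 0)%N) then 1
            else if (i == 1)%N && (v == (1, 1)%N) then 2 * n%:Z ^+ 2 + n%:Z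
            else if [&& 2 <= i, 1 <= v.1, 1 <= v.2 & v.1 + v.2 == i + 2]%N
            then (2 * n%:Z ^+ 2 - n%:Z)
                   * 'C(2 * n, v.1 - 1)%:Z * 'C(2 * n, v.2 - 1)%:Z
                 - 'C(2 * n, v.1)%:Z * 'C(2 * n, v.2)%:Z
            else 0,
      forall i : nat,
        exists2 b : nat,
          betti (@pq_wt n) (@Zgr k n) i b
        & b%:Z =
            if (i == 0)%N then 1
            else if (i == 1)%N then 2 * n%:Z ^+ 2 + n%:Z
            else (2 * n%:Z ^+ 2 - n%:Z) * 'C(4 * n, i)%:Z
                 - 'C(4 * n, i + 2)%:Z + 2 * 'C(2 * n, i + 2)%:Z,
      krull_dim (Zring k n) (2 * n)
    & depth (Zring k n) (@hmax k ((n + n) + (n + n))) 0].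
Proof.
split.
- move=> i v; exists (betti_num n i v); first exact: graded_betti_num.
  by rewrite (betti_numE n char_k).
- exact: betti_total.
- exact: krull_dim_Z.
exact: depth_Z.
Qed.
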